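(* Let $\mathbb{K}=\mathbb{R}$ or $\mathbb{K}=\mathbb{C}$ and let $n\ge2$ be an integer such that there exists a maximal ETF in $\mathbb{K}^n$ (of cardinality $d=d_{\mathbb{K}}(n)$). Then there exists a unique (up to isometry) $n$-dimensional normed space $X$ over $\mathbb{K}$ satisfying $\lambda(X)=\lambda_{\mathbb{K}}(n)$ if and only if $n=2$ and $\mathbb{K}=\mathbb{R}$. In this case, the unit ball of $X$ is an affine image of a regular hexagon. In all other situations, there exist continuum many pairwise non-isometric $n$-dimensional normed spaces over $\mathbb{K}$ with the maximal projection constant, i.e. satisfying $\lambda(X)=\lambda_{\mathbb{K}}(n)$.
   Context: Isometric means linearly isometrically isomorphic over $\mathbb{K}$. For a linear subspace $Y$ of a normed space $Z$ over $\mathbb{K}$, $\lambda(Y,Z)$ is the infimum of $\|P\|$ over all linear projections $P:Z\to Y$ onto $Y$. The absolute projection constant $\lambda(X)$ is the supremum of $\lambda(S(X),Z)$ over all normed spaces $Z$ over $\mathbb{K}$ and all linear isometric embeddings $S:X\to Z$. $\lambda_{\mathbb{K}}(n)$ is the maximum of $\lambda(X)$ over all $n$-dimensional normed spaces $X$ over $\mathbb{K}$ (it is attained). $d_{\mathbb{R}}(n)=\frac{n(n+1)}{2}$ and $d_{\mathbb{C}}(n)=n^2$. With $\langle\cdot,\cdot\rangle$ the standard inner product, a set of pairwise distinct Euclidean unit vectors $w_1,\ldots,w_m\in\mathbb{K}^n$ is equiangular if $|\langle w_i,w_j\rangle|$ is constant over all $1\le i<j\le m$. It is an equiangular tight frame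 (ETF) if in addition, for some constant $\alpha$, $x=\alpha\sum_{i=1}^m\langle x,w_i\rangle w_i$ for every $x\in\mathbb{K}^n$. A maximal ETF in $\mathbb{K}^n$ is an ETF consisting of exactly $d_{\mathbb{K}}(n)$ vectors. *)

(* Defs.v *)
From HB Require Import structures.
From mathcomp Require Import all_boot all_order all_algebra.
From mathcomp Require Import all_classical all_reals all_analysis.
From mathcomp Require Import complex.

Set Implicit Arguments.
Unset Strict Implicit.
Unset Printing Implicit Defensive.

Import Order.TTheory GRing.Theory Num.Theory.
Import numFieldNormedType.Exports.

Local Open Scope classical_set_scope.
Local Open Scope ring_scope.

Inductive scalar_kind := RealScalars | ComplexScalars.

Definition scalars (R : realType) (k : scalar_kind) : numFieldType :=
  match k with
  | RealScalars => R
  | ComplexScalars => R[i]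
  end.

Definition scalar_re (R : realType) (k : scalar_kind) : scalars R k -> R :=
  match k return scalars R k -> R with
  | RealScalars => fun a => a
  | ComplexScalars => fun a => complex.Re a
  end.

Definition scalar_conj (R : realType) (k : scalar_kind) :
    scalars R k -> scalars R k :=
  match k return scalars R k -> scalars R k with
  | RealScalars => fun a => a
  | ComplexScalars => fun a => conjc a
  end.

(* The norm of a [normedModType K] takes its values in [K]. They are
   nonnegative elements of [K], hence real, so over [R[i]] the real part
   loses nothing. *)
Definition real_norm (R : realType) (k : scalar_kind)
    (V : normedModType (scalars R k)) (x : V) : R :=
  scalar_re `|x|.

Definition has_dimension (K : numFieldType) (n : nat) (V : normedModType K) :
    Prop :=
  exists f : {linear V -> 'rV[K]_n}, bijective f.

Definition isometric_embedding (K : numFieldType) (V W : normedModType K)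
    (S : {linear V -> W}) : Prop :=
  forall x, `|S x| = `|x|.

Definition isometric (K : numFieldType) (V W : normedModType K) : Prop :=
  exists S : {linear V -> W}, bijective S /\ isometric_embedding S.

Definition is_projection_onto (K : numFieldType) (Z : normedModType K)
    (Y : set Z) (P : {linear Z -> Z}) : Prop :=
  range P `<=` Y /\ forall y, Y y -> P y = y.

(* Equal to +oo when [P] is unbounded. *)
Definition operator_norm (R : realType) (k : scalar_kind)
    (V W : normedModType (scalars R k)) (P : {linear V -> W}) : \bar R :=
  ereal_sup [set (real_norm (P x))%:E | x in [set x : V | real_norm x <= 1]].

Definition relative_projection_constant (R : realType) (k : scalar_kind)
    (Z : normedModType (scalars R k)) (Y : set Z) : \bar R :=
  ereal_inf [set operator_norm P |
             P in [set P : {linear Z -> Z} | is_projection_onto Y P]].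

Definition projection_constant (R : realType) (k : scalar_kind)
    (X : normedModType (scalars R k)) : \bar R :=
  ereal_sup [set c | exists (Z : normedModType (scalars R k))
                            (S : {linear X -> Z}),
                       isometric_embedding S /\
                       c = relative_projection_constant (range S)].

Definition max_projection_constant (R : realType) (k : scalar_kind) (n : nat) :
    \bar R :=
  ereal_sup [set c | exists X : normedModType (scalars R k),
                       has_dimension n X /\ c = projection_constant X].

Definition maximal_space (R : realType) (k : scalar_kind) (n : nat)
    (X : normedModType (scalars R k)) : Prop :=
  has_dimension n X /\ projection_constant X = max_projection_constant R k n.

Definition max_ETF_size (k : scalar_kind) (n : nat) : nat :=
  match k with
  | RealScalars => ((n * n.+1) %/ 2)%N
  | ComplexScalars => (n ^ 2)%N
  end.

Definition inner_product (R : realType) (k : scalar_kind) (n : nat)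
    (x y : 'rV[scalars R k]_n) : scalars R k :=
  \sum_(j < n) x ord0 j * scalar_conj (y ord0 j).

Definition equiangular (R : realType) (k : scalar_kind) (n m : nat)
    (w : 'I_m -> 'rV[scalars R k]_n) : Prop :=
  [/\ injective w,
      (forall i, inner_product (w i) (w i) = 1) &
      exists c, forall i j : 'I_m, (i < j)%N ->
        `|inner_product (w i) (w j)| = c].

Definition equiangular_tight_frame (R : realType) (k : scalar_kind) (n m : nat)
    (w : 'I_m -> 'rV[scalars R k]_n) : Prop :=
  equiangular w /\
  exists a : scalars R k, forall x,
    x = a *: \sum_(i < m) inner_product x (w i) *: w i.

Definition maximal_ETF_exists (R : realType) (k : scalar_kind) (n : nat) :
    Prop :=
  exists w : 'I_(max_ETF_size k n) -> 'rV[scalars R k]_n,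
    equiangular_tight_frame w.

Definition convex_hull (R : realType) (V : lmodType R) (m : nat)
    (v : 'I_m -> V) : set V :=
  [set x | exists t : 'I_m -> R,
     [/\ forall i, 0 <= t i, \sum_(i < m) t i = 1 &
         x = \sum_(i < m) t i *: v i]].

Definition hexagon_vertex (R : realType) (c : 'rV[R]_2) (r theta : R)
    (i : 'I_6) : 'rV[R]_2 :=
  let phi := theta + i%:R * (pi / 3) in
  c + r *: \row_(j < 2) (if j == ord0 then cos phi else sin phi).

Definition regular_hexagon (R : realType) (H : set 'rV[R]_2) : Prop :=
  exists (c : 'rV[R]_2) (r theta : R),
    0 < r /\ H = convex_hull (hexagon_vertex c r theta).

Definition affine_map (R : realType) (V W : lmodType R) (f : V -> W) : Prop :=
  exists (L : {linear V -> W}) (b : W), forall x, f x = L x + b.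

Definition unit_ball_is_affine_regular_hexagon (R : realType)
    (X : normedModType R) : Prop :=
  exists (H : set 'rV[R]_2) (f : 'rV[R]_2 -> X),
    [/\ regular_hexagon H, affine_map f & [set x : X | `|x| <= 1] = f @` H].

(* Main.v *)
(* Trace duality and the Hahn-Banach theorem reduce an upper bound C for the
   projection constants of n-dimensional spaces to |tr T| <= C sum_j |z_j| for
   nuclear representations T = sum_j phi_j (x) z_j.  Orthonormalizing the
   functionals phi_j in the space L2 with weights |z_j| bounds the trace by
   sum_ij t_i t_j |<u_i, u_j>| with sum_i u_i u_i^* = 1 and sum_i t_i^2 = 1.  An
   even quartic that lies above the modulus, with contact at the angle of a
   maximal ETF, bounds this sum through the moments of orders two and four.

   Let w be a maximal ETF.  The norm max_i |<x, th_i>| attains the bound as soon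
   as the th_i contain the w_j and D <., th_i> is a combination of the <., w_j>
   with coefficients in the unit disc, where D = sum_j |<w_i, w_j>|.  Unless
   n = 2 and K = R, there is a further such vector g, exposed by a vector h;
   adjoining l g to w gives maximal spaces for all l <= 1.  An isometry between
   two of them permutes the th_i up to phases, so the ratio of the sum of fourth
   powers of the n x n minors of th to the squared sum of their squares is an
   invariant, and it is injective in l on an interval.

   If n = 2 and K = R, the constant is 4/3.  The equality case of the quartic
   inequality shows that nearly extremal functionals cluster at the vertices of
   a regular hexagon.  By compactness there are functionals G0, G2 such that G0,
   G2 and G0 + G2 have norm at most 1, and an operator T of trace at least 4/3
   with |T x| <= (|G0 x| + |G2 x| + |G0 x + G2 x|) / 3.  This forces T = 2/3 and
   |x| = max(|G0 x|, |G2 x|, |G0 x + G2 x|), a hexagonal norm. *)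
From HB Require Import structures.
Require Import Defs.
From mathcomp Require Import all_boot all_order all_algebra.
From mathcomp Require Import all_classical all_reals all_analysis.
From mathcomp Require Import complex ring lra zify.
Import Order.TTheory GRing.Theory Num.Theory.
Import numFieldNormedType.Exports.
Set Implicit Arguments.
Unset Strict Implicit.
Unset Printing Implicit Defensive.
Local Open Scope ring_scope.
Local Open Scope classical_set_scope.

(** * Scalars *)

Section scalar_field.
Variables (R : realType) (k : scalar_kind).
Local Notation K := (scalars R k).

(** The quartic is even because |<u_i, u_j>|^2 and |<u_i, u_j>|^4, unlike the modulus, are
    polynomial in the vectors. Sums of squares are bounded above through sum_i u_i u_i^* = 1, sums
    of fourth powers are bounded below by Cauchy-Schwarz against an isotropic tensor, and the
    coefficients of the quartic have the signs that these bounds require.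

    Neither the infimum over nuclear representations nor the supremum over the superspaces is
    assumed to be attained, so no exactly extremal configuration is at hand. The planar case
    therefore rests on a quantitative equality case, for which a defect term is kept in the
    inequality, and on a limit taken only in the coefficients of G0, G2 and T, which live on X
    itself.

    The exceptional case is the one without room between the angle c and 1. To find g, one product
    of size c must be pushed off the positive half-line by a perturbation smaller than 1 - c. Over C
    an imaginary perturbation does this; over R it takes c < 1/2, and the real plane has c = 1/2. *)

Lemma scalar_conj_is_additive : zmod_morphism (@scalar_conj R k).
Proof. by case: k => // x y; rewrite /= rmorphB. Qed.

Lemma scalar_conj_is_multiplicative : monoid_morphism (@scalar_conj R k).
Proof. by case: k; split => [|x y] //=; [rewrite oppr0|exact: (rmorphM (@conjc R))]. Qed.

Lemma scalar_re_is_additive : zmod_morphism (@scalar_re R k).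
Proof. by case: k => // -[a b] [a' b']. Qed.

Definition real_scalar : R -> K :=
  match k return R -> scalars R k with
  | RealScalars => fun a => a
  | ComplexScalars => fun a => a%:C%C
  end.

Lemma real_scalar_is_additive : zmod_morphism real_scalar.
Proof. by rewrite /real_scalar; case: k => // x y; rewrite /= rmorphB. Qed.

Lemma real_scalar_is_multiplicative : monoid_morphism real_scalar.
Proof.
by rewrite /real_scalar; case: k; split => [|x y] //=; exact: (rmorphM (real_complex R)).
Qed.

End scalar_field.
Arguments real_scalar {R k}.

HB.instance Definition _ (R : realType) (k : scalar_kind) :=
  GRing.isZmodMorphism.Build _ _ (@scalar_conj R k) (@scalar_conj_is_additive R k).
HB.instance Definition _ (R : realType) (k : scalar_kind) :=
  GRing.isMonoidMorphism.Build _ _ (@scalar_conj R k) (@scalar_conj_is_multiplicative R k).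
HB.instance Definition _ (R : realType) (k : scalar_kind) :=
  GRing.isZmodMorphism.Build _ _ (@scalar_re R k) (@scalar_re_is_additive R k).
HB.instance Definition _ (R : realType) (k : scalar_kind) :=
  GRing.isZmodMorphism.Build _ _ (@real_scalar R k) (@real_scalar_is_additive R k).
HB.instance Definition _ (R : realType) (k : scalar_kind) :=
  GRing.isMonoidMorphism.Build _ _ (@real_scalar R k) (@real_scalar_is_multiplicative R k).

Section scalar_theory.
Variables (R : realType) (k : scalar_kind).
Local Notation K := (scalars R k).
Local Notation conj := (@scalar_conj R k).
Local Notation re := (@scalar_re R k).
Local Notation rs := (@real_scalar R k).

Definition modulus (x : K) : R := re `|x|.

Lemma conjK : involutive conj.
Proof. by rewrite /scalar_conj; case: k => // x; rewrite conjcK. Qed.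

Lemma conj_real a : conj (rs a) = rs a.
Proof. by rewrite /scalar_conj /real_scalar; case: k => //; rewrite conjc_real. Qed.

Lemma re_real a : re (rs a) = a.
Proof. by rewrite /scalar_re /real_scalar; case: k. Qed.

Lemma re_realM a x : re (rs a * x) = a * re x.
Proof.
rewrite /scalar_re /real_scalar; case: k x => //= -[u v] /=.
by rewrite mul0r subr0.
Qed.

Lemma le_real a b : (rs a <= rs b) = (a <= b).
Proof. by rewrite /real_scalar; case: k => //=; rewrite lecR. Qed.

Lemma real_ge0 a : (0 <= rs a) = (0 <= a).
Proof. by rewrite -(rmorph0 rs) le_real. Qed.

Lemma real_inj : injective rs.
Proof. by rewrite /real_scalar; case: k => // x y; apply: complexI. Qed.

Lemma real_re x : 0 <= x -> rs (re x) = x.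
Proof.
rewrite /scalar_re /real_scalar; case: k x => // -[a b] /=.
by rewrite lecE /= => /andP[/eqP -> _].
Qed.

Lemma normE x : `|x| = rs (modulus x).
Proof. by rewrite real_re. Qed.

Lemma modulus_ge0 x : 0 <= modulus x.
Proof. by rewrite -real_ge0 -normE. Qed.

Lemma modulusM x y : modulus (x * y) = modulus x * modulus y.
Proof. by apply: real_inj; rewrite rmorphM /= -!normE normrM. Qed.

Lemma modulusD x y : modulus (x + y) <= modulus x + modulus y.
Proof. by rewrite -le_real rmorphD /= -!normE ler_normD. Qed.

Lemma modulusN x : modulus (- x) = modulus x.
Proof. by rewrite /modulus normrN. Qed.

Lemma modulus_eq0 x : (modulus x == 0) = (x == 0).
Proof. by rewrite -(inj_eq real_inj) -normE rmorph0 normr_eq0. Qed.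

Lemma modulus0 : modulus 0 = 0.
Proof. by apply/eqP; rewrite modulus_eq0. Qed.

Lemma modulus_real a : modulus (rs a) = `|a|.
Proof.
have h b : 0 <= b -> modulus (rs b) = b.
  by move=> b0; rewrite /modulus ger0_norm ?real_ge0// re_real.
have [a0|a0] := leP 0 a; first by rewrite h// ger0_norm.
by rewrite ltr0_norm// -{1}[a]opprK rmorphN /= modulusN h// oppr_ge0 ltW.
Qed.

Lemma modulus1 : modulus 1 = 1.
Proof. by rewrite -(rmorph1 rs) modulus_real normr1. Qed.

Lemma modulus_sum (I : finType) (P : pred I) (F : I -> K) :
  modulus (\sum_(i | P i) F i) <= \sum_(i | P i) modulus (F i).
Proof.
apply: (big_ind2 (fun x y => modulus x <= y)) => [|x1 x2 y1 y2 h1 h2|//].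
  by rewrite modulus0.
by apply: (le_trans (modulusD _ _)); apply: lerD.
Qed.

Lemma mul_conj x : x * conj x = rs (modulus x ^+ 2).
Proof.
rewrite rmorphXn /= -normE /scalar_conj; case: k x => [x|x] /=.
  by rewrite real_normK ?num_real// expr2.
by rewrite sqr_normc.
Qed.

Lemma modulus_conj x : modulus (conj x) = modulus x.
Proof.
have: modulus (conj x) ^+ 2 = modulus x ^+ 2.
  by apply: real_inj; rewrite -!mul_conj conjK mulrC.
by move/eqP; rewrite eqrXn2 ?modulus_ge0// => /eqP.
Qed.

Lemma re_le_modulus x : re x <= modulus x.
Proof.
apply: (le_trans (ler_norm _)); rewrite -le_real -normE.
rewrite /scalar_re /real_scalar; case: k x => [x|x] //=; exact: normc_ge_Re.
Qed.

Lemma modulus_phase x : exists s : K, modulus s = 1 /\ s * x = rs (modulus x).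
Proof.
have [->|x0] := eqVneq x 0.
  by exists 1; rewrite modulus1 modulus0 mulr0 rmorph0.
have m0 : modulus x != 0 by rewrite modulus_eq0.
exists (conj x * rs (modulus x)^-1); split.
  by rewrite modulusM modulus_conj modulus_real ger0_norm ?invr_ge0 ?modulus_ge0// divff.
by rewrite mulrAC (mulrC (conj x)) mul_conj -[rs _ * rs _]rmorphM /= expr2 mulfK.
Qed.

Lemma cauchy_schwarz (J : finType) (f g : J -> K) :
  modulus (\sum_j f j * conj (g j)) ^+ 2 <=
    (\sum_j modulus (f j) ^+ 2) * (\sum_j modulus (g j) ^+ 2).
Proof.
set a := \sum_j _ * _; set A := \sum_j _ ^+ 2; set B := \sum_j _ ^+ 2.
have A_K : \sum_j f j * conj (f j) = rs A.
  by rewrite rmorph_sum /=; apply: eq_bigr => j _; rewrite mul_conj.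
have B_K : \sum_j g j * conj (g j) = rs B.
  by rewrite rmorph_sum /=; apply: eq_bigr => j _; rewrite mul_conj.
have a_conj : \sum_j g j * conj (f j) = conj a.
  rewrite /a rmorph_sum /=; apply: eq_bigr => j _.
  by rewrite rmorphM /= conjK mulrC.
have B0 : 0 <= B by apply: sumr_ge0 => j _; rewrite sqr_ge0.
have expand (b c : K) : conj c = c ->
    \sum_j rs (modulus (c * f j - b * g j) ^+ 2) =
      c ^+ 2 * (\sum_j f j * conj (f j))
      - c * conj b * (\sum_j f j * conj (g j))
      - c * b * (\sum_j g j * conj (f j))
      + b * conj b * (\sum_j g j * conj (g j)).
  move=> c_real; rewrite !mulr_sumr -!sumrB -big_split /=.
  apply: eq_bigr => j _.
  by rewrite -mul_conj rmorphB !rmorphM /= c_real; ring.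
have {}expand : \sum_j modulus (rs B * f j - a * g j) ^+ 2 =
    B * (B * A - modulus a ^+ 2).
  apply: real_inj; rewrite rmorph_sum /= expand ?conj_real//.
  rewrite rmorphM rmorphB /= rmorphM /= -mul_conj A_K B_K a_conj -/a.
  by ring.
have := expand; set S := \sum_j _ => S_eq.
have S0 : 0 <= S by apply: sumr_ge0 => j _; rewrite sqr_ge0.
have [B_eq0|Bn0] := eqVneq B 0; last first.
  have Bp : 0 < B by rewrite lt_def Bn0.
  by move: S0; rewrite S_eq pmulr_rge0// subr_ge0 mulrC.
have g0 j : g j = 0.
  have : modulus (g j) ^+ 2 = 0.
    by apply: (psumr_eq0P _ B_eq0) => // i _; exact: sqr_ge0.
  by move/eqP; rewrite sqrf_eq0 modulus_eq0 => /eqP.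
rewrite /a big1 ?modulus0 ?expr0n ?B_eq0 ?mulr0// => j _.
by rewrite g0 rmorph0 mulr0.
Qed.
End scalar_theory.

Lemma real_cauchy_schwarz (R : realType) (J : finType) (f g : J -> R) :
  (\sum_j f j * g j) ^+ 2 <= (\sum_j f j ^+ 2) * (\sum_j g j ^+ 2).
Proof.
have mE (y : R) : @modulus R RealScalars y ^+ 2 = y ^+ 2.
  by rewrite /modulus /= real_normK ?num_real.
have := @cauchy_schwarz R RealScalars J f g; rewrite mE.
by congr (_ <= _ * _); apply: eq_bigr => j _; rewrite mE.
Qed.

(** * Moments of orders two and four *)

Section moments.
Variables (R : realType) (k : scalar_kind) (n : nat) (I : finType).
Local Notation K := (scalars R k).
Local Notation conj := (@scalar_conj R k).
Local Notation rs := (@real_scalar R k).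

Definition dotp (x y : 'I_n -> K) : K := \sum_a x a * conj (y a).

Let realM3 a b c : rs (a * b * c) = rs a * rs b * rs c.
Proof. by rewrite !rmorphM. Qed.

Lemma conj_dotp x y : conj (dotp x y) = dotp y x.
Proof.
rewrite rmorph_sum /=; apply: eq_bigr => a _.
by rewrite rmorphM /= conjK mulrC.
Qed.

Lemma modulus_dotpC x y : modulus (dotp x y) = modulus (dotp y x).
Proof. by rewrite -conj_dotp modulus_conj. Qed.

Lemma dotpp x : dotp x x = rs (\sum_a modulus (x a) ^+ 2).
Proof. by rewrite rmorph_sum; apply: eq_bigr => a _; rewrite mul_conj. Qed.

Lemma sum_sqr_modulusB (J : finType) (f g : J -> K) :
  rs (\sum_j modulus (f j - g j) ^+ 2) =
  \sum_j f j * conj (f j) - \sum_j f j * conj (g j)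
  - \sum_j g j * conj (f j) + \sum_j g j * conj (g j).
Proof.
rewrite rmorph_sum -!sumrB -big_split; apply: eq_bigr => j _ /=.
by rewrite -mul_conj rmorphB /=; ring.
Qed.

Lemma sum_delta (J : finType) (F : J -> K) b :
  \sum_a F a * (a == b)%:R = F b.
Proof.
rewrite (bigD1 b)//= eqxx mulr1 big1 ?addr0// => a /negPf ->.
by rewrite mulr0.
Qed.

(** With [H] = sum_i p_i v_i v_i^*, the left side is the squared Hilbert-Schmidt norm [h] of [H].
    The columns of [u] are orthonormal, so [L], the product of [u] with the conjugate of [H], has
    the same norm, and t u = p v gives <L, V> = h for the rows V_i = t_i v_i. Expanding |L - V|^2 >=
    0 leaves h <= |V|^2. *)
Lemma second_moment_le (t p : I -> R) (u v : I -> 'I_n -> K) :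
  (forall a b, \sum_i u i a * conj (u i b) = (a == b)%:R) ->
  (forall i a, rs (t i) * u i a = rs (p i) * v i a) ->
  (forall i, \sum_a modulus (v i a) ^+ 2 <= 1) ->
  \sum_i \sum_j p i * p j * modulus (dotp (v i) (v j)) ^+ 2 <= \sum_i t i ^+ 2.
Proof.
move=> iso tu v1.
pose H a b := \sum_i rs (p i) * (v i a * conj (v i b)).
have HH : \sum_a \sum_b H a b * conj (H a b) =
    rs (\sum_i \sum_j p i * p j * modulus (dotp (v i) (v j)) ^+ 2).
  transitivity (\sum_i \sum_j \sum_a \sum_b rs (p i) * rs (p j) *
      ((v i a * conj (v i b)) * (conj (v j a) * v j b))).
    rewrite [LHS](eq_bigr (fun a => \sum_i \sum_j \sum_b rs (p i) * rs (p j) *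
      ((v i a * conj (v i b)) * (conj (v j a) * v j b)))).
      rewrite exchange_big; apply: eq_bigr => i _; exact: exchange_big.
    move=> a _.
    rewrite [LHS](eq_bigr (fun b => \sum_i \sum_j rs (p i) * rs (p j) *
      ((v i a * conj (v i b)) * (conj (v j a) * v j b)))).
      rewrite exchange_big; apply: eq_bigr => i _; exact: exchange_big.
    move=> b _; rewrite rmorph_sum mulr_suml; apply: eq_bigr => i _.
    rewrite mulr_sumr; apply: eq_bigr => j _.
    by rewrite !rmorphM /= conjK conj_real; ring.
  rewrite rmorph_sum; apply: eq_bigr => i _ /=.
  rewrite rmorph_sum; apply: eq_bigr => j _ /=.
  rewrite realM3 -mul_conj conj_dotp mulr_suml mulr_sumr.
  apply: eq_bigr => a _; rewrite mulr_sumr mulr_sumr; apply: eq_bigr => b _.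
  by ring.
pose h := \sum_i \sum_j p i * p j * modulus (dotp (v i) (v j)) ^+ 2.
rewrite -/h in HH *.
pose L (ib : I * 'I_n) := \sum_a u ib.1 a * conj (H a ib.2).
pose V (ib : I * 'I_n) := rs (t ib.1) * v ib.1 ib.2.
have pairE (F : I * 'I_n -> K) : \sum_ib F ib = \sum_i \sum_b F (i, b).
  by rewrite pair_bigA /=; apply: eq_bigr => -[].
have LL : \sum_ib L ib * conj (L ib) = rs h.
  rewrite pairE -HH exchange_big [RHS]exchange_big; apply: eq_bigr => b _ /=.
  transitivity (\sum_a \sum_a' conj (H a b) * H a' b *
      (\sum_i u i a * conj (u i a'))).
    rewrite [LHS](eq_bigr (fun i => \sum_a \sum_a' conj (H a b) * H a' b *
      (u i a * conj (u i a')))).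
      rewrite exchange_big; apply: eq_bigr => a _.
      rewrite exchange_big; apply: eq_bigr => a' _.
      by rewrite mulr_sumr.
    move=> i _; rewrite rmorph_sum mulr_suml; apply: eq_bigr => a _.
    rewrite mulr_sumr; apply: eq_bigr => a' _.
    by rewrite rmorphM /= conjK; ring.
  apply: eq_bigr => a _.
  under eq_bigr do rewrite iso eq_sym.
  by rewrite sum_delta mulrC.
have LV : \sum_ib L ib * conj (V ib) = rs h.
  rewrite pairE -HH.
  rewrite [LHS](eq_bigr (fun i => \sum_b \sum_a conj (H a b) *
     (rs (p i) * (v i a * conj (v i b))))).
    rewrite exchange_big [RHS]exchange_big; apply: eq_bigr => b _ /=.
    rewrite exchange_big; apply: eq_bigr => a _ /=.
    by rewrite -mulr_sumr mulrC.
  move=> i _; apply: eq_bigr => b _; rewrite mulr_suml; apply: eq_bigr => a _.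
  by rewrite /V /= rmorphM /= conj_real [rs (p i) * (_ * _)]mulrA -tu; ring.
have VL : \sum_ib V ib * conj (L ib) = rs h.
  rewrite -[rs h]conj_real -LV rmorph_sum; apply: eq_bigr => ib _ /=.
  by rewrite rmorphM /= conjK mulrC.
have VV : \sum_ib V ib * conj (V ib) =
    rs (\sum_i t i ^+ 2 * \sum_a modulus (v i a) ^+ 2).
  rewrite pairE rmorph_sum; apply: eq_bigr => i _ /=.
  rewrite rmorphM /= -dotpp mulr_sumr; apply: eq_bigr => b _.
  by rewrite /V /= rmorphM /= conj_real; ring.
have := sum_sqr_modulusB L V.
rewrite LL LV VL VV subrr sub0r => eqh.
have: 0 <= - h + \sum_i t i ^+ 2 * \sum_a modulus (v i a) ^+ 2.
  rewrite -(@real_ge0 R k) rmorphD rmorphN /= -eqh real_ge0.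
  by apply: sumr_ge0 => ib _; rewrite sqr_ge0.
rewrite addrC subr_ge0 => /le_trans; apply.
apply: ler_sum => i _; rewrite ler_piMr ?sqr_ge0//.
Qed.

(** The number theta merges the formulas of the two fields: d = n (n + theta) / (1 + theta) and c^2
    = 1 / (n + 1 + theta). *)
Definition is_real_scalar : R := if k is RealScalars then 1 else 0.
Local Notation theta := is_real_scalar.

Lemma theta_sqr : theta * theta = theta.
Proof. by rewrite /theta; case: k; rewrite ?mulr1 ?mulr0. Qed.

(* The invariant tensor of order four; the last summand is invariant under
   the orthogonal group only. *)
Definition isotropic_tensor (a b c d : 'I_n) : K :=
  (a == c)%:R * (b == d)%:R + (a == d)%:R * (b == c)%:R
  + rs theta * ((a == b)%:R * (c == d)%:R).

Lemma contract_isotropic (G : 'I_n -> 'I_n -> 'I_n -> 'I_n -> K) :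
  \sum_a \sum_b \sum_c \sum_d G a b c d * isotropic_tensor a b c d =
  \sum_a \sum_b G a b a b + \sum_a \sum_b G a b b a
  + rs theta * \sum_a \sum_c G a a c c.
Proof.
have split3 a b c d : G a b c d * isotropic_tensor a b c d =
    G a b c d * (d == b)%:R * (c == a)%:R + G a b c d * (d == a)%:R * (c == b)%:R
    + rs theta * (G a b c d * (d == c)%:R * (b == a)%:R).
  rewrite /isotropic_tensor (eq_sym a c) (eq_sym b d) (eq_sym a d) (eq_sym b c).
  by rewrite (eq_sym a b) (eq_sym c d); ring.
under eq_bigr do under eq_bigr do under eq_bigr do under eq_bigr do rewrite split3.
under eq_bigr do under eq_bigr do under eq_bigr do rewrite !big_split /=.
under eq_bigr do under eq_bigr do rewrite !big_split /=.
under eq_bigr do rewrite !big_split /=.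
rewrite !big_split /=; congr (_ + _ + _).
- apply: eq_bigr => a _; apply: eq_bigr => b _.
  under eq_bigr do rewrite -mulr_suml sum_delta.
  by rewrite sum_delta.
- apply: eq_bigr => a _; apply: eq_bigr => b _.
  under eq_bigr do rewrite -mulr_suml sum_delta.
  by rewrite sum_delta.
- rewrite mulr_sumr; apply: eq_bigr => a _; rewrite mulr_sumr exchange_big /=.
  apply: eq_bigr => c _.
  under eq_bigr do rewrite -mulr_sumr -mulr_suml sum_delta.
  by rewrite -mulr_sumr sum_delta.
Qed.

Lemma isotropic_tensor_norm :
  \sum_a \sum_b \sum_c \sum_d
     isotropic_tensor a b c d * isotropic_tensor a b c d =
  rs ((2 + theta) * (n%:R * (n%:R + 1 + theta))).
Proof.
have one_sum : \sum_(a < n) \sum_(b < n) (1 : K) = n%:R * n%:R.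
  by rewrite !sumr_const !card_ord -mulrnA -natrM.
have delta_sum : \sum_(a < n) \sum_(b < n) (a == b)%:R = n%:R :> K.
  rewrite (eq_bigr (fun=> 1)) ?sumr_const ?card_ord// => a _.
  rewrite (eq_bigr (fun b => 1 * (b == a)%:R)) ?sum_delta// => b _.
  by rewrite mul1r eq_sym.
have dd (a b : 'I_n) : (a == b)%:R * (a == b)%:R = (a == b)%:R :> K.
  by case: eqP; rewrite ?mulr1 ?mulr0.
have th2 := congr1 rs theta_sqr; rewrite rmorphM /= in th2.
rewrite contract_isotropic.
rewrite (_ : \sum_a \sum_b _ = n%:R * n%:R + n%:R + rs theta * n%:R); last first.
  rewrite -{3 4}delta_sum -one_sum mulr_sumr -!big_split /=; apply: eq_bigr => a _.
  rewrite mulr_sumr -!big_split /=; apply: eq_bigr => b _.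
  by rewrite /isotropic_tensor !eqxx (eq_sym b a) !dd /=; ring.
rewrite (_ : \sum_a \sum_b _ = n%:R * n%:R + n%:R + rs theta * n%:R); last first.
  rewrite -{3 4}delta_sum -one_sum mulr_sumr -!big_split /=; apply: eq_bigr => a _.
  rewrite mulr_sumr -!big_split /=; apply: eq_bigr => b _.
  by rewrite /isotropic_tensor !eqxx (eq_sym b a) !dd /=; ring.
rewrite (_ : \sum_a \sum_c _ = n%:R + n%:R + rs theta * (n%:R * n%:R)); last first.
  rewrite -{1 2}delta_sum -one_sum mulr_sumr -!big_split /=; apply: eq_bigr => a _.
  rewrite mulr_sumr -!big_split /=; apply: eq_bigr => b _.
  by rewrite /isotropic_tensor !eqxx !dd /=; ring.
rewrite !rmorphM !rmorphD /= !rmorph_nat rmorph1 mulrDr [rs theta * (rs theta * _)]mulrA th2.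
rewrite [RHS](_ : _ = (2 + rs theta) * (n%:R * n%:R) + (2 + 3 * rs theta + rs theta * rs theta) * n%:R); last by ring.
by rewrite th2; ring.
Qed.

(** Cauchy-Schwarz between [f] = sum_i p_i v_i (x) v_i (x) conj v_i (x) conj v_i and the isotropic
    tensor [T]. The norm of [f] produces the fourth powers, while the pairing with [T] sees only the
    lengths |v_i| = 1. This is the Welch bound of order two. *)
Lemma fourth_moment_ge (p : I -> R) (v : I -> 'I_n -> K) :
  (forall i, p i != 0 -> dotp (v i) (v i) = 1) ->
  (2 + theta) * (\sum_i p i) ^+ 2 <=
  n%:R * (n%:R + 1 + theta) *
    \sum_i \sum_j p i * p j * modulus (dotp (v i) (v j)) ^+ 4.
Proof.
move=> v1; pose J := (('I_n * 'I_n) * ('I_n * 'I_n))%type.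
have sum4 (F : 'I_n -> 'I_n -> 'I_n -> 'I_n -> K) :
    \sum_(q : J) F q.1.1 q.1.2 q.2.1 q.2.2 = \sum_a \sum_b \sum_c \sum_d F a b c d.
  rewrite [RHS](pair_bigA _ (fun a b => \sum_c \sum_d F a b c d)) /=.
  rewrite [RHS](eq_bigr (fun ab => \sum_(cd : 'I_n * 'I_n) F ab.1 ab.2 cd.1 cd.2)).
    by rewrite [RHS]pair_bigA.
  by move=> ab _; rewrite [LHS](pair_bigA _ (fun c d => F ab.1 ab.2 c d)).
pose G i a b c d := v i a * v i b * conj (v i c) * conj (v i d).
pose f (q : J) := \sum_i rs (p i) * G i q.1.1 q.1.2 q.2.1 q.2.2.
pose T (q : J) := isotropic_tensor q.1.1 q.1.2 q.2.1 q.2.2.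
have T_real q : conj (T q) = T q.
  by rewrite /T /isotropic_tensor !rmorphD !rmorphM /= conj_real !rmorph_nat.
(* Over C both sides vanish with theta; over R conjugation is trivial and the bilinear square of w
   is <w, w>. *)
have theta_dot w : rs theta * ((\sum_a w a * w a) * (\sum_c conj (w c) * conj (w c)))
    = rs theta * (dotp w w * dotp w w).
  rewrite /theta /dotp /real_scalar /scalar_conj; case: k w => w //=.
  by rewrite !mul0r.
have fT : \sum_q f q * conj (T q) = rs ((2 + theta) * \sum_i p i).
  under eq_bigr do rewrite T_real mulr_suml.
  rewrite exchange_big /= mulr_sumr rmorph_sum; apply: eq_bigr => i _ /=.
  rewrite [LHS](eq_bigr (fun q => rs (p i) * (G i q.1.1 q.1.2 q.2.1 q.2.2 * T q))); last first.
    by move=> q _; rewrite mulrA.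
  rewrite -mulr_sumr /T (sum4 (fun a b c d => G i a b c d * isotropic_tensor a b c d)).
  rewrite contract_isotropic.
  have -> : \sum_a \sum_b G i a b a b = dotp (v i) (v i) * dotp (v i) (v i).
    rewrite mulr_suml; apply: eq_bigr => a _; rewrite mulr_sumr.
    by apply: eq_bigr => b _; rewrite /G; ring.
  have -> : \sum_a \sum_b G i a b b a = dotp (v i) (v i) * dotp (v i) (v i).
    rewrite mulr_suml; apply: eq_bigr => a _; rewrite mulr_sumr.
    by apply: eq_bigr => b _; rewrite /G; ring.
  have -> : \sum_a \sum_c G i a a c c =
      (\sum_a v i a * v i a) * (\sum_c conj (v i c) * conj (v i c)).
    rewrite mulr_suml; apply: eq_bigr => a _; rewrite mulr_sumr.
    by apply: eq_bigr => b _; rewrite /G; ring.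
  rewrite theta_dot.
  have [->|pn0] := eqVneq (p i) 0; first by rewrite mulr0 !rmorph0 mul0r.
  by rewrite v1// rmorphM rmorphD /= rmorph_nat; ring.
have TT : \sum_q T q * conj (T q) = rs ((2 + theta) * (n%:R * (n%:R + 1 + theta))).
  under eq_bigr do rewrite T_real.
  by rewrite /T (sum4 (fun a b c d => isotropic_tensor a b c d * isotropic_tensor a b c d)) isotropic_tensor_norm.
have ff : \sum_q f q * conj (f q) =
    rs (\sum_i \sum_j p i * p j * modulus (dotp (v i) (v j)) ^+ 4).
  transitivity (\sum_i \sum_j rs (p i) * rs (p j) * (\sum_q
      G i q.1.1 q.1.2 q.2.1 q.2.2 * conj (G j q.1.1 q.1.2 q.2.1 q.2.2))).
    rewrite [LHS](eq_bigr (fun q => \sum_i \sum_j rs (p i) * rs (p j) *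
      (G i q.1.1 q.1.2 q.2.1 q.2.2 * conj (G j q.1.1 q.1.2 q.2.1 q.2.2)))).
      rewrite exchange_big; apply: eq_bigr => i _.
      by rewrite exchange_big; apply: eq_bigr => j _; rewrite mulr_sumr.
    move=> q _; rewrite rmorph_sum mulr_suml; apply: eq_bigr => i _.
    rewrite mulr_sumr; apply: eq_bigr => j _.
    by rewrite rmorphM /= conj_real; ring.
  rewrite rmorph_sum; apply: eq_bigr => i _ /=.
  rewrite rmorph_sum; apply: eq_bigr => j _ /=.
  rewrite realM3; congr (_ * _).
  rewrite (sum4 (fun a b c d => G i a b c d * conj (G j a b c d))).
  rewrite (_ : rs (_ ^+ 4) = rs (modulus (dotp (v i) (v j)) ^+ 2) ^+ 2); last first.
    by rewrite -rmorphXn /= -exprM.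
  rewrite -mul_conj conj_dotp.
  transitivity (dotp (v i) (v j) * (dotp (v i) (v j) * (dotp (v j) (v i) * dotp (v j) (v i)))); last by ring.
  rewrite mulr_suml; apply: eq_bigr => a _.
  rewrite mulr_suml mulr_sumr; apply: eq_bigr => b _.
  rewrite mulr_suml !mulr_sumr; apply: eq_bigr => c _.
  rewrite !mulr_sumr; apply: eq_bigr => d _.
  by rewrite /G !rmorphM /= !conjK; ring.
have := cauchy_schwarz f T.
have sqE (F : J -> K) (x : R) : \sum_q F q * conj (F q) = rs x ->
    \sum_q modulus (F q) ^+ 2 = x.
  by move=> Fx; apply: (@real_inj R k); rewrite -Fx rmorph_sum; apply: eq_bigr => q _; rewrite mul_conj.
rewrite (sqE _ _ ff) (sqE _ _ TT) fT modulus_real real_normK ?num_real//.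
set S4 := \sum_i _; set S1 := \sum_i _.
have th0 : 0 < 2 + theta by rewrite /theta; case: k; lra.
rewrite (_ : S4 * _ = (2 + theta) * (n%:R * (n%:R + 1 + theta) * S4)); last by ring.
rewrite (_ : (_ * S1) ^+ 2 = (2 + theta) * ((2 + theta) * S1 ^+ 2)); last by ring.
by rewrite ler_pM2l.
Qed.

End moments.

(** * Positive definite matrices *)

Section gram_schmidt.
Variables (R : realType) (k : scalar_kind).
Local Notation K := (scalars R k).
Local Notation conj := (@scalar_conj R k).
Local Notation re := (@scalar_re R k).
Local Notation rs := (@real_scalar R k).

Definition adjmx m n (A : 'M[K]_(m, n)) : 'M[K]_(n, m) := map_mx conj A^T.

Lemma adjmxM m n p (A : 'M[K]_(m, n)) (B : 'M[K]_(n, p)) :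
  adjmx (A *m B) = adjmx B *m adjmx A.
Proof. by rewrite /adjmx trmx_mul map_mxM. Qed.

Lemma adjmxK m n (A : 'M[K]_(m, n)) : adjmx (adjmx A) = A.
Proof. by apply/matrixP => i j; rewrite !mxE conjK. Qed.

Definition posdef n (G : 'M[K]_n) :=
  adjmx G = G /\ forall x : 'cV[K]_n, x != 0 -> 0 < re ((adjmx x *m G *m x) ord0 ord0).

Lemma posdef_congr n (G L : 'M[K]_n) :
  L \in unitmx -> posdef G -> posdef (adjmx L *m G *m L).
Proof.
move=> Lu [Gh Gp]; split.
  by rewrite !adjmxM adjmxK Gh mulmxA.
move=> x x0; rewrite !mulmxA -adjmxM -!mulmxA mulmxA.
apply: Gp; apply: contraNneq x0 => Lx0.
by rewrite -(mulKmx Lu x) Lx0 mulmx0.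
Qed.

Lemma adjmx_block m1 m2 n1 n2 (A : 'M[K]_(m1, n1)) B C (D : 'M[K]_(m2, n2)) :
  adjmx (block_mx A B C D) = block_mx (adjmx A) (adjmx C) (adjmx B) (adjmx D).
Proof. by rewrite /adjmx tr_block_mx map_block_mx. Qed.

Lemma adjmx_scalar n (a : K) : adjmx (a%:M : 'M[K]_n) = (conj a)%:M.
Proof. by rewrite /adjmx tr_scalar_mx map_scalar_mx. Qed.

Lemma adjmx0 m n : adjmx (0 : 'M[K]_(m, n)) = 0.
Proof. by rewrite /adjmx trmx0 map_mx0. Qed.

Lemma adjmx_sub_block n1 n2 (H : 'M[K]_(n1 + n2)) : adjmx H = H ->
  [/\ adjmx (ulsubmx H) = ulsubmx H, adjmx (ursubmx H) = dlsubmx H &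
      adjmx (drsubmx H) = drsubmx H].
Proof.
by rewrite -{1 2}[H]submxK adjmx_block => /eq_block_mx[-> _ -> ->].
Qed.

Lemma conj_id_real (a : K) : conj a = a -> a = rs (re a).
Proof.
rewrite /scalar_conj /scalar_re /real_scalar; case: k a => // -[u v] [] /= Nv.
by congr Complex; lra.
Qed.

(** Eliminating the first row and column by the congruence [L] leaves the Schur complement [S],
    which is again positive definite and subject to the induction; the pivot [g] is scaled to 1. *)
Lemma posdef_orthonormalize n (G : 'M[K]_n) : posdef G ->
  exists2 P : 'M[K]_n, P \in unitmx & adjmx P *m G *m P = 1%:M.
Proof.
elim: n G => [|n IH] G Gp.
  exists 1%:M; first exact: unitmx1.
  by apply/matrixP => -[].
rewrite -[n.+1]/(1 + n)%N in G Gp *.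
have [Gh Gpos] := Gp.
have [ulG urG drG] := adjmx_sub_block Gh.
pose a := G 0 0; pose g := re a.
have ulE : ulsubmx G = a%:M.
  apply/matrixP => i j; rewrite !mxE !ord1 eqxx mulr1n /a.
  by congr (G _ _); apply: val_inj.
have aE : a = rs g.
  apply: conj_id_real; move: ulG; rewrite ulE adjmx_scalar => /matrixP/(_ 0 0).
  by rewrite !mxE.
have g0 : 0 < g.
  have := Gpos (col_mx 1%:M 0).
  rewrite -{1}[G]submxK ulE.
  rewrite /adjmx tr_col_mx trmx1 trmx0 map_row_mx map_mx1 map_mx0.
  rewrite mul_row_block mul_row_col !mul0mx !mulmx0 !addr0 mul1mx mulmx1 !mxE eqxx.
  apply; apply/eqP => /eqP; rewrite col_mx_eq0 => /andP[/eqP/matrixP/(_ 0 0)].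
  by rewrite !mxE => /eqP; rewrite oner_eq0.
set b := ursubmx G in urG *.
pose L := block_mx 1%:M (- rs g^-1 *: b) 0 1%:M : 'M[K]_(1 + n).
have Lu : L \in unitmx by rewrite unitmxE det_ublock !det1 mul1r unitr1.
pose H := adjmx L *m G *m L.
have Hp : posdef H by exact: posdef_congr.
have adjb : adjmx (- rs g^-1 *: b) = - rs g^-1 *: adjmx b.
  by apply/matrixP => i j; rewrite !mxE rmorphM rmorphN /= conj_real.
have [S HE] : exists S, H = block_mx a%:M 0 0 S.
  rewrite /H /L -[G]submxK -urG -/b ulE adjmx_block !adjmx_scalar rmorph1.
  rewrite adjmx0 adjb !mulmx_block !mul1mx !mul0mx !mulmx1 !mulmx0 !addr0.
  have gg : a * (- rs g^-1) = -1.
    by rewrite aE mulrN -rmorphM /= mulfV ?gt_eqF// rmorph1.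
  have -> : a%:M *m (- rs g^-1 *: b) + b = 0.
    by rewrite mul_scalar_mx scalerA gg scaleN1r addNr.
  have -> : - rs g^-1 *: adjmx b *m a%:M + adjmx b = 0.
    by rewrite mul_mx_scalar scalerA gg scaleN1r addNr.
  by rewrite mul0mx add0r; eexists; reflexivity.
have Sp : posdef S.
  have [Hh Hpos] := Hp; split.
    have [_ _] := adjmx_sub_block Hh.
    by rewrite HE block_mxKdr.
  move=> x x0; have := Hpos (col_mx 0 x).
  rewrite HE /adjmx tr_col_mx trmx0 map_row_mx map_mx0.
  rewrite mul_row_block mul_row_col !mul0mx !mulmx0 !add0r; apply.
  by rewrite col_mx_eq0 negb_and x0 orbT.
have [P Pu PE] := IH S Sp.
pose Q := block_mx (rs (Num.sqrt g)^-1)%:M 0 0 P : 'M[K]_(1 + n).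
exists (L *m Q).
  rewrite unitmx_mul Lu unitmxE det_ublock det_scalar expr1 unitrM -unitmxE Pu andbT.
  by rewrite rmorph_unit// unitfE invr_eq0 sqrtr_eq0 -ltNge.
rewrite adjmxM !mulmxA -[_ *m G *m L]/(_) -(mulmxA (adjmx Q)) -(mulmxA (adjmx Q)) -/H.
rewrite HE adjmx_block !adjmx0 !mulmx_block !mul0mx !mulmx0 !addr0 !add0r PE.
rewrite !mul0mx adjmx_scalar conj_real -!scalar_mxM aE -!rmorphM /=.
rewrite mulrAC -expr2 exprVn sqr_sqrtr ?ltW// mulVf ?gt_eqF// rmorph1.
by rewrite -scalar_mx_block.
Qed.
End gram_schmidt.

(** * The extremal constant and the quartic *)

Section kll.
Variables (R : realType) (k : scalar_kind) (n : nat).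
Hypothesis n_ge2 : (2 <= n)%N.
Local Notation theta := (is_real_scalar R k).

(* The common value of |<w_i, w_j>| in a maximal ETF. *)
Definition etf_angle : R := (Num.sqrt (n%:R + 1 + theta))^-1.
Local Notation c := etf_angle.

Definition etf_size : R := n%:R * (n%:R + theta) / (1 + theta).

(** The value of sum_ij t_i t_j |<u_i, u_j>| at a maximal ETF, with u_i = (n / d)^(1/2) w_i and t_i
    = d^(-1/2). *)
Definition etf_constant : R := n%:R / etf_size * (1 + (etf_size - 1) * c).

(* a + b x^2 - e x^4 is the even quartic that touches x at c and meets it
   at 1. *)
Definition quartic_e : R := (2 * c * (1 + c) ^+ 2)^-1.
Definition quartic_a : R := quartic_e * c ^+ 2 * (1 + 2 * c).
Definition quartic_b : R := quartic_e * (1 + 2 * c + 3 * c ^+ 2).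
(** The mean of |<x, y>|^4 over independent, uniformly distributed unit vectors x and y. *)
Definition welch_constant : R := (2 + theta) / (n%:R * (n%:R + 1 + theta)).

Lemma theta01 : theta = 0 \/ theta = 1.
Proof. by rewrite /is_real_scalar; case: k; [right|left]. Qed.

Let n2 : 2 <= n%:R :> R. Proof. by rewrite ler_nat. Qed.
Let th0 : 0 <= theta. Proof. by case: theta01 => ->. Qed.

Lemma etf_angle_gt0 : 0 < c.
Proof. by rewrite invr_gt0 sqrtr_gt0; have := n2; have := th0; lra. Qed.

Lemma etf_angle_sqr : (n%:R + 1 + theta) * c ^+ 2 = 1.
Proof.
rewrite exprVn sqr_sqrtr ?mulfV//; have := n2; have := th0; last by lra.
by move=> *; apply/eqP; lra.
Qed.

Lemma quartic_e_gt0 : 0 < quartic_e.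
Proof.
have c0 := etf_angle_gt0; have c1 : 0 < 1 + c by lra.
by rewrite invr_gt0 !(mulr_gt0, exprn_gt0).
Qed.

(** A double root at c and a root at 1 leave one more root, which must be -(1 + 2 c) because the
    cubic term is absent. The factor [quartic_e] makes the linear coefficient -1. *)
Lemma quartic_identity x :
  quartic_a + quartic_b * x ^+ 2 - quartic_e * x ^+ 4 - x =
  quartic_e * ((x - c) ^+ 2 * (1 - x) * (x + 1 + 2 * c)).
Proof.
have c0 := etf_angle_gt0.
have c1 : 0 < 1 + c by lra.
have e1 : quartic_e * (2 * c * (1 + c) ^+ 2) = 1.
  by rewrite mulVf// gt_eqF// !(mulr_gt0, exprn_gt0).
rewrite -[X in _ - X]mul1r -[X in _ - X * _ = _]e1 /quartic_a /quartic_b; ring.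
Qed.

Lemma etf_angle_lt1 : c < 1.
Proof.
rewrite ltNge; apply/negP => c1; have := etf_angle_sqr; have := n2; have := th0.
have c2 : 1 <= c ^+ 2 by rewrite expr_ge1// ltW// etf_angle_gt0.
by nra.
Qed.

(** An upper bound for (sum_i p_i)^2 can be inserted only if its coefficient is nonnegative. As
    [welch_constant] is c^2 (2 + theta) / n, this amounts to (2 + theta) / n <= 1 + 2 c. *)
Lemma quartic_slope_ge0 : 0 <= quartic_a - quartic_e * welch_constant.
Proof.
have c0 := etf_angle_gt0; have e0 := quartic_e_gt0; have c2 := etf_angle_sqr.
have kE : welch_constant = c ^+ 2 * ((2 + theta) / n%:R).
  rewrite /welch_constant -[LHS]mulr1 -[X in _ * X = _]c2; field.
  by apply/andP; split; apply/eqP; have := n2; have := th0; lra.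
rewrite kE /quartic_a -mulrA -mulrBr pmulr_rge0// -mulrBr pmulr_rge0 ?exprn_gt0//.
rewrite subr_ge0 ler_pdivrMr; last by have := n2; lra.
have [n3|] := ltP 2%N n.
  have : 3 <= n%:R :> R by rewrite ler_nat.
  by case: theta01 c2 => -> c2; nra.
move=> n3; have nE : n%:R = 2 :> R by rewrite (_ : n = 2%N)//; lia.
by case: theta01 c2 => ->; rewrite nE => c2; nra.
Qed.

(** The right side is what the quartic gives when (sum_i p_i)^2 = n, the second moment is 1 and the
    fourth moment equals the Welch bound, so all three estimates are sharp together. Expressing n
    through c reduces the identity to rational functions of c. *)
Lemma etf_constantE :
  etf_constant = n%:R * (quartic_a - quartic_e * welch_constant) + quartic_b.
Proof.
have c0 := etf_angle_gt0; have c2 := etf_angle_sqr; have := n2.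
rewrite /etf_constant /etf_size /welch_constant /quartic_a /quartic_b /quartic_e.
have c20 : 0 < c ^+ 2 by rewrite exprn_gt0.
have nE : n%:R = (c ^+ 2)^-1 - 1 - theta.
  have : (c ^+ 2)^-1 = n%:R + 1 + theta.
    by rewrite -[LHS]mul1r -[X in X * _]c2 mulfK ?gt_eqF.
  by lra.
rewrite nE => n2'.
have h : 2 * c ^+ 2 <= 1 - (1 + theta) * c ^+ 2.
  rewrite -(ler_pM2r c20) in n2'; move: n2'.
  by rewrite 2!mulrBl mulVf ?gt_eqF//; lra.
case: theta01 h => -> h.
  field; rewrite ?gt_eqF//=; nra.
field; rewrite ?gt_eqF//=; nra.
Qed.

End kll.

(** * The extremal inequality for isotropic families *)

Section kll_inequality.
Variables (R : realType) (k : scalar_kind) (n : nat).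
Hypothesis n_ge2 : (2 <= n)%N.
Local Notation K := (scalars R k).
Local Notation conj := (@scalar_conj R k).
Local Notation rs := (@real_scalar R k).
Local Notation c := (etf_angle R k n).

Variables (I : finType) (t : I -> R) (u : I -> 'I_n -> K).

Definition length i : R := Num.sqrt (\sum_a modulus (u i a) ^+ 2).
(** When a vector vanishes, division by zero makes the cosine 0, and [mul_cosine] holds in that case
    too. *)
Definition cosine i j : R := modulus (dotp (u i) (u j)) / (length i * length j).
Local Notation s := length.
Local Notation x := cosine.

Lemma length_ge0 i : 0 <= s i. Proof. exact: sqrtr_ge0. Qed.

Lemma length_sqr i : s i ^+ 2 = \sum_a modulus (u i a) ^+ 2.
Proof. by rewrite sqr_sqrtr// sumr_ge0// => a _; rewrite sqr_ge0. Qed.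

Lemma modulus_dotp_le i j : modulus (dotp (u i) (u j)) <= s i * s j.
Proof.
rewrite -ler_sqr ?nnegrE ?modulus_ge0 ?mulr_ge0 ?length_ge0//.
by rewrite exprMn !length_sqr; exact: cauchy_schwarz.
Qed.

Lemma cosine_ge0 i j : 0 <= x i j.
Proof. by rewrite divr_ge0 ?modulus_ge0 ?mulr_ge0 ?length_ge0. Qed.

Lemma mul_cosine i j : s i * s j * x i j = modulus (dotp (u i) (u j)).
Proof.
have [ss0|ss0] := eqVneq (s i * s j) 0; last by rewrite mulrC divfK.
rewrite ss0 mul0r; apply/eqP; rewrite eq_le modulus_ge0 /= -ss0.
exact: modulus_dotp_le.
Qed.

Lemma cosine_le1 i j : x i j <= 1.
Proof.
have [ss0|ss0] := eqVneq (s i * s j) 0.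
  by rewrite /cosine ss0 invr0 mulr0.
rewrite ler_pdivrMr ?mul1r ?modulus_dotp_le//.
by rewrite lt_def ss0 mulr_ge0 ?length_ge0.
Qed.

Hypothesis iso : forall a b, \sum_i u i a * conj (u i b) = (a == b)%:R.
Hypothesis t_ge0 : forall i, 0 <= t i.
Hypothesis t_sum : \sum_i t i ^+ 2 = 1.
Local Notation p i := (t i * s i).

Lemma sum_length_sqr : \sum_i s i ^+ 2 = n%:R.
Proof.
apply: (@real_inj R k); rewrite rmorph_sum rmorph_nat.
transitivity (\sum_i \sum_a u i a * conj (u i a)).
  apply: eq_bigr => i _; rewrite /= length_sqr rmorph_sum.
  by apply: eq_bigr => a _; rewrite mul_conj.
rewrite exchange_big (eq_bigr (fun=> 1)) ?sumr_const ?card_ord//.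
by move=> a _; rewrite iso eqxx.
Qed.

Lemma sum_weight_sqr_le : (\sum_i p i) ^+ 2 <= n%:R.
Proof.
have := real_cauchy_schwarz t s.
by rewrite t_sum mul1r sum_length_sqr.
Qed.

(** The quartic is evaluated at the cosines of the vectors v_i = u_i / |u_i| and summed with weights
    p_i p_j, using t_i t_j |<u_i, u_j>| = p_i p_j x_ij. Its excess over the modulus stays on the
    left, since the equality case consists in that excess being small. *)
Lemma kll_defect :
  \sum_i \sum_j t i * t j * modulus (dotp (u i) (u j))
  + quartic_e R k n * \sum_i \sum_j p i * p j *
     ((x i j - c) ^+ 2 * (1 - x i j) * (x i j + 1 + 2 * c)) <=
  (quartic_a R k n - quartic_e R k n * welch_constant R k n) * (\sum_i p i) ^+ 2
  + quartic_b R k n.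
Proof.
have s_ge0 := length_ge0.
pose v i a := rs (s i)^-1 * u i a.
have dotv i j : modulus (dotp (v i) (v j)) = x i j.
  rewrite (_ : dotp (v i) (v j) = rs ((s i)^-1 * (s j)^-1) * dotp (u i) (u j)); last first.
    rewrite mulr_sumr; apply: eq_bigr => a _.
    by rewrite /v !rmorphM /= conj_real; ring.
  by rewrite modulusM modulus_real ger0_norm ?mulr_ge0 ?invr_ge0// -invfM mulrC.
have vv i : \sum_a modulus (v i a) ^+ 2 = (s i != 0)%:R.
  transitivity ((s i)^-2 * s i ^+ 2).
    rewrite length_sqr mulr_sumr; apply: eq_bigr => a _.
    by rewrite /v modulusM modulus_real ger0_norm ?invr_ge0// exprMn exprVn -length_sqr.
  by have [->|s0] := eqVneq (s i) 0; rewrite ?expr0n ?mulr0// mulVf// expf_neq0.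
have vp i : p i != 0 -> dotp (v i) (v i) = 1.
  rewrite mulf_eq0 negb_or => /andP[_ si].
  by rewrite dotpp vv si rmorph1.
have su i a : s i = 0 -> u i a = 0.
  move=> s0; have := length_sqr i; rewrite s0 expr0n /= => /esym u0.
  have : modulus (u i a) ^+ 2 = 0.
    by apply: (psumr_eq0P _ u0) => // b _; exact: sqr_ge0.
  by move/eqP; rewrite sqrf_eq0 modulus_eq0 => /eqP.
have tu i a : rs (t i) * u i a = rs (p i) * v i a.
  rewrite /v mulrA -rmorphM /=.
  have [s0|s0] := eqVneq (s i) 0; last by rewrite -mulrA mulfV ?mulr1.
  by rewrite su// !mulr0.
have v1 i : \sum_a modulus (v i a) ^+ 2 <= 1 by rewrite vv lern1 leq_b1.
have M2 := second_moment_le iso tu v1.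
have M4 := fourth_moment_ge vp.
rewrite t_sum in M2.
have e0 := quartic_e_gt0 R k n_ge2.
have b0 : 0 <= quartic_b R k n.
  have c0 := etf_angle_gt0 R k n_ge2.
  by apply: mulr_ge0; [exact: ltW|have := sqr_ge0 c; lra].
set S1 := \sum_i p i in M4 *.
set S2 := \sum_i \sum_j _ in M2.
set S4 := \sum_i \sum_j _ in M4.
have -> : \sum_i \sum_j t i * t j * modulus (dotp (u i) (u j))
  + quartic_e R k n * \sum_i \sum_j p i * p j *
     ((x i j - c) ^+ 2 * (1 - x i j) * (x i j + 1 + 2 * c)) =
  quartic_a R k n * S1 ^+ 2 + quartic_b R k n * S2 - quartic_e R k n * S4.
  rewrite expr2 /S1 mulr_suml /S2 /S4 !mulr_sumr -!big_split -sumrB /=.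
  apply: eq_bigr => i _.
  rewrite !mulr_sumr -!big_split -sumrB /=; apply: eq_bigr => j _.
  rewrite dotv [X in _ + X]mulrCA -quartic_identity// -mul_cosine; ring.
have kS4 : welch_constant R k n * S1 ^+ 2 <= S4.
  have n0 : 2 <= n%:R :> R by rewrite ler_nat.
  have th0 : 0 <= is_real_scalar R k by case: (theta01 R k) => ->.
  rewrite /welch_constant mulrAC ler_pdivrMr; last by rewrite mulr_gt0//; lra.
  by rewrite [S4 * _]mulrC.
rewrite mulrBl addrAC lerD// ?ler_piMr//.
by rewrite lerB// -mulrA ler_pM2l.
Qed.

Lemma kll_inequality :
  \sum_i \sum_j t i * t j * modulus (dotp (u i) (u j)) <= etf_constant R k n.
Proof.
rewrite (etf_constantE R k n_ge2).
have := kll_defect.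
set Q := quartic_e R k n * \sum_i _ => h.
have Q0 : 0 <= Q.
  apply: mulr_ge0; first exact/ltW/quartic_e_gt0.
  have c0 := etf_angle_gt0 R k n_ge2.
  apply: sumr_ge0 => i _; apply: sumr_ge0 => j _.
  apply: mulr_ge0; first by rewrite !mulr_ge0 ?length_ge0.
  apply: mulr_ge0; last by have := cosine_ge0 i j; lra.
  by apply: mulr_ge0; [exact: sqr_ge0|rewrite subr_ge0 cosine_le1].
apply: (le_trans (le_trans _ h)); first by rewrite lerDl.
rewrite lerD2r mulrC ler_wpM2r//; first exact: quartic_slope_ge0.
exact: sum_weight_sqr_le.
Qed.
End kll_inequality.

(** * The trace bound *)

Section trace_bound.
Variables (R : realType) (k : scalar_kind) (n N : nat).
Local Notation K := (scalars R k).
Local Notation conj := (@scalar_conj R k).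
Local Notation rs := (@real_scalar R k).
(** In the application M_ij is phi_i (z_j) for functionals of norm at most 1, m_j is slightly larger
    than the norm of z_j, F holds the values of the phi_j on a basis, and T is the transposed matrix
    of the operator. *)
Variables (M : 'M[K]_N) (F : 'M[K]_(N, n)) (T : 'M[K]_n) (m : 'I_N -> R).
Hypothesis m_gt0 : forall j, 0 < m j.
Hypothesis M_le : forall i j, modulus (M i j) <= m j.
Hypothesis MF : M *m F = F *m T.
Hypothesis F_inj : forall y : 'cV[K]_n, F *m y = 0 -> y = 0.

(* Orthonormalizing the columns of F in the space L2 with weights m turns tr T
   into the trace of M compressed to the range of F. *)
Lemma trace_orthonormalized :
  exists2 P : 'M[K]_n, P \in unitmx &
    let z i a := (F *m P) i a in
    (forall a b, \sum_i (rs (m i) * z i a * conj (z i b)) = (a == b)%:R) /\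
    \tr T = \sum_i \sum_j rs (m i) * M i j * dotp (z j) (z i).
Proof.
pose G := adjmx F *m diag_mx (\row_i rs (m i)) *m F.
have Gp : posdef G.
  split.
    rewrite !adjmxM adjmxK mulmxA; congr (_ *m _ *m _).
    apply/matrixP => i j; rewrite !mxE eq_sym.
    by case: eqP => [->|]; rewrite ?mulr1n ?mulr0n ?rmorph0 ?conj_real.
  move=> y y0; rewrite (_ : _ *m y = adjmx (F *m y) *m diag_mx (\row_i rs (m i)) *m (F *m y)); last first.
    by rewrite adjmxM !mulmxA.
  set w := F *m y.
  have -> : (adjmx w *m diag_mx (\row_i rs (m i)) *m w) ord0 ord0 =
      rs (\sum_i m i * modulus (w i ord0) ^+ 2).
    rewrite !mxE rmorph_sum; apply: eq_bigr => i _.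
    by rewrite mul_mx_diag !mxE /= rmorphM /= -mul_conj; ring.
  rewrite re_real lt_def sumr_ge0 ?andbT; last first.
    by move=> i _; rewrite mulr_ge0 ?sqr_ge0// ltW.
  apply: contraNneq y0 => sum0; apply/eqP/F_inj/matrixP => i j.
  rewrite ord1 -/w [RHS]mxE.
  have : m i * modulus (w i ord0) ^+ 2 = 0.
    by apply: (psumr_eq0P _ sum0) => // l _; rewrite mulr_ge0 ?sqr_ge0// ltW.
  move/eqP; rewrite mulf_eq0 gt_eqF//= sqrf_eq0 modulus_eq0.
  by move/eqP.
have [P Pu PG] := posdef_orthonormalize Gp.
exists P => // z.
have adjE : adjmx (F *m P) *m diag_mx (\row_i rs (m i)) *m (F *m P) = 1%:M.
  by rewrite -PG /G adjmxM !mulmxA.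
split.
  move=> a b; move/matrixP/(_ b a): adjE; rewrite !mxE eq_sym => <-.
  apply: eq_bigr => i _; rewrite mul_mx_diag !mxE /= /z !mxE; ring.
have -> : \tr T = \tr (adjmx (F *m P) *m diag_mx (\row_i rs (m i)) *m M *m (F *m P)).
  have MFP : M *m (F *m P) = (F *m P) *m (invmx P *m T *m P).
    by rewrite mulmxA MF !mulmxA mulmxK.
  by rewrite -[_ *m M *m _]mulmxA MFP mulmxA adjE mul1mx -mulmxA mxtrace_mulC mulmxK.
rewrite mxtrace_mulC mulmxA mxtrace_mulC /mxtrace; apply: eq_bigr => i _.
rewrite mxE; apply: eq_bigr => j _.
rewrite mulmxA mul_mx_diag !mxE.
rewrite (_ : \sum_(_ < n) _ = dotp (z j) (z i)); first by ring.
by apply: eq_bigr => a _; rewrite /z !mxE.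
Qed.

Hypothesis n_ge2 : (2 <= n)%N.

(** Absorbing the weights into u_i = m_i^(1/2) z_i and t_i = (m_i / S)^(1/2) gives a system as in
    [kll_inequality]; the bound |M_ij| <= m_j makes its double sum, multiplied by S, dominate the
    expression for the trace. *)
Lemma trace_bound : modulus (\tr T) <= etf_constant R k n * \sum_j m j.
Proof.
have [P _ /= [iso ->]] := trace_orthonormalized.
pose S := \sum_j m j; pose z i a := (F *m P) i a.
have [N0|N0] := posnP N.
  have none : 'I_N -> False by rewrite N0 => -[].
  by rewrite !big1 ?modulus0 ?mulr0// => i; case: (none i).
have S0 : 0 < S.
  rewrite /S (bigD1 (Ordinal N0))//= ltr_wpDr ?m_gt0// sumr_ge0// => j _.
  exact: ltW.
pose u i a := rs (Num.sqrt (m i)) * z i a; pose t i := Num.sqrt (m i / S).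
have u_iso a b : \sum_i u i a * conj (u i b) = (a == b)%:R.
  rewrite -iso; apply: eq_bigr => i _; rewrite /u rmorphM /= conj_real.
  rewrite -[in RHS](@sqr_sqrtr _ (m i)) ?ltW// expr2 rmorphM /= -/(z i a) -/(z i b).
  ring.
have t_sum : \sum_i t i ^+ 2 = 1.
  under eq_bigr do rewrite sqr_sqrtr ?divr_ge0 ?(ltW S0) ?(ltW (m_gt0 _))//.
  by rewrite -mulr_suml divff ?gt_eqF.
have t_ge0 i : 0 <= t i by exact: sqrtr_ge0.
have := kll_inequality n_ge2 u_iso t_ge0 t_sum.
rewrite -(ler_pM2r S0); apply: le_trans.
apply: (le_trans (modulus_sum _ _)); rewrite mulr_suml; apply: ler_sum => i _.
apply: (le_trans (modulus_sum _ _)); rewrite mulr_suml; apply: ler_sum => j _.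
have -> : t i * t j * modulus (dotp (u i) (u j)) * S =
    m i * m j * modulus (dotp (z j) (z i)).
  have -> : dotp (u i) (u j) = rs (Num.sqrt (m i) * Num.sqrt (m j)) * dotp (z i) (z j).
    rewrite mulr_sumr; apply: eq_bigr => a _.
    by rewrite /u !rmorphM /= conj_real; ring.
  rewrite modulusM modulus_real ger0_norm ?mulr_ge0 ?sqrtr_ge0//.
  rewrite /t !sqrtrM ?(ltW (m_gt0 _))// modulus_dotpC.
  rewrite sqrtrV ?(ltW S0)//; have s0 : Num.sqrt S != 0 by rewrite sqrtr_eq0 -ltNge.
  have := sqr_sqrtr (ltW S0); have := sqr_sqrtr (ltW (m_gt0 i)).
  have := sqr_sqrtr (ltW (m_gt0 j)); move: s0.
  set a := Num.sqrt (m i); set b := Num.sqrt (m j); set r := Num.sqrt S.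
  by move=> r0 <- <- <-; field.
rewrite !modulusM modulus_real ger0_norm ?(ltW (m_gt0 _))//.
by rewrite ler_wpM2r ?modulus_ge0// ler_wpM2l ?(ltW (m_gt0 _)).
Qed.
End trace_bound.

(** * The equality case in the real plane *)

Section plane.
Variable R : realType.

Lemma plane_angle : etf_angle R RealScalars 2 = 2^-1.
Proof.
rewrite /etf_angle /is_real_scalar (_ : 2 + 1 + 1 = 2 ^+ 2 :> R); last by ring.
by rewrite sqrtr_sqr ger0_norm.
Qed.

Lemma plane_constant : etf_constant R RealScalars 2 = 4 / 3.
Proof. by rewrite /etf_constant /etf_size plane_angle /is_real_scalar /=; field. Qed.

(** The factor (x - c)^2 (1 - x) (x + 1 + 2 c) of the quartic excess at c = 1/2. *)
Definition defect (x : R) := (x - 2^-1) ^+ 2 * (1 - x) * (x + 2).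

Variables (N : nat) (m a b : 'I_N -> R).
Hypothesis m_ge0 : forall j, 0 <= m j.
Hypothesis m_sum : \sum_j m j = 1.
Hypothesis aa : \sum_j m j * a j ^+ 2 = 1.
Hypothesis bb : \sum_j m j * b j ^+ 2 = 1.
Hypothesis ab : \sum_j m j * (a j * b j) = 0.

Definition radius j := Num.sqrt (a j ^+ 2 + b j ^+ 2).
Local Notation r := radius.
Definition cross_dot i j := a i * a j + b i * b j.
Definition cross_cos i j := `|cross_dot i j| / (r i * r j).

Lemma radius_ge0 j : 0 <= r j. Proof. exact: sqrtr_ge0. Qed.

Lemma radius_sqr j : r j ^+ 2 = a j ^+ 2 + b j ^+ 2.
Proof. by rewrite sqr_sqrtr// addr_ge0 ?sqr_ge0. Qed.

(** Here c = 1/2, e = 4/9, b = 11/9 and a - e [welch_constant] = 1/18. Since 2/18 + 11/9 = 4/3, a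
    double sum close to 4/3 makes both the defect and the gap in the second inequality small. *)
Lemma plane_defect :
  \sum_i \sum_j m i * m j * `|cross_dot i j|
  + 4 / 9 * \sum_i \sum_j (m i * r i) * (m j * r j) * defect (cross_cos i j) <=
  (\sum_j m j * r j) ^+ 2 / 18 + 11 / 9
  /\ (\sum_j m j * r j) ^+ 2 <= 2.
Proof.
pose t j := Num.sqrt (m j).
pose u j (i : 'I_2) : scalars R RealScalars := t j * (if i == ord0 then a j else b j).
have tt j : t j * t j = m j by rewrite -expr2 sqr_sqrtr.
have t_ge0 j : 0 <= t j by exact: sqrtr_ge0.
have sum2 (F : 'I_2 -> R) : \sum_i F i = F ord0 + F (lift ord0 ord0).
  by rewrite big_ord_recl big_ord1.
have iso p q : \sum_j u j p * scalar_conj (u j q) = (p == q)%:R.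
  have h (x y : 'I_N -> R) : \sum_j (t j * x j) * (t j * y j) = \sum_j m j * (x j * y j).
    by apply: eq_bigr => j _; rewrite -tt; ring.
  rewrite /u /=.
  case: (unliftP ord0 p) => [p'|] ->; case: (unliftP ord0 q) => [q'|] -> /=.
  - by rewrite !ord1 eqxx h -bb; apply: eq_bigr => j _; rewrite expr2.
  - by rewrite h -[RHS]ab; apply: eq_bigr => j _; rewrite mulrC; ring.
  - by rewrite h -[RHS]ab; apply: eq_bigr => j _.
  - by rewrite h -[RHS]aa; apply: eq_bigr => j _; rewrite expr2.
have t_sum : \sum_j t j ^+ 2 = 1.
  by rewrite -m_sum; apply: eq_bigr => j _; rewrite expr2 tt.
have dotE i j : dotp (u i) (u j) = t i * t j * cross_dot i j.
  by rewrite /dotp sum2 /u /= /cross_dot; ring.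
have len j : length u j = t j * r j.
  rewrite /length sum2 /u /= /modulus /= !real_normK ?num_real//.
  rewrite !exprMn -mulrDr sqrtrM ?sqr_ge0// sqrtr_sqr ger0_norm//.
have pE j : t j * length u j = m j * r j by rewrite len mulrA tt.
have modE i j : modulus (dotp (u i) (u j)) = t i * t j * `|cross_dot i j|.
  by rewrite dotE /modulus /= normrM ger0_norm ?mulr_ge0.
have cosE i j : 0 < m i -> 0 < m j -> cosine u i j = cross_cos i j.
  move=> mi mj; rewrite /cosine modE !len /cross_cos.
  have ti : t i != 0 by rewrite sqrtr_eq0 -ltNge.
  have tj : t j != 0 by rewrite sqrtr_eq0 -ltNge.
  rewrite (_ : t i * r i * (t j * r j) = (t i * t j) * (r i * r j)); last by ring.
  by rewrite invfM mulrACA mulfV ?mulf_neq0// mul1r.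
have two : (2 <= 2)%N by [].
have := kll_defect two iso t_sum; have := sum_weight_sqr_le iso t_sum.
rewrite (eq_bigr (fun j => m j * r j)) => [sq|j _]; last exact: pE.
rewrite (eq_bigr (fun i => \sum_j m i * m j * `|cross_dot i j|)); last first.
  move=> i _; apply: eq_bigr => j _; rewrite modE -(tt i) -(tt j); ring.
rewrite [X in _ * X](eq_bigr (fun i => \sum_j (m i * r i) * (m j * r j) * defect (cross_cos i j))); last first.
  move=> i _; apply: eq_bigr => j _; rewrite !pE.
  have [->|mi] := eqVneq (m i) 0; first by rewrite !mul0r.
  have [->|mj] := eqVneq (m j) 0; first by rewrite !mul0r !mulr0 !mul0r.
  have mi0 : 0 < m i by rewrite lt_def mi m_ge0.
  have mj0 : 0 < m j by rewrite lt_def mj m_ge0.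
  rewrite (cosE _ _ mi0 mj0) plane_angle /defect; congr (_ * (_ * _)); lra.
have -> : quartic_e R RealScalars 2 = 4 / 9.
  by rewrite /quartic_e plane_angle; field.
have -> : quartic_b R RealScalars 2 = 11 / 9.
  by rewrite /quartic_b /quartic_e plane_angle; field.
have -> : quartic_a R RealScalars 2 - 4 / 9 * welch_constant R RealScalars 2 = 18^-1.
  by rewrite /quartic_a /quartic_e /welch_constant plane_angle /is_real_scalar /=; field.
by rewrite [18^-1 * _]mulrC.
Qed.
End plane.

(** * Distance from a unit vector to a regular hexagon *)

Section near_hexagon.
Variable R : realType.
Implicit Types (y t : R) (k : 'I_3).

Definition sin60 : R := Num.sqrt 3 / 2.
Local Notation g := sin60.

Lemma sin60_sqr : g * g = 3 / 4.
Proof. by rewrite /sin60 mulrACA -expr2 sqr_sqrtr; [field|]. Qed.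

Lemma sin60_ge : 2^-1 <= g.
Proof.
by rewrite /sin60 -[leLHS]mul1r ler_pM2r ?invr_gt0// -[leLHS]sqrtr1 ler_wsqrtr// ler1n.
Qed.

(** [hex1] and [hex2] are the cosines and sines of 0, 60 and 120 degrees: one vertex from each
    antipodal pair. *)
Definition hex1 k : R := if k == 0 then 1 else if k == 1 then 2^-1 else - 2^-1.
Definition hex2 k : R := if k == 0 then 0 else g.

Lemma hex_unit k : hex1 k ^+ 2 + hex2 k ^+ 2 = 1.
Proof.
rewrite /hex1 /hex2 !expr2; have := sin60_sqr.
by case: (k == 0) => /=; [|case: (k == 1) => /=]; lra.
Qed.

Lemma ord3P k : [\/ k = 0, k = 1 | k = 2%:R].
Proof.
case: k => -[|[|[|l]]] kP //; [constructor 1|constructor 2|constructor 3]; exact: val_inj.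
Qed.

(** If c is the cosine of the angle between the two unit vectors, the nearer of e and -e lies at
    squared distance 2 - 2 |c|, which is at most 2 - 2 c^2. *)
Lemma near_line y t (e1 e2 : R) : y ^+ 2 + t ^+ 2 = 1 -> e1 ^+ 2 + e2 ^+ 2 = 1 ->
  exists2 s : R, s = 1 \/ s = -1 &
    (y - s * e1) ^+ 2 + (t - s * e2) ^+ 2 <= 2 * (y * e2 - t * e1) ^+ 2.
Proof.
move=> yt ee; pose c := y * e1 + t * e2.
have cY : c ^+ 2 + (y * e2 - t * e1) ^+ 2 = 1.
  rewrite /c -[RHS](mulr1 1) -{1}yt -ee; ring.
have aux (x Y : R) : 0 <= x -> x ^+ 2 + Y ^+ 2 = 1 -> 2 - 2 * x <= 2 * Y ^+ 2.
  move=> x0 xY; have Y0 := sqr_ge0 Y; have x1 : x <= 1 by nra.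
  by nra.
have [c0|c0] := leP 0 c.
  exists 1; first by left.
  rewrite (_ : _ + _ = 2 - 2 * c); first exact: aux.
  transitivity (y ^+ 2 + t ^+ 2 + (e1 ^+ 2 + e2 ^+ 2) - 2 * c); first by rewrite /c; ring.
  by rewrite yt ee; ring.
exists (-1); first by right.
rewrite (_ : _ + _ = 2 - 2 * - c); first by apply: aux; rewrite ?sqrrN//; lra.
transitivity (y ^+ 2 + t ^+ 2 + (e1 ^+ 2 + e2 ^+ 2) + 2 * c); first by rewrite /c; ring.
by rewrite yt ee; ring.
Qed.

(** The first two hypotheses give A B = 3/4 - C^2. As C is the smallest of the three, C^2 <= 1/2, so
    that 16 (A B)^2 >= 1. *)
Lemma min_product (A B C : R) : A - B = C -> A ^+ 2 + B ^+ 2 + C ^+ 2 = 3 / 2 ->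
  C ^+ 2 <= A ^+ 2 -> C ^+ 2 <= B ^+ 2 -> C ^+ 2 <= 16 * (A * B * C) ^+ 2.
Proof.
move=> ABC sq CA CB.
have AB : A * B = 3 / 4 - C ^+ 2.
  by move: sq; rewrite -ABC; lra.
have AB_ge : 4^-1 <= A * B by rewrite AB; lra.
rewrite exprMn AB in AB_ge *.
have : 16^-1 <= (3 / 4 - C ^+ 2) ^+ 2 by nra.
have := sqr_ge0 C; set C2 := C ^+ 2; set P := (_ - _) ^+ 2; nra.
Qed.

(** For y = cos phi and t = sin phi, the number t (4 y^2 - 1) is sin (3 phi), which vanishes exactly
    at the six vertices. Up to sign it is 4 times the product of the sines [Y0], [Y1], [Y2] of the
    angles to the three diagonals, so it controls the smallest of these; its square is at most 36
    times the defect. *)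
Lemma near_hexagon y t : y ^+ 2 + t ^+ 2 = 1 ->
  exists k (s : R), (s = 1 \/ s = -1) /\
    (y - s * hex1 k) ^+ 2 + (t - s * hex2 k) ^+ 2 <= 72 * defect `|y|.
Proof.
move=> yt; have g2 := sin60_sqr.
have prodE : 2 * t ^+ 2 * (4 * y ^+ 2 - 1) ^+ 2 <= 72 * defect `|y|.
  rewrite -[y ^+ 2]real_normK ?num_real//; have y1 : `|y| <= 1.
    have y2 : `|y| ^+ 2 <= 1 by rewrite real_normK ?num_real//; have := sqr_ge0 t; lra.
    by have := normr_ge0 y; nra.
  have y0 := normr_ge0 y.
  have -> : t ^+ 2 = 1 - `|y| ^+ 2 by rewrite real_normK ?num_real//; lra.
  move: (`|y|) y0 y1 => x x0 x1; rewrite /defect.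
  rewrite (_ : 2 * _ * _ = (32 * (1 + x) * (x + 2^-1) ^+ 2) * ((x - 2^-1) ^+ 2 * (1 - x))); last first.
    by field.
  rewrite (_ : 72 * _ = (72 * (x + 2)) * ((x - 2^-1) ^+ 2 * (1 - x))); last by ring.
  apply: ler_wpM2r; first by rewrite mulr_ge0 ?sqr_ge0 ?subr_ge0.
  by nra.
pose Y0 := - t; pose Y1 := y * g - t * 2^-1; pose Y2 := y * g + t * 2^-1.
have sq : Y0 ^+ 2 + Y1 ^+ 2 + Y2 ^+ 2 = 3 / 2.
  rewrite (_ : _ + _ = 2 * y ^+ 2 * (g * g) + 3 / 2 * t ^+ 2); first by rewrite g2; lra.
  by rewrite /Y0 /Y1 /Y2; field.
have prod : 16 * (Y0 * Y1 * Y2) ^+ 2 = t ^+ 2 * (4 * y ^+ 2 - 1) ^+ 2.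
  rewrite (_ : Y0 * Y1 * Y2 = - t * (y ^+ 2 * (g * g) - t ^+ 2 / 4)); last first.
    by rewrite /Y0 /Y1 /Y2; field.
  have -> : t ^+ 2 = 1 - y ^+ 2 by lra.
  rewrite g2 exprMn sqrrN.
  have -> : t ^+ 2 = 1 - y ^+ 2 by lra.
  by field.
have close (Y : R) k : (y * hex2 k - t * hex1 k) ^+ 2 = Y ^+ 2 ->
    Y ^+ 2 <= 16 * (Y0 * Y1 * Y2) ^+ 2 ->
    exists k (s : R), (s = 1 \/ s = -1) /\
    (y - s * hex1 k) ^+ 2 + (t - s * hex2 k) ^+ 2 <= 72 * defect `|y|.
  move=> YE Yle; have [s s1 le] := near_line yt (hex_unit k).
  exists k, s; split => //; apply: (le_trans le); apply: le_trans prodE.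
  by rewrite YE -mulrA ler_pM2l// -prod.
have [Y01|Y10] := leP (Y0 ^+ 2) (Y1 ^+ 2).
  have [Y02|Y20] := leP (Y0 ^+ 2) (Y2 ^+ 2).
    apply: (close Y0 0); first by rewrite /hex1 /hex2 /= /Y0; ring.
    rewrite (_ : Y0 * Y1 * Y2 = Y1 * Y2 * Y0); last by ring.
    by apply: min_product => //; [rewrite /Y0 /Y1 /Y2; lra|lra].
  apply: (close Y2 2%:R); first by rewrite /hex1 /hex2 /= /Y2; ring.
  rewrite (_ : Y0 * Y1 * Y2 = Y1 * Y0 * Y2); last by ring.
  by apply: min_product; [rewrite /Y0 /Y1 /Y2; lra|lra|lra|lra].
have [Y12|Y21] := leP (Y1 ^+ 2) (Y2 ^+ 2).
  apply: (close Y1 1); first by rewrite /hex1 /hex2 /= /Y1; ring.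
  rewrite (_ : (Y0 * Y1 * Y2) ^+ 2 = (Y2 * (- Y0) * Y1) ^+ 2); last by ring.
  by apply: min_product; [rewrite /Y0 /Y1 /Y2; lra|lra|lra|lra].
apply: (close Y2 2%:R); first by rewrite /hex1 /hex2 /= /Y2; ring.
rewrite (_ : Y0 * Y1 * Y2 = Y1 * Y0 * Y2); last by ring.
by apply: min_product; [rewrite /Y0 /Y1 /Y2; lra|lra|lra|lra].
Qed.
End near_hexagon.

(** * Stability of the planar equality case *)

Section hexagon_approximation.
Variables (R : realType) (N : nat) (m a b : 'I_N -> R) (z : R).
Hypothesis m_ge0 : forall j, 0 <= m j.
Hypothesis m_sum : \sum_j m j = 1.
Hypothesis aa : \sum_j m j * a j ^+ 2 = 1.
Hypothesis bb : \sum_j m j * b j ^+ 2 = 1.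
Hypothesis ab : \sum_j m j * (a j * b j) = 0.
Hypothesis z_gt0 : 0 < z.
Hypothesis z_small : z <= 100^-1.
Hypothesis extremal : 4 / 3 - z ^+ 4 <= \sum_i \sum_j m i * m j * `|cross_dot a b i j|.
Local Notation r := (radius a b).
Local Notation g := (sin60 R).

Let z4 : 0 < z ^+ 4 <= 10000^-1.
Proof.
rewrite exprn_gt0//=; apply: (@le_trans _ _ ((100^-1) ^+ 4)).
  by rewrite lerXn2r// nnegrE ltW.
by rewrite (_ : _ ^+ 4 = 10000^-1 * 10000^-1 :> R); [lra|field].
Qed.

Let w2 : R := Num.sqrt 2.
Let w2_sqr : w2 * w2 = 2. Proof. by rewrite -expr2 sqr_sqrtr. Qed.
Let w2_gt0 : 0 < w2. Proof. by rewrite sqrtr_gt0. Qed.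

Let mean_r := \sum_j m j * r j.

Let weighted_r2 : \sum_j m j * r j ^+ 2 = 2.
Proof.
under eq_bigr do rewrite radius_sqr mulrDr.
by rewrite big_split /= aa bb -mulr2n.
Qed.

Let cos01 i j : 0 <= cross_cos a b i j <= 1.
Proof.
have rr0 : 0 <= r i * r j by rewrite mulr_ge0 ?radius_ge0.
rewrite divr_ge0//=; have [rr|rr] := eqVneq (r i * r j) 0.
  by rewrite /cross_cos rr invr0 mulr0.
rewrite ler_pdivrMr ?lt_def ?rr// mul1r -ler_sqr ?nnegrE//.
rewrite real_normK ?num_real// exprMn !radius_sqr /cross_dot.
by have := sqr_ge0 (a i * b j - b i * a j); nra.
Qed.

Let defect01 (x : R) : 0 <= x <= 1 -> 0 <= defect x <= 1.
Proof.
move=> /andP[x0 x1]; rewrite /defect -mulrA.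
have h1 : 0 <= (x - 2^-1) ^+ 2 <= 1 by rewrite sqr_ge0; nra.
have h2 : 0 <= (1 - x) * (x + 2) <= 9 / 4 by apply/andP; split; nra.
have h3 : (x - 2^-1) ^+ 2 <= 4^-1 by nra.
case/andP: h1 => h1 _; case/andP: h2 => h2 h2'; apply/andP; split; first exact: mulr_ge0.
by apply: (le_trans (ler_pM h1 h2 h3 h2')); lra.
Qed.

Let Q := \sum_i \sum_j (m i * r i) * (m j * r j) * defect (cross_cos a b i j).

Let mean_r_ge0 : 0 <= mean_r.
Proof. by apply: sumr_ge0 => j _; rewrite mulr_ge0 ?radius_ge0. Qed.

Let extremal_bounds :
  [/\ 2 - 18 * z ^+ 4 <= mean_r ^+ 2, mean_r ^+ 2 <= 2 & Q <= 9 / 4 * z ^+ 4].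
Proof.
have [le le2] := plane_defect m_ge0 m_sum aa bb ab.
rewrite -/Q -/mean_r in le le2.
have Q0 : 0 <= Q.
  apply: sumr_ge0 => i _; apply: sumr_ge0 => j _.
  apply: mulr_ge0; first by rewrite !mulr_ge0 ?radius_ge0.
  by have /andP[] := defect01 (cos01 i j).
by move: extremal le; set S := \sum_i \sum_j _ => ? ?; split; lra.
Qed.

(** [Q] combines the sums over j with weights m_i r_i, whose total is at least 1, so one of these
    sums obeys the bound on [Q]. The direction of that i becomes the axis of the hexagon. *)
Let pivot : exists2 i, 0 < r i & \sum_j m j * r j * defect (cross_cos a b i j) <= 9 / 4 * z ^+ 4.
Proof.
have [D2 D2' Qle] := extremal_bounds; have /andP[z40 z4l] := z4.
have D1 : 1 <= mean_r by have := mean_r_ge0; nra.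
pose X i := \sum_j m j * r j * defect (cross_cos a b i j).
have QE : Q = \sum_i m i * r i * X i.
  by apply: eq_bigr => i _; rewrite /X mulr_sumr; apply: eq_bigr => j _; ring.
apply: contrapT => none.
have X_gt i : r i != 0 -> 9 / 4 * z ^+ 4 < X i.
  move=> ri; rewrite ltNge; apply/negP => Xle; apply: none; exists i => //.
  by rewrite lt_def ri radius_ge0.
have nonneg i : 0 <= m i * r i * (X i - 9 / 4 * z ^+ 4).
  have [->|/X_gt ri] := eqVneq (r i) 0; first by rewrite mulr0 mul0r.
  by rewrite !mulr_ge0 ?radius_ge0// subr_ge0 ltW.
have sum0 : \sum_i m i * r i * (X i - 9 / 4 * z ^+ 4) = 0.
  apply/eqP; rewrite eq_le sumr_ge0 ?andbT; last by move=> i _.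
  rewrite (eq_bigr (fun i => m i * r i * X i - m i * r i * (9 / 4 * z ^+ 4))); last first.
    by move=> i _; rewrite mulrBr.
  by rewrite sumrB -QE -mulr_suml -/mean_r; nra.
have all0 i : m i * r i = 0.
  have : m i * r i * (X i - 9 / 4 * z ^+ 4) = 0 by apply: (psumr_eq0P _ sum0).
  have [->|/X_gt ri] := eqVneq (r i) 0; first by rewrite mulr0.
  by move/eqP; rewrite mulf_eq0 subr_eq0 (gt_eqF ri) orbF => /eqP.
have : mean_r = 0 by apply: big1 => i _.
by move=> D0; rewrite D0 in D1; lra.
Qed.

Let mean_sqr_le (x : 'I_N -> R) : (\sum_j m j * x j) ^+ 2 <= \sum_j m j * x j ^+ 2.
Proof.
set X := \sum_j _; rewrite -subr_ge0.
have -> : \sum_j m j * x j ^+ 2 - X ^+ 2 = \sum_j m j * (x j - X) ^+ 2.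
  rewrite [RHS](eq_bigr (fun j => m j * x j ^+ 2 - 2 * X * (m j * x j) + X ^+ 2 * m j)); last first.
    by move=> j _; ring.
  by rewrite big_split sumrB /= -!mulr_sumr m_sum -/X; ring.
by apply: sumr_ge0 => j _; rewrite mulr_ge0 ?sqr_ge0.
Qed.

Let var_r : \sum_j m j * (r j - w2) ^+ 2 <= 36 * z ^+ 4.
Proof.
have [D2 D2' _] := extremal_bounds.
rewrite (eq_bigr (fun j => m j * r j ^+ 2 - 2 * w2 * (m j * r j) + (w2 * w2) * m j)); last first.
  by move=> j _; ring.
rewrite w2_sqr big_split sumrB /= -!mulr_sumr m_sum weighted_r2 -/mean_r.
have D_le : mean_r <= w2.
  by have := mean_r_ge0; have := w2_gt0; have := w2_sqr; nra.
have : mean_r ^+ 2 <= w2 * mean_r by rewrite expr2 ler_wpM2r.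
by lra.
Qed.

Let w2_ge1 : 1 <= w2.
Proof. by have := w2_gt0; have := w2_sqr; nra. Qed.

(** The weights m_j r_j are replaced by m_j: dl_j <= r_j dl_j + |r_j - w2|, and the mean of the last
    term is of order z^2 by the variance bound [var_r]. *)
Let mean_defect (dl : 'I_N -> R) : (forall j, 0 <= dl j <= 1) ->
  \sum_j m j * dl j <= \sum_j m j * r j * dl j + 6 * z ^+ 2.
Proof.
move=> dl01.
have dev : \sum_j m j * `|r j - w2| <= 6 * z ^+ 2.
  have dev0 : 0 <= \sum_j m j * `|r j - w2|.
    by apply: sumr_ge0 => j _; rewrite mulr_ge0.
  have z20 : 0 <= 6 * z ^+ 2 by rewrite mulr_ge0 ?sqr_ge0.
  rewrite -ler_sqr ?nnegrE//.
  apply: (le_trans (mean_sqr_le _)).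
  under eq_bigr do rewrite real_normK ?num_real//.
  by apply: (le_trans var_r); rewrite exprMn -exprM; lra.
apply: (@le_trans _ _ (\sum_j (m j * r j * dl j + m j * `|r j - w2|))).
  apply: ler_sum => j _; rewrite -mulrA -mulrDr ler_wpM2l//.
  have /andP[d0 d1] := dl01 j; have r0 := radius_ge0 a b j.
  have : w2 - r j <= `|r j - w2| by rewrite distrC ler_norm.
  have := normr_ge0 (r j - w2); have := w2_ge1.
  have [r1|r1] := leP 1 (r j); first by nra.
  by nra.
by rewrite big_split lerD2l.
Qed.

Let zz : z ^+ 4 <= 10000^-1 * z ^+ 2.
Proof.
have z2 : z ^+ 2 <= 10000^-1.
  have -> : 10000^-1 = 100^-1 * 100^-1 :> R by field.
  by rewrite expr2 ler_pM// ltW.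
rewrite (_ : z ^+ 4 = z ^+ 2 * z ^+ 2); last by ring.
by rewrite ler_wpM2r ?sqr_ge0.
Qed.

(* Up to an error that vanishes with z, the functionals (a j, b j) are the
   signed vertices of a regular hexagon, each pair of opposite vertices having
   mass 1/3. *)
Lemma hexagon_approximation : exists (e1 e2 : 'I_3 -> R) (cl : 'I_N -> 'I_3) (s w : 'I_N -> R),
  [/\ e1 1 = e1 0 + e1 2%:R /\ e2 1 = e2 0 + e2 2%:R,
      forall j, s j = 1 \/ s j = -1,
      forall j, 0 <= w j /\ forall y1 y2,
        `|a j * y1 + b j * y2 - s j * (e1 (cl j) * y1 + e2 (cl j) * y2)|
          <= w j * Num.sqrt (y1 ^+ 2 + y2 ^+ 2),
      \sum_j m j * w j <= 50 * z &
      forall k, `|\sum_(j | cl j == k) m j - 3^-1| <= 300 * z].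
Proof.
have [i0 r0 pivot_le] := pivot.
pose p := a i0 / r i0; pose q := b i0 / r i0.
have r0n : r i0 != 0 by rewrite gt_eqF.
have pq : p ^+ 2 + q ^+ 2 = 1.
  rewrite /p /q !exprMn -mulrDl -radius_sqr exprVn divff// expf_neq0//.
(* Coordinates of (a_j, b_j) along the pivot direction (p, q) and across it; |Y_j| / r_j is the
   cosine with the pivot. *)
pose Y j := a j * p + b j * q; pose T j := b j * p - a j * q.
have YT j : Y j ^+ 2 + T j ^+ 2 = r j ^+ 2.
  transitivity ((a j ^+ 2 + b j ^+ 2) * (p ^+ 2 + q ^+ 2)); first by rewrite /Y /T; ring.
  by rewrite pq mulr1 radius_sqr.
pose dl j := defect (cross_cos a b i0 j).
have dl01 j : 0 <= dl j <= 1 by exact: defect01.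
have choice_j j : exists ksw : 'I_3 * R * R, let: (k, s, w) := ksw in
    [/\ s = 1 \/ s = -1, 0 <= w,
      (Y j - s * (w2 * hex1 R k)) ^+ 2 + (T j - s * (w2 * hex2 R k)) ^+ 2 = w ^+ 2 &
      w ^+ 2 <= 2 * (r j - w2) ^+ 2 + 288 * dl j].
  (* The error splits into a radial part r_j - w2 and w2 times an angular part, which [near_hexagon]
     bounds by 72 times the defect; 288 is 2 * w2^2 * 72. *)
  suff [k [s [s1 le]]] : exists k (s : R), (s = 1 \/ s = -1) /\
      (Y j - s * (w2 * hex1 R k)) ^+ 2 + (T j - s * (w2 * hex2 R k)) ^+ 2
        <= 2 * (r j - w2) ^+ 2 + 288 * dl j.
    set W := (_ + _) in le.
    have W0 : 0 <= W by rewrite addr_ge0 ?sqr_ge0.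
    by exists (k, s, Num.sqrt W); rewrite !sqr_sqrtr ?sqrtr_ge0.
  have /andP[d0 d1] := dl01 j.
  (* At r_j = 0 any vertex will do: its squared length 2 is below 2 (r_j - w2)^2 = 4. *)
  have [rj|rj] := eqVneq (r j) 0.
    exists 0, 1; split; first by left.
    have := YT j; rewrite rj /hex1 /hex2 /= => e.
    have Yj : Y j = 0 by apply/eqP; rewrite -sqrf_eq0; apply/eqP; have := sqr_ge0 (Y j); have := sqr_ge0 (T j); lra.
    have Tj : T j = 0 by apply/eqP; rewrite -sqrf_eq0; apply/eqP; have := sqr_ge0 (Y j); have := sqr_ge0 (T j); lra.
    by rewrite Yj Tj; have := w2_sqr; nra.
  have yt : (Y j / r j) ^+ 2 + (T j / r j) ^+ 2 = 1.
    by rewrite !exprMn -mulrDl YT exprVn divff// expf_neq0.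
  have [k [s [s1 le]]] := near_hexagon yt; exists k, s; split => //.
  have yE : `|Y j / r j| = cross_cos a b i0 j.
    rewrite /cross_cos /cross_dot -[r i0 * r j]ger0_norm ?mulr_ge0 ?radius_ge0//.
    by rewrite -normf_div; congr `|_|; rewrite /Y /p /q; field; rewrite rj.
  rewrite yE -/(dl j) in le.
  have YrE : Y j = r j * (Y j / r j) by rewrite mulrC divfK.
  have TrE : T j = r j * (T j / r j) by rewrite mulrC divfK.
  rewrite YrE TrE; move: (Y j / r j) (T j / r j) le yt {YrE TrE yE} => y t le yt.
  set h1 := hex1 R k in le *; set h2 := hex2 R k in le *.
  have split_sq (u v : R) : (u + v) ^+ 2 <= 2 * u ^+ 2 + 2 * v ^+ 2.
    by have := sqr_ge0 (u - v); nra.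
  have := split_sq ((r j - w2) * y) (w2 * (y - s * h1)).
  have := split_sq ((r j - w2) * t) (w2 * (t - s * h2)).
  rewrite (_ : (r j - w2) * y + _ = r j * y - s * (w2 * h1)); last by ring.
  rewrite (_ : (r j - w2) * t + _ = r j * t - s * (w2 * h2)); last by ring.
  rewrite !exprMn -[w2 ^+ 2]/(w2 * w2) w2_sqr.
  have : (r j - w2) ^+ 2 * y ^+ 2 + (r j - w2) ^+ 2 * t ^+ 2 = (r j - w2) ^+ 2.
    by rewrite -mulrDr yt mulr1.
  by lra.
have [f fP] := choice choice_j.
pose cl j := (f j).1.1; pose s j := (f j).1.2; pose w j := (f j).2.
have fP' j : [/\ s j = 1 \/ s j = -1, 0 <= w j,
      (Y j - s j * (w2 * hex1 R (cl j))) ^+ 2 + (T j - s j * (w2 * hex2 R (cl j))) ^+ 2 = w j ^+ 2 &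
      w j ^+ 2 <= 2 * (r j - w2) ^+ 2 + 288 * dl j].
  by have := fP j; rewrite /s /w /cl; case: (f j) => -[].
have s_cases j : s j = 1 \/ s j = -1 by have [] := fP' j.
have ss j : s j ^+ 2 = 1 by case: (s_cases j) => ->; rewrite ?sqrrN expr1n.
have w0 j : 0 <= w j by have [] := fP' j.
(* The mean square of [w] is only of order z^2, because [mean_defect] has taken a square root of
   z^4. Passing to the mean of [w] takes a second one; hence the fourth power in the hypothesis. *)
have mw2 : \sum_j m j * w j ^+ 2 <= (50 * z) ^+ 2.
  apply: (@le_trans _ _ (\sum_j (2 * (m j * (r j - w2) ^+ 2) + 288 * (m j * dl j)))).
    apply: ler_sum => j _; have [_ _ _ le] := fP' j.
    rewrite (_ : 2 * _ + _ = m j * (2 * (r j - w2) ^+ 2 + 288 * dl j)); last by ring.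
    exact: ler_wpM2l.
  rewrite big_split /= -!mulr_sumr.
  rewrite (_ : (50 * z) ^+ 2 = 2500 * z ^+ 2); last by ring.
  have pl : \sum_j m j * r j * dl j <= 9 / 4 * z ^+ 4 := pivot_le.
  have := mean_defect dl01; have := var_r; have := zz; have := sqr_ge0 z; lra.
have mw : \sum_j m j * w j <= 50 * z.
  rewrite -ler_sqr ?nnegrE ?(le_trans (mean_sqr_le w))//.
    by apply: sumr_ge0 => j _; rewrite mulr_ge0.
  by rewrite mulr_ge0// ltW.
pose e1 k := w2 * (hex1 R k * p - hex2 R k * q).
pose e2 k := w2 * (hex1 R k * q + hex2 R k * p).
exists e1, e2, cl, s, w; split => //.
- by rewrite /e1 /e2 /hex1 /hex2 /=; split; field.
- move=> j; split => // y1 y2; have [_ _ wE _] := fP' j.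
  rewrite -ler_sqr ?nnegrE ?mulr_ge0 ?sqrtr_ge0//.
  rewrite real_normK ?num_real// exprMn sqr_sqrtr ?addr_ge0 ?sqr_ge0// -wE.
  set A := Y j - _; set B := T j - _.
  pose y1' := p * y1 + q * y2; pose y2' := p * y2 - q * y1.
  have -> : a j * y1 + b j * y2 - s j * (e1 (cl j) * y1 + e2 (cl j) * y2) = A * y1' + B * y2'.
    transitivity ((a j * y1 + b j * y2) * (p ^+ 2 + q ^+ 2) - s j * (e1 (cl j) * y1 + e2 (cl j) * y2)).
      by rewrite pq mulr1.
    by rewrite /A /B /y1' /y2' /e1 /e2 /Y /T; ring.
  have -> : y1 ^+ 2 + y2 ^+ 2 = y1' ^+ 2 + y2' ^+ 2.
    by rewrite -[LHS]mulr1 -pq /y1' /y2'; ring.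
  have cs2 (x1 x2 x3 x4 : R) :
      (x1 * x3 + x2 * x4) ^+ 2 <= (x1 ^+ 2 + x2 ^+ 2) * (x3 ^+ 2 + x4 ^+ 2).
    rewrite -subr_ge0 (_ : _ - _ = (x1 * x4 - x2 * x3) ^+ 2) ?sqr_ge0//; ring.
  exact: cs2.
move=> k.
have z1 : 50 * z <= 2^-1.
  have h : 50 * z <= 50 * 100^-1 by rewrite ler_pM2l.
  by lra.
have d0 : 0 <= 50 * z by rewrite mulr_ge0// ltW.
have err : \sum_j m j * (3 * w j + w j ^+ 2) <= 4 * (50 * z).
  rewrite (eq_bigr (fun j => 3 * (m j * w j) + m j * w j ^+ 2)); last by move=> j _; ring.
  by rewrite big_split /= -mulr_sumr; nra.
have h_le (k' : 'I_3) : `|w2 * hex1 R k'| <= 3 / 2 /\ `|w2 * hex2 R k'| <= 3 / 2.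
  have hu := hex_unit R k'; have w22 := w2_sqr.
  by split; rewrite -ler_sqr ?nnegrE ?divr_ge0// real_normK ?num_real// !exprMn expr2 w2_sqr;
     [have := sqr_ge0 (hex2 R k')|have := sqr_ge0 (hex1 R k')]; lra.
have dY j : `|Y j - s j * (w2 * hex1 R (cl j))| <= w j /\ `|T j - s j * (w2 * hex2 R (cl j))| <= w j.
  have [_ _ wE _] := fP' j.
  by split; rewrite -ler_sqr ?nnegrE// real_normK ?num_real// -wE ?lerDl ?lerDr ?sqr_ge0.
have prod_close (u v u' v' d : R) : 0 <= d -> `|u - u'| <= d -> `|v - v'| <= d ->
    `|u'| <= 3 / 2 -> `|v'| <= 3 / 2 -> `|u * v - u' * v'| <= 3 * d + d ^+ 2.
  move=> dd du dv hu hv.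
  rewrite (_ : u * v - _ = (u - u') * (v - v') + u' * (v - v') + (u - u') * v'); last by ring.
  apply: (le_trans (ler_normD _ _)); rewrite normrM.
  apply: (le_trans (lerD (ler_normD _ _) (lexx _))); rewrite !normrM.
  have h1 : `|u - u'| * `|v - v'| <= d * d by apply: ler_pM.
  have h2 : `|u'| * `|v - v'| <= 3 / 2 * d by apply: ler_pM.
  have h3 : `|u - u'| * `|v'| <= d * (3 / 2) by apply: ler_pM.
  by lra.
have s_norm j x : `|s j * x| = `|x|.
  by case: (s_cases j) => ->; rewrite ?mul1r ?mulN1r ?normrN.
have mean_close (F : 'I_N -> R) (H : 'I_3 -> R) c :
    (forall j, `|F j - H (cl j)| <= 3 * w j + w j ^+ 2) -> \sum_j m j * F j = c ->
    `|\sum_k H k * (\sum_(j | cl j == k) m j) - c| <= 4 * (50 * z).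
  move=> FH Fc; apply: le_trans err.
  have -> : \sum_k H k * (\sum_(j | cl j == k) m j) = \sum_j m j * H (cl j).
    rewrite [RHS](partition_big cl predT)//=; apply: eq_bigr => k' _.
    by rewrite mulr_sumr; apply: eq_bigr => j /eqP ->; rewrite mulrC.
  rewrite -Fc -sumrB; apply: (le_trans (ler_norm_sum _ _ _)); apply: ler_sum => j _.
  by rewrite -mulrBr normrM ger0_norm// ler_wpM2l// distrC.
(* The moments of Y^2 and Y T, together with the total mass, become three approximate linear
   equations for the masses of the classes, whose exact solution is 1/3 for each. *)
have YY1 : \sum_j m j * (Y j * Y j) = 1.
  rewrite (eq_bigr (fun j => p ^+ 2 * (m j * a j ^+ 2) + 2 * p * q * (m j * (a j * b j)) + q ^+ 2 * (m j * b j ^+ 2))); last first.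
    by move=> j _; rewrite /Y; ring.
  by rewrite !big_split /= -!mulr_sumr aa bb ab mulr0 addr0 !mulr1.
have YT0 : \sum_j m j * (Y j * T j) = 0.
  rewrite (eq_bigr (fun j => - (p * q) * (m j * a j ^+ 2) + (p ^+ 2 - q ^+ 2) * (m j * (a j * b j)) + p * q * (m j * b j ^+ 2))); last first.
    by move=> j _; rewrite /Y /T; ring.
  by rewrite !big_split /= -!mulr_sumr aa bb ab mulr0 addr0 !mulr1 addNr.
have sum3 (F : 'I_3 -> R) : \sum_k F k = F 0 + F 1 + F 2%:R.
  rewrite !big_ord_recl big_ord0 addr0 addrA.
  by congr (F _ + F _ + F _); apply: val_inj.
pose M k' := \sum_(j | cl j == k') m j.
have M_sum : M 0 + M 1 + M 2%:R = 1.
  by rewrite -sum3 -[RHS]m_sum [RHS](partition_big cl predT).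
have class_close (h h' : 'I_3 -> R) (A B : 'I_N -> R) c :
    (forall j, `|A j - s j * (w2 * h (cl j))| <= w j) ->
    (forall j, `|B j - s j * (w2 * h' (cl j))| <= w j) ->
    (forall k', `|w2 * h k'| <= 3 / 2) -> (forall k', `|w2 * h' k'| <= 3 / 2) ->
    \sum_j m j * (A j * B j) = c ->
    `|\sum_k 2 * (h k * h' k) * M k - c| <= 4 * (50 * z).
  move=> Ah Bh h1 h2; apply: mean_close => j.
  have -> : 2 * (h (cl j) * h' (cl j)) = (s j * (w2 * h (cl j))) * (s j * (w2 * h' (cl j))).
    transitivity ((w2 * w2) * (s j ^+ 2) * (h (cl j) * h' (cl j))); last by ring.
    by rewrite w2_sqr ss mulr1.
  by apply: prod_close; rewrite ?s_norm.
have := class_close _ _ _ _ _ (fun j => (dY j).1) (fun j => (dY j).1)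
  (fun k' => (h_le k').1) (fun k' => (h_le k').1) YY1.
have := class_close _ _ _ _ _ (fun j => (dY j).1) (fun j => (dY j).2)
  (fun k' => (h_le k').1) (fun k' => (h_le k').2) YT0.
rewrite !sum3 /hex1 /hex2 /= -/(M k) => C2 C1.
have g1 := sin60_ge R.
have hz : 0 <= z by rewrite ltW.
have {}C2 : `|M 1 - M 2%:R| <= 400 * z.
  rewrite (_ : _ - 0 = g * (M 1 - M 2%:R)) in C2; last by field.
  rewrite normrM (@ger0_norm _ g) in C2; last by lra.
  have : 2^-1 * `|M 1 - M 2%:R| <= g * `|M 1 - M 2%:R| by rewrite ler_wpM2r.
  by lra.
move: C1 C2 M_sum hz; rewrite !ler_norml => /andP[? ?] /andP[? ?] ? ?.
by case: (ord3P k) => ->; apply/andP; split; lra.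
Qed.
End hexagon_approximation.

(** * Hahn-Banach theorem and trace duality *)

Section linear_maps.
Variables (K : fieldType) (U W : lmodType K).

Lemma linear_at0 (A : U -> W) : linear A -> A 0 = 0.
Proof.
by move=> Alin; have := Alin (-1) 0 0; rewrite !scaleN1r oppr0 addr0 addNr.
Qed.

Lemma linear_atZ (A : U -> W) a x : linear A -> A (a *: x) = a *: A x.
Proof. by move=> Alin; have := Alin a x 0; rewrite linear_at0// !addr0. Qed.

Lemma linear_atD (A : U -> W) x y : linear A -> A (x + y) = A x + A y.
Proof. by move=> Alin; have := Alin 1 x y; rewrite !scale1r. Qed.

Lemma linear_at_sum (A : U -> W) (I : finType) (F : I -> U) :
  linear A -> A (\sum_i F i) = \sum_i A (F i).
Proof.
by move=> Alin; apply: big_morph => [x y|]; [exact: linear_atD|exact: linear_at0].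
Qed.

Lemma scalar_at0 (f : U -> K) : scalar f -> f 0 = 0.
Proof.
by move=> flin; have := flin (-1) 0 0; rewrite scaleN1r mulN1r oppr0 addr0 addNr.
Qed.

Lemma scalar_atZ (f : U -> K) a x : scalar f -> f (a *: x) = a * f x.
Proof. by move=> flin; have := flin a x 0; rewrite scalar_at0// !addr0. Qed.

Lemma scalar_atD (f : U -> K) x y : scalar f -> f (x + y) = f x + f y.
Proof. by move=> flin; have := flin 1 x y; rewrite scale1r mul1r. Qed.

Lemma scalar_at_sum (f : U -> K) (I : finType) (F : I -> U) :
  scalar f -> f (\sum_i F i) = \sum_i f (F i).
Proof.
by move=> flin; apply: big_morph => [x y|]; [exact: scalar_atD|exact: scalar_at0].
Qed.
End linear_maps.

Section hahn_banach.
Variables (R : realType) (k : scalar_kind).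
Local Notation K := (scalars R k).
Local Notation rs := (@real_scalar R k).
Variables (V : lmodType K) (p : V -> R).
Hypothesis p_subadd : forall x y, p (x + y) <= p x + p y.
Hypothesis p_norm : forall a x, p (a *: x) = modulus a * p x.

Let p0 : p 0 = 0.
Proof. by rewrite -(scale0r 0) p_norm modulus0 mul0r. Qed.

(** Real linear functionals on subspaces, bounded by [p] and encoded as graphs: extension is
    inclusion, and chains have their union as upper bound. Domination already makes such a graph
    single-valued. *)
Definition dominated_graph (G : set (V * R)) :=
  [/\ G (0, 0),
      forall a x r y s, G (x, r) -> G (y, s) -> G (rs a *: x + y, a * r + s) &
      forall x r, G (x, r) -> r <= p x].

Lemma dominated_graph_fun G x r s :
  dominated_graph G -> G (x, r) -> G (x, s) -> r = s.
Proof.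
case=> G0 GD Gp.
suff le r' s' : G (x, r') -> G (x, s') -> r' <= s'.
  by move=> Gr Gs; apply/eqP; rewrite eq_le !le.
move=> Gr Gs; have := GD (-1) _ _ _ _ Gs Gr.
rewrite rmorphN rmorph1 scaleN1r addNr mulN1r => /Gp; rewrite p0; lra.
Qed.

Lemma dominated_graph_extend G v :
  dominated_graph G -> (forall r, ~ G (v, r)) ->
  exists G', [/\ dominated_graph G', G `<=` G' & exists r, G' (v, r)].
Proof.
move=> [G0 GD Gp] vG.
have GDD x r y s : G (x, r) -> G (y, s) -> G (x + y, r + s).
  by move=> Gx Gy; have := GD 1 _ _ _ _ Gx Gy; rewrite rmorph1 scale1r mul1r.
have GZ a x r : G (x, r) -> G (rs a *: x, a * r).
  by move=> Gx; have := GD a _ _ _ _ Gx G0; rewrite !addr0.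
have cross x r y s : G (x, r) -> G (y, s) -> r - p (x - v) <= p (y + v) - s.
  move=> Gx Gy; have := Gp _ _ (GDD _ _ _ _ Gx Gy).
  have := p_subadd (x - v) (y + v); rewrite addrACA addNr addr0; lra.
pose L := [set r.2 - p (r.1 - v) | r in G].
have L0 : L !=set0 by exists (0 - p (0 - v)), (0, 0).
have Lub y s : G (y, s) -> ubound L (p (y + v) - s).
  by move=> Gy _ [[x r] Gx <-]; exact: cross.
pose al := sup L.
have al_le y s : G (y, s) -> s + al <= p (y + v).
  move=> Gy; have : al <= p (y + v) - s by apply: ge_sup => //; exact: Lub.
  lra.
have al_ge x r : G (x, r) -> r - al <= p (x - v).
  move=> Gx; have : r - p (x - v) <= al.
    apply: ub_le_sup; last by exists (x, r).
    by exists (p (0 + v) - 0); exact: Lub.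
  lra.
exists [set z | exists x r b, G (x, r) /\ z = (x + rs b *: v, r + b * al)].
split; last 2 first.
- move=> [x r] Gx; exists x, r, 0; split => //.
  by rewrite rmorph0 scale0r mul0r !addr0.
- exists al, 0, 0, 1; split => //.
  by rewrite rmorph1 scale1r mul1r !add0r.
split.
- exists 0, 0, 0; split => //.
  by rewrite rmorph0 scale0r mul0r !addr0.
- move=> a _ _ _ _ [x [r [b [Gx [-> ->]]]]] [y [s [b' [Gy [-> ->]]]]].
  exists (rs a *: x + y), (a * r + s), (a * b + b'); split; first exact: GD.
  rewrite rmorphD rmorphM /= scalerDr scalerA scalerDl; congr (_, _); last by ring.
  by rewrite -!addrA; congr (_ + _); rewrite addrCA.
move=> _ _ [x [r [b [Gx [-> ->]]]]].
have scale_p a z : 0 < a -> p z = a * p (rs a^-1 *: z).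
  move=> a0; rewrite p_norm modulus_real gtr0_norm ?invr_gt0//.
  by rewrite mulVKf ?gt_eqF.
have [b0|b0|->] := ltgtP b 0; last first.
- by rewrite rmorph0 scale0r mul0r !addr0; exact: Gp.
- rewrite (scale_p b)// scalerDr scalerA -rmorphM /= mulVf ?gt_eqF// rmorph1 scale1r.
  have := al_le _ _ (GZ b^-1 _ _ Gx); rewrite -(ler_pM2l b0); apply: le_trans.
  by rewrite mulrDr mulVKf ?gt_eqF.
- rewrite (scale_p (- b)) ?oppr_gt0// scalerDr scalerA -rmorphM /= invrN [- _^-1 * _]mulNr.
  rewrite mulVf ?lt_eqF// rmorphN1 scaleN1r.
  have := al_ge _ _ (GZ (- b^-1) _ _ Gx).
  have nb0 : 0 < - b by rewrite oppr_gt0.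
  rewrite -(ler_pM2l nb0); apply: le_trans.
  by rewrite mulrBr mulrA mulrNN mulfV ?lt_eqF// mul1r mulNr opprK.
Qed.

Lemma dominated_graph_maximal G0 : dominated_graph G0 ->
  exists G, [/\ dominated_graph G, G0 `<=` G & forall v, exists r, G (v, r)].
Proof.
move=> G0_dom.
(* Joining [G0] to every candidate makes the predicate hold for the union of the empty chain too. *)
pose P := [set A | dominated_graph (A `|` G0)].
have [A [PA Amax]] : exists A, P A /\ forall B, A `<` B -> ~ P B.
  apply: Zorn_bigcup => F FP Ftot.
  have dir x y : (\bigcup_(X in F) X `|` G0) x -> (\bigcup_(X in F) X `|` G0) y ->
      exists G, [/\ dominated_graph G, G x, G y & G `<=` \bigcup_(X in F) X `|` G0].
    have sub X : F X -> X `|` G0 `<=` \bigcup_(X in F) X `|` G0.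
      by move=> FX z [Xz|]; [left; exists X|right].
    move=> [[X FX Xx]|G0x] [[Y FY Yy]|G0y].
    - have [XY|YX] := Ftot X Y FX FY.
        exists (Y `|` G0); split; [exact: FP|by left; apply: XY|by left|exact: sub].
      exists (X `|` G0); split; [exact: FP|by left|by left; apply: YX|exact: sub].
    - exists (X `|` G0); split; [exact: FP|by left|by right|exact: sub].
    - exists (Y `|` G0); split; [exact: FP|by right|by left|exact: sub].
    - by exists G0; split => // z; right.
  split.
  - by right; case: G0_dom.
  - move=> a x r y s xr ys; have [G [[_ GD _] Gx Gy]] := dir _ _ xr ys.
    by apply; apply: GD.
  - by move=> x r xr; have [G [[_ _ Gp] Gx _ _]] := dir _ _ xr xr; apply: Gp.
exists (A `|` G0); split; [exact: PA|by move=> z; right|].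
move=> v; apply: contrapT => vA.
have vA' r : ~ (A `|` G0) (v, r) by move=> vr; apply: vA; exists r.
have [G' [G'dom AG' [r G'v]]] := dominated_graph_extend PA vA'.
apply: (Amax G').
  split=> [z Az|G'A]; first by apply: AG'; left.
  by apply: (vA' r); left; exact: G'A.
by rewrite /P /= setUidl// => z; move: (AG' z) => /[swap] Gz; apply; right.
Qed.

Lemma dominated_graph_functional G0 : dominated_graph G0 ->
  exists g : V -> R, [/\ forall a x y, g (rs a *: x + y) = a * g x + g y,
    forall x, g x <= p x & forall x r, G0 (x, r) -> g x = r].
Proof.
move=> /dominated_graph_maximal[G [Gdom G0G Gtot]].
have [g gG] := choice Gtot.
have [_ GD Gp] := Gdom; exists g; split.
- by move=> a x y; apply: dominated_graph_fun (gG _) _ => //; exact: GD.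
- by move=> x; apply: Gp.
- by move=> x r G0x; apply: dominated_graph_fun (gG _) _ => //; exact: G0G.
Qed.
End hahn_banach.

(** Over C the functional is g (x) = gR (x) - i gR (i x). *)
Lemma scalar_of_real_part (R : realType) (k : scalar_kind)
    (V : lmodType (scalars R k)) (gR : V -> R) :
  (forall a x y, gR (real_scalar a *: x + y) = a * gR x + gR y) ->
  exists2 g : V -> scalars R k, scalar g & forall x, scalar_re (g x) = gR x.
Proof.
case: k V gR => V gR lin; first by exists gR.
have gD x y : gR (x + y) = gR x + gR y.
  by have := lin 1 x y; rewrite rmorph1 scale1r mul1r.
have g0 : gR 0 = 0.
  have := gD 0 0; rewrite addr0; lra.
have gZ a x : gR (a%:C%C *: x) = a * gR x.
  by have := lin a x 0; rewrite !addr0 g0 addr0.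
pose g x : R[i] := Complex (gR x) (- gR ('i%C *: x)).
exists g => // -[a b] x y.
have abE : Complex a b = a%:C%C + b%:C%C * 'i%C.
  by rewrite /= ; apply/eqP; rewrite eq_complex /=; apply/andP; split; apply/eqP; ring.
have i_ab : 'i%C * Complex a b = a%:C%C * 'i%C - b%:C%C.
  by apply/eqP; rewrite eq_complex /=; apply/andP; split; apply/eqP; ring.
have gN z : gR (- z) = - gR z by apply/eqP; rewrite -addr_eq0 -gD addNr g0.
apply/eqP; rewrite eq_complex /=; apply/andP; split; apply/eqP.
  rewrite gD abE scalerDl gD -scalerA !gZ; ring.
rewrite scalerDr gD scalerA i_ab scalerDl gD -scalerA gZ scaleNr gN gZ; ring.
Qed.

(** The subspace is presented as the image of [A]; the bound by [p (A w)] forces [f] to factor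
    through it. Rotating the argument by a phase carries both the equality and the bound from real
    parts to scalars. *)
Theorem hahn_banach (R : realType) (k : scalar_kind)
    (V W : lmodType (scalars R k)) (p : V -> R) (A : W -> V) (f : W -> scalars R k) :
  (forall x y, p (x + y) <= p x + p y) ->
  (forall a x, p (a *: x) = modulus a * p x) ->
  linear A -> scalar f -> (forall w, scalar_re (f w) <= p (A w)) ->
  exists g : V -> scalars R k, [/\ scalar g, forall w, g (A w) = f w &
    forall x, modulus (g x) <= p x].
Proof.
move=> pD pZ Alin flin fp.
pose G0 := [set (A w, scalar_re (f w)) | w in [set: W]].
have G0dom : dominated_graph p G0.
  split.
  - by exists 0; rewrite ?linear_at0 ?scalar_at0 ?raddf0.
  - move=> a _ _ _ _ [w _ [<- <-]] [w' _ [<- <-]].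
    by exists (real_scalar a *: w + w'); rewrite // Alin flin raddfD /= re_realM.
  - by move=> _ _ [w _ [<- <-]]; exact: fp.
have [gR [glin gp gG0]] := dominated_graph_functional pD pZ G0dom.
have [g gscal gre] := scalar_of_real_part glin.
have gA_re w : scalar_re (g (A w)) = scalar_re (f w).
  by rewrite gre; apply: gG0; exists w.
exists g; split=> [//|w|x].
- have [s [s1 sE]] := modulus_phase (g (A w) - f w).
  have : modulus (g (A w) - f w) = 0.
    have := gA_re (s *: w); rewrite linear_atZ// !scalar_atZ// => /eqP.
    by rewrite -subr_eq0 -raddfB -mulrBr sE /= re_real => /eqP.
  by move/eqP; rewrite modulus_eq0 subr_eq0 => /eqP.
- have [s [s1 sE]] := modulus_phase (g x).
  by have := gp (s *: x); rewrite -gre scalar_atZ// sE re_real pZ s1 mul1r.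
Qed.

(** * Functionals on normed spaces *)

Section normed.
Variables (R : realType) (k : scalar_kind).
Local Notation K := (scalars R k).
Local Notation rs := (@real_scalar R k).
Implicit Types X Z : normedModType K.

Lemma normrE X (x : X) : `|x| = rs (real_norm x).
Proof. by rewrite /real_norm real_re// normr_ge0. Qed.

Lemma real_norm_ge0 X (x : X) : 0 <= real_norm x.
Proof. by rewrite -(@real_ge0 R k) -normrE. Qed.

Lemma real_normZ X a (x : X) : real_norm (a *: x) = modulus a * real_norm x.
Proof. by apply: (@real_inj R k); rewrite rmorphM /= -!normrE normrZ normE. Qed.

Lemma real_normD X (x y : X) : real_norm (x + y) <= real_norm x + real_norm y.
Proof. by rewrite -(@le_real R k) rmorphD /= -!normrE ler_normD. Qed.

Lemma real_norm0 X : real_norm (0 : X) = 0.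
Proof. by apply: (@real_inj R k); rewrite rmorph0 -normrE normr0. Qed.

Lemma real_norm_eq0 X (x : X) : real_norm x = 0 -> x = 0.
Proof. by move=> x0; apply/eqP; rewrite -normr_eq0 normrE x0 rmorph0. Qed.

Lemma real_norm_sum X (I : finType) (F : I -> X) :
  real_norm (\sum_i F i) <= \sum_i real_norm (F i).
Proof.
apply: (big_ind2 (fun x y => real_norm x <= y)) => [|x1 x2 y1 y2 h1 h2|//].
  by rewrite real_norm0.
by apply: (le_trans (real_normD _ _)); apply: lerD.
Qed.

Lemma isometric_real_norm X Z (S : {linear X -> Z}) :
  isometric_embedding S -> forall x, real_norm (S x) = real_norm x.
Proof. by move=> S_iso x; rewrite /real_norm S_iso. Qed.

Definition dual_ball X (phi : X -> K) :=
  scalar phi /\ forall x, modulus (phi x) <= real_norm x.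

Lemma norming_functional X (x : X) :
  exists2 phi : X -> K, dual_ball phi & phi x = rs (real_norm x).
Proof.
have [|||||g [gs gA gp]] := @hahn_banach R k X K^o (@real_norm R k X)
  (fun a => a *: x) (fun a => a * rs (real_norm x)).
- exact: real_normD.
- exact: real_normZ.
- by move=> a b c; rewrite scalerDl scalerA.
- by move=> a b c; rewrite mulrDl mulrA.
- move=> a; rewrite real_normZ mulrC re_realM mulrC.
  by rewrite ler_wpM2r ?real_norm_ge0 ?re_le_modulus.
by exists g => //; have := gA 1; rewrite scale1r mul1r.
Qed.

Lemma extend_functional X Z (S : {linear X -> Z}) (phi : X -> K) :
  isometric_embedding S -> dual_ball phi ->
  exists2 psi : Z -> K, dual_ball psi & forall x, psi (S x) = phi x.
Proof.
move=> S_iso [phis phib].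
have [|||||g [gs gA gp]] := @hahn_banach R k Z X (@real_norm R k Z) S phi.
- exact: real_normD.
- exact: real_normZ.
- by move=> a x y; rewrite linearP.
- exact: phis.
- by move=> x; rewrite isometric_real_norm// (le_trans (re_le_modulus _)).
by exists g.
Qed.
End normed.

Section finite_dimension.
Variables (R : realType) (k : scalar_kind) (n : nat).
Local Notation K := (scalars R k).
Variables (X : normedModType K) (f : {linear X -> 'rV[K]_n}) (fi : 'rV[K]_n -> X).
Hypotheses (fK : cancel f fi) (fiK : cancel fi f).

Lemma coord_inv_linear : linear fi.
Proof. by move=> a x y; apply: (can_inj fK); rewrite linearP !fiK. Qed.

Definition basis_vector (i : 'I_n) : X := fi (delta_mx 0 i).
Local Notation b := basis_vector.

Lemma fi_sum (y : 'rV[K]_n) : fi y = \sum_i y 0 i *: b i.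
Proof.
rewrite [y in LHS]row_sum_delta linear_at_sum; last exact: coord_inv_linear.
by apply: eq_bigr => i _; rewrite linear_atZ//; exact: coord_inv_linear.
Qed.

Lemma coord_sum x : x = \sum_i f x 0 i *: b i.
Proof. by rewrite -fi_sum fK. Qed.

Lemma scalar_coord (phi : X -> K) x :
  scalar phi -> phi x = \sum_i f x 0 i * phi (b i).
Proof.
move=> phis; rewrite {1}[x]coord_sum scalar_at_sum//.
by apply: eq_bigr => i _; rewrite scalar_atZ.
Qed.

Definition functional_matrix N (psi : 'I_N -> X -> K) : 'M[K]_(N, n) :=
  \matrix_(j, i) psi j (b i).

(** As long as the rank is below n, some nonzero vector is annihilated by all functionals chosen so
    far; a functional norming that vector raises the rank. *)
Lemma dual_ball_total : exists N (psi : 'I_N -> X -> K),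
  (forall j, dual_ball (psi j)) /\ row_full (functional_matrix psi).
Proof.
suff H r : (r <= n)%N -> exists N (psi : 'I_N -> X -> K),
    (forall j, dual_ball (psi j)) /\ (r <= \rank (functional_matrix psi))%N.
  have [N [psi [psib psir]]] := H n (leqnn n).
  by exists N, psi; split => //; rewrite /row_full eqn_leq rank_leq_col.
elim: r => [_|r IH rn].
  by exists 0%N, (fun=> fun=> 0); split => // -[].
have [N [psi [psib psir]]] := IH (ltnW rn).
have [r_lt|r_ge] := ltnP r (\rank (functional_matrix psi)).
  by exists N, psi.
have rE : \rank (functional_matrix psi) = r by apply/eqP; rewrite eqn_leq r_ge.
have [y y0 psiy] : exists2 y : 'cV[K]_n, y != 0 & functional_matrix psi *m y = 0.
  have : kermx (functional_matrix psi)^T != 0.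
    by rewrite -mxrank_eq0 mxrank_ker mxrank_tr rE subn_eq0 -ltnNge.
  case/rowV0Pn => v /sub_kermxP vker v0; exists v^T; first by rewrite trmx_eq0.
  by apply: trmx_inj; rewrite trmx_mul trmxK vker trmx0.
have [phi [phis phib] phiy] := norming_functional (fi y^T).
pose psi' (j : 'I_(N + 1)) := match fintype.split j with inl i => psi i | inr _ => phi end.
exists (N + 1)%N, psi'; split.
  by move=> j; rewrite /psi'; case: fintype.split => // _; split.
have matE : functional_matrix psi' = col_mx (functional_matrix psi) (\row_i phi (b i)).
  apply/matrixP => j i; rewrite !mxE /psi'.
  by case: fintype.split => l; rewrite !mxE.
rewrite -rE matE; apply: rank_ltmx; rewrite ltmxE; apply/andP; split.
  by rewrite -addsmxE addsmxSl.
apply/negP => /submxP[D DE].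
have : (\row_i phi (b i)) *m y = 0.
  have : col_mx (functional_matrix psi) (\row_i phi (b i)) *m y = 0.
    by rewrite DE -mulmxA psiy mulmx0.
  by rewrite mul_col_mx => /eqP; rewrite col_mx_eq0 => /andP[_ /eqP].
move/matrixP/(_ 0 0); rewrite !mxE => phi0.
have : real_norm (fi y^T) = 0.
  apply: (@real_inj R k); rewrite rmorph0 -phiy scalar_coord// -[RHS]phi0.
  by apply: eq_bigr => i _; rewrite fiK !mxE mulrC.
move/real_norm_eq0 => /(congr1 f); rewrite fiK linear0 => /eqP.
by rewrite trmx_eq0; exact/negP.
Qed.
End finite_dimension.

(** * The nuclear norm and projections *)

Section projection.
Variables (R : realType) (k : scalar_kind) (n : nat).
Local Notation K := (scalars R k).
Variables (X Z : normedModType K) (f : {linear X -> 'rV[K]_n}) (fi : 'rV[K]_n -> X).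
Hypotheses (fK : cancel f fi) (fiK : cancel fi f).
Variables (S : {linear X -> Z}).
Hypothesis S_iso : isometric_embedding S.
Local Notation b := (basis_vector fi).
Local Notation V := {ffun 'I_n -> Z}.

(* e, as an operator b_l |-> e l from X to Z, is the sum of the rank one
   operators phi_j (x) z_j. *)
Definition nuclear_decomposition (e : V) N (phi : 'I_N -> X -> K) (z : 'I_N -> Z) :=
  (forall j, dual_ball (phi j)) /\ forall l, e l = \sum_j phi j (b l) *: z j.

Definition nuclear_cost (e : V) : set R := [set r | exists N phi z,
  @nuclear_decomposition e N phi z /\ r = \sum_j real_norm (z j)].

Definition nuclear_norm (e : V) : R := inf (nuclear_cost e).

Lemma nuclear_cost_ge0 e r : nuclear_cost e r -> 0 <= r.
Proof.
by move=> [N [phi [z [_ ->]]]]; apply: sumr_ge0 => j _; exact: real_norm_ge0.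
Qed.

Lemma nuclear_cost_has_inf e : has_inf (nuclear_cost e).
Proof.
split; last by exists 0 => r; exact: nuclear_cost_ge0.
have [N [psi [psib /row_fullP[B BE]]]] := dual_ball_total fK fiK.
exists (\sum_j real_norm (\sum_l B l j *: e l)), N, psi, (fun j => \sum_l B l j *: e l).
split => //; split => // l.
rewrite [RHS](eq_bigr (fun j => \sum_i (psi j (b l) * B i j) *: e i)); last first.
  by move=> j _; rewrite scaler_sumr; apply: eq_bigr => i _; rewrite scalerA.
rewrite exchange_big /= (bigD1 l)//= -scaler_suml [X in X *: _](_ : _ = 1).
  rewrite scale1r big1 ?addr0// => i il; rewrite -scaler_suml.
  rewrite (_ : \sum_j _ = (B *m functional_matrix fi psi) i l).
    by rewrite BE mxE (negPf il) scale0r.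
  by rewrite mxE; apply: eq_bigr => j _; rewrite !mxE mulrC.
transitivity ((B *m functional_matrix fi psi) l l); last by rewrite BE mxE eqxx.
by rewrite mxE; apply: eq_bigr => j _; rewrite !mxE mulrC.
Qed.

Lemma nuclear_norm_le e r : nuclear_cost e r -> nuclear_norm e <= r.
Proof. by move=> er; apply: ge_inf => //; have [] := nuclear_cost_has_inf e. Qed.

Lemma nuclear_norm_ge e r : (forall s, nuclear_cost e s -> r <= s) -> r <= nuclear_norm e.
Proof. by move=> er; apply: lb_le_inf => //; have [] := nuclear_cost_has_inf e. Qed.

Lemma nuclear_normD x y : nuclear_norm (x + y) <= nuclear_norm x + nuclear_norm y.
Proof.
rewrite -lerBlDr; apply: nuclear_norm_ge => r [N [phi [z [[phib xE] ->]]]].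
rewrite lerBlDr [X in _ <= X]addrC -lerBlDr; apply: nuclear_norm_ge => s [M [psi [w [[psib yE] ->]]]].
rewrite lerBlDr; apply: nuclear_norm_le.
pose chi (j : 'I_(M + N)) := match fintype.split j with inl i => psi i | inr i => phi i end.
pose v (j : 'I_(M + N)) := match fintype.split j with inl i => w i | inr i => z i end.
have lsE i : fintype.split (lshift N i) = inl i := unsplitK (inl i).
have rsE i : fintype.split (rshift M i) = inr i := unsplitK (inr i).
exists (M + N)%N, chi, v; split; last first.
  rewrite big_split_ord /= /v; congr (_ + _); apply: eq_bigr => i _.
    by rewrite lsE.
  by rewrite rsE.
split=> [j|l]; first by rewrite /chi; case: fintype.split.
rewrite ffunE xE yE addrC big_split_ord /=; congr (_ + _); apply: eq_bigr => i _.
  by rewrite /chi /v lsE.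
by rewrite /chi /v rsE.
Qed.

Lemma nuclear_normZ_le a x : nuclear_norm (a *: x) <= modulus a * nuclear_norm x.
Proof.
have [->|a0] := eqVneq a 0.
  rewrite modulus0 mul0r; apply: nuclear_norm_le.
  exists 0%N, (fun=> fun=> 0), (fun=> 0); split; last by rewrite big_ord0.
  split=> [[]//|l]; rewrite big_ord0 ffunE.
  by rewrite scale0r.
have a_gt0 : 0 < modulus a by rewrite lt_def modulus_eq0 a0 modulus_ge0.
rewrite -ler_pdivrMl//; apply: nuclear_norm_ge => r [N [phi [z [[phib xE] ->]]]].
rewrite ler_pdivrMl//; apply: nuclear_norm_le.
exists N, phi, (fun j => a *: z j); split; last first.
  by rewrite mulr_sumr; apply: eq_bigr => j _; rewrite real_normZ.
split=> // l; rewrite ffunE xE scaler_sumr; apply: eq_bigr => j _.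
by rewrite !scalerA mulrC.
Qed.

Lemma nuclear_normZ a x : nuclear_norm (a *: x) = modulus a * nuclear_norm x.
Proof.
apply/eqP; rewrite eq_le nuclear_normZ_le /=.
have [->|a0] := eqVneq a 0.
  rewrite modulus0 mul0r; apply: nuclear_norm_ge => s; exact: nuclear_cost_ge0.
have a_gt0 : 0 < modulus a by rewrite lt_def modulus_eq0 a0 modulus_ge0.
have := nuclear_normZ_le a^-1 (a *: x).
rewrite scalerA mulVf// scale1r -(ler_pM2l a_gt0) mulrA -modulusM mulfV//.
by rewrite modulus1 mul1r.
Qed.

Definition embedded_operator (T : 'M[K]_n) : V := [ffun l => S (fi (row l T))].

Lemma embedded_operator_linear : linear embedded_operator.
Proof.
move=> a T U; apply/ffunP => l; rewrite !ffunE linearP /=.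
by rewrite (coord_inv_linear fK fiK) linearP.
Qed.

(** On operators with values in the range of [S], the trace is bounded by C times the nuclear norm.
    Its Hahn-Banach extension [g] to all operators from X to Z defines [Q] by phi (Q z) = g (phi (x)
    z). The bound on rank one operators gives |Q z| <= C |z|, and agreement with the trace gives Q S
    = 1, so S Q is the projection. *)
Theorem projection_of_trace_bound (C : R) : 0 < C ->
  (forall T r, nuclear_cost (embedded_operator T) r -> modulus (\tr T) <= C * r) ->
  (relative_projection_constant (range S) <= C%:E)%E.
Proof.
move=> C0 trC.
have [|||||g [gs gA gp]] := @hahn_banach R k V 'M[K]_n
    (fun e => C * nuclear_norm e) embedded_operator (fun T => \tr T).
- by move=> x y; rewrite -mulrDr ler_pM2l// nuclear_normD.
- by move=> a x; rewrite nuclear_normZ mulrCA.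
- exact: embedded_operator_linear.
- by move=> a x y; rewrite linearP.
- move=> T; rewrite -ler_pdivrMl//; apply: nuclear_norm_ge => r Tr.
  by rewrite ler_pdivrMl//; apply: (le_trans (re_le_modulus _)); exact: trC.
have fi_lin := coord_inv_linear fK fiK.
pose single z l : V := [ffun i => if i == l then z else 0].
have single_lin l a z w : single (a *: z + w) l = a *: single z l + single w l.
  by apply/ffunP => i; rewrite !ffunE; case: eqP => _ //; rewrite scaler0 addr0.
pose Q z : X := fi (\row_l g (single z l)).
have Q_lin : linear Q.
  move=> a z w; rewrite -fi_lin; congr fi; apply/rowP => l.
  by rewrite !mxE single_lin gs.
pose SQ z := S (Q z).
have SQ_lin : linear SQ by move=> a z w; rewrite /SQ Q_lin linearP.
pose P : {linear Z -> Z} := HB.pack SQ (GRing.isLinear.Build _ _ _ _ SQ SQ_lin).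
have QS x : Q (S x) = x.
  rewrite -[RHS]fK; congr fi; apply/rowP => l; rewrite mxE.
  have -> : single (S x) l = embedded_operator (\matrix_(i, j) (if i == l then f x 0 j else 0)).
    apply/ffunP => i; rewrite !ffunE; case: eqP => il.
      congr (S _); rewrite -[LHS]fK; congr fi; apply/rowP => j.
      by rewrite !mxE il eqxx.
    rewrite (_ : row _ _ = 0) ?(linear_at0 fi_lin) ?linear0//.
    by apply/rowP => j; rewrite !mxE; case: eqP.
  rewrite gA /mxtrace (bigD1 l)//= mxE eqxx big1 ?addr0// => i il.
  by rewrite mxE (negPf il).
have Q_le z : real_norm (Q z) <= C * real_norm z.
  have [phi [phis phib] phiE] := norming_functional (Q z).
  have -> : real_norm (Q z) = modulus (g [ffun l => phi (b l) *: z]).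
    rewrite -[LHS]ger0_norm ?real_norm_ge0// -(@modulus_real R k) -phiE.
    congr modulus; rewrite (scalar_coord fK fiK)// /Q fiK.
    rewrite (_ : [ffun l => _] = \sum_l phi (b l) *: single z l); last first.
      apply/ffunP => i; rewrite sum_ffunE ffunE (bigD1 i)//= !ffunE eqxx.
      rewrite big1 ?addr0// => l li; rewrite !ffunE eq_sym (negPf li).
      by rewrite scaler0.
    rewrite scalar_at_sum//; apply: eq_bigr => l _.
    by rewrite scalar_atZ// mxE mulrC.
  apply: (le_trans (gp _)); rewrite ler_pM2l//; apply: nuclear_norm_le.
  exists 1%N, (fun=> phi), (fun=> z); split; last by rewrite big_ord1.
  by split => // l; rewrite big_ord1 ffunE.
apply: (@le_trans _ _ (operator_norm P)).
  apply: ereal_inf_lbound; exists P => //; split.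
    by move=> _ [z _ <-]; exists (Q z).
  by move=> _ [x _ <-]; rewrite /= /SQ QS.
apply: ub_ereal_sup => _ [z /= z1 <-]; rewrite lee_fin /SQ isometric_real_norm//.
by apply: (le_trans (Q_le z)); rewrite ler_piMr// ltW.
Qed.
End projection.

Section trace_data.
Variables (R : realType) (k : scalar_kind) (n : nat).
Local Notation K := (scalars R k).
Variables (X Z : normedModType K) (f : {linear X -> 'rV[K]_n}) (fi : 'rV[K]_n -> X).
Hypotheses (fK : cancel f fi) (fiK : cancel fi f).
Variables (S : {linear X -> Z}).
Hypothesis S_iso : isometric_embedding S.
Local Notation b := (basis_vector fi).

(* The functionals spanning the dual are adjoined with zero vectors, to make F
   injective, and all weights are increased by a small amount, to make them
   positive. *)
Lemma nuclear_trace_data (T : 'M[K]_n) (r eps : R) : 0 < eps ->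
  nuclear_cost fi (embedded_operator fi S T) r ->
  exists N (phi : 'I_N -> X -> K) (m : 'I_N -> R) (M : 'M[K]_N),
    let F := functional_matrix fi phi in
    [/\ forall j, dual_ball (phi j), forall j, 0 < m j,
        forall i j, modulus (M i j) <= m j, M *m F = F *m T^T &
        [/\ forall y : 'cV[K]_n, F *m y = 0 -> y = 0,
            \sum_j m j <= r + eps &
            forall x, real_norm (fi (f x *m T)) <= \sum_j m j * modulus (phi j x)]].
Proof.
move=> eps0 [N1 [phi1 [z1 [[phib1 zE] ->]]]].
have [N2 [psi [psib psi_full]]] := dual_ball_total fK fiK.
pose N := (N1 + N2)%N.
pose phi (j : 'I_N) := match fintype.split j with inl i => phi1 i | inr i => psi i end.
pose z (j : 'I_N) := match fintype.split j with inl i => z1 i | inr i => 0 end.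
have lsE i : fintype.split (lshift N2 i) = inl i := unsplitK (inl i).
have rsE i : fintype.split (rshift N1 i) = inr i := unsplitK (inr i).
have phib j : dual_ball (phi j) by rewrite /phi; case: fintype.split.
have eE l : S (fi (row l T)) = \sum_j phi j (b l) *: z j.
  have := zE l; rewrite ffunE => ->.
  rewrite big_split_ord /= [X in _ = _ + X]big1 ?addr0 => [|j _]; last first.
    by rewrite /z rsE scaler0.
  by apply: eq_bigr => j _; rewrite /phi /z lsE.
have ext j : {ps : Z -> K | dual_ball ps /\ forall x, ps (S x) = phi j x}.
  apply: cid; have [ps psb psS] := extend_functional S_iso (phib j).
  by exists ps.
pose phiZ j := sval (ext j).
have phiZb j : dual_ball (phiZ j) by have [] := svalP (ext j).
have phiZS j x : phiZ j (S x) = phi j x by have [_ h] := svalP (ext j); exact: h.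
pose m j := real_norm (z j) + eps / N.+1%:R.
have d0 : 0 < eps / N.+1%:R by rewrite divr_gt0.
exists N, phi, m, (\matrix_(i, j) phiZ i (z j)) => F.
split; [exact: phib| | | |split].
- by move=> j; rewrite ltr_wpDl// real_norm_ge0.
- move=> i j; rewrite mxE; have [_ le] := phiZb i.
  by apply: (le_trans (le _)); rewrite lerDl ltW.
- apply/matrixP => i l; rewrite !mxE.
  have [ps _] := phib i; have [pZs _] := phiZb i.
  transitivity (phiZ i (S (fi (row l T)))).
    rewrite eE scalar_at_sum//; apply: eq_bigr => j _.
    by rewrite scalar_atZ// !mxE mulrC.
  rewrite phiZS (scalar_coord fK fiK)// fiK; apply: eq_bigr => q _.
  by rewrite !mxE mulrC.
- move=> y Fy; apply: (row_full_inj psi_full).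
  rewrite mulmx0; apply/matrixP => j i.
  transitivity ((F *m y) (rshift N1 j) i); last by rewrite Fy !mxE.
  by rewrite !mxE; apply: eq_bigr => q _; rewrite !mxE /phi rsE.
- rewrite /m big_split /= sumr_const card_ord -[X in _ + X <= _]mulr_natr; apply: lerD.
    rewrite big_split_ord /= [X in _ + X]big1 ?addr0 => [|j _]; last first.
      by rewrite /z rsE real_norm0.
    by apply: ler_sum => j _; rewrite /z lsE.
  rewrite -mulrA ler_piMr ?(ltW eps0)// mulrC ler_pdivrMr// mul1r ler_nat//.
- move=> x; rewrite -(isometric_real_norm S_iso).
  have -> : S (fi (f x *m T)) = \sum_j phi j x *: z j.
    rewrite mulmx_sum_row linear_at_sum; last exact: (coord_inv_linear fK fiK).
    rewrite linear_sum /=.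
    rewrite (eq_bigr (fun l => \sum_j (f x 0 l * phi j (b l)) *: z j)); last first.
      move=> l _; rewrite linear_atZ ?linearZ /=; last exact: (coord_inv_linear fK fiK).
      by rewrite eE scaler_sumr; apply: eq_bigr => j _; rewrite scalerA.
    rewrite exchange_big; apply: eq_bigr => j _ /=; rewrite -scaler_suml.
    by have [ps _] := phib j; rewrite [in RHS](scalar_coord fK fiK).
  apply: (le_trans (real_norm_sum _)); apply: ler_sum => j _.
  rewrite real_normZ mulrC ler_wpM2r ?modulus_ge0//.
  by rewrite lerDl ltW.
Qed.

Hypothesis n_ge2 : (2 <= n)%N.

Lemma etf_constant_gt0 : 0 < etf_constant R k n.
Proof.
have n2 : 2 <= n%:R :> R by rewrite ler_nat.
have c0 := etf_angle_gt0 R k n_ge2.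
have th : 0 <= is_real_scalar R k <= 1 by case: (theta01 R k) => ->; rewrite lexx ler01.
have d1 : 1 <= etf_size R k n by rewrite /etf_size ler_pdivlMr; nra.
apply: mulr_gt0; first by rewrite divr_gt0//; lra.
by rewrite ltr_pwDl// mulr_ge0 ?subr_ge0 ?(ltW c0).
Qed.

Lemma relative_projection_constant_le :
  (relative_projection_constant (range S) <= (etf_constant R k n)%:E)%E.
Proof.
have C0 := etf_constant_gt0.
apply: (projection_of_trace_bound fK fiK S_iso C0) => T r Tr.
apply/ler_addgt0Pr => eps eps0.
have eps0' : 0 < eps / etf_constant R k n by rewrite divr_gt0.
have [N [phi [m [M [phib m0 Mm MF [Finj mr _]]]]]] := nuclear_trace_data eps0' Tr.
have := trace_bound m0 Mm MF Finj n_ge2; rewrite mxtrace_tr => /le_trans; apply.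
rewrite -(ler_pM2l C0) mulrDr [_ * (eps / _)]mulrC divfK ?gt_eqF// in mr.
Qed.
End trace_data.

Theorem projection_constant_le (R : realType) (k : scalar_kind) (n : nat)
    (X : normedModType (scalars R k)) : (2 <= n)%N -> has_dimension n X ->
  (projection_constant X <= (etf_constant R k n)%:E)%E.
Proof.
move=> n2 [f [fi fK fiK]]; apply: ub_ereal_sup => _ [Z [S [S_iso ->]]].
exact: (relative_projection_constant_le fK fiK).
Qed.

Theorem max_projection_constant_le (R : realType) (k : scalar_kind) (n : nat) :
  (2 <= n)%N -> (max_projection_constant R k n <= (etf_constant R k n)%:E)%E.
Proof.
move=> n2; apply: ub_ereal_sup => _ [X [Xn ->]]; exact: projection_constant_le.
Qed.

(** * Spaces normed by a maximal ETF *)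

Section pullback.
Variables (K : numFieldType) (V : lmodType K) (W : normedModType K).
Variables (S : {linear V -> W}) (S_inj : injective S).

(** The [let] makes the alias depend on [S] and on its injectivity, so that the norm x |-> |S x| can
    be attached to the type. *)
Definition pullback : Type := let _ := S_inj in V.

HB.instance Definition _ := GRing.Lmodule.copy pullback V.

Definition pullback_norm (x : pullback) : K := `|S x|.

Lemma pullback_normD x y :
  pullback_norm (x + y) <= pullback_norm x + pullback_norm y.
Proof. by rewrite /pullback_norm linearD ler_normD. Qed.

Lemma pullback_normZ a x : pullback_norm (a *: x) = `|a| * pullback_norm x.
Proof. by rewrite /pullback_norm linearZ normrZ. Qed.

Lemma pullback_norm_eq0 x : pullback_norm x = 0 -> x = 0.
Proof.
move/eqP; rewrite normr_eq0 => /eqP Sx0; apply: S_inj.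
by rewrite Sx0 linear0.
Qed.

HB.instance Definition _ := Lmodule_isNormed.Build K pullback
  pullback_normD pullback_normZ pullback_norm_eq0.

Definition pullback_space : normedModType K := pullback.

Definition pullback_map (x : pullback_space) : W := S x.

Lemma pullback_map_linear : linear pullback_map.
Proof. by move=> a x y; rewrite /pullback_map linearP. Qed.

HB.instance Definition _ := GRing.isLinear.Build K pullback_space W *:%R
  pullback_map pullback_map_linear.

Lemma pullback_map_isometric : isometric_embedding pullback_map.
Proof. by []. Qed.
End pullback.

Section sup_norm.
Variables (R : realType) (k : scalar_kind) (N : nat).
Local Notation K := (scalars R k).
Implicit Types y : 'rV[K]_N.

Lemma row_entry_le y i : modulus (y 0 i) <= real_norm y.
Proof.
rewrite -(@le_real R k) -normE -normrE.
change `|y| with (mx_norm y); rewrite mx_normE -[leLHS]nngE num_le.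
exact: (le_bigmax _ (fun ij : 'I_1 * 'I_N => `|y ij.1 ij.2|%:nng) (0, i)).
Qed.

Lemma row_norm_attained y : y != 0 -> exists i, modulus (y 0 i) = real_norm y.
Proof.
move=> y0; have : mx_norm y != 0 by apply: contraNneq y0 => /mx_norm_eq0 ->.
case/mx_norm_neq0 => -[i j] /= yE; exists j.
by rewrite /real_norm; change `|y| with (mx_norm y); rewrite yE ord1.
Qed.

Lemma row_norm_le y r : 0 <= r -> (forall i, modulus (y 0 i) <= r) -> real_norm y <= r.
Proof.
move=> r0 yr; have [->|/row_norm_attained[i <-]//] := eqVneq y 0.
by rewrite real_norm0.
Qed.
End sup_norm.

Section inner_product.
Variables (R : realType) (k : scalar_kind) (n : nat).
Local Notation K := (scalars R k).
Local Notation conj := (@scalar_conj R k).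
Implicit Types x y : 'rV[K]_n.

Lemma ip_linear y : scalar (fun x : 'rV[K]_n => inner_product x y).
Proof.
move=> a u v; rewrite /inner_product mulr_sumr -big_split /=.
by apply: eq_bigr => i _; rewrite !mxE; ring.
Qed.

Lemma ip_conj x y : conj (inner_product x y) = inner_product y x.
Proof.
rewrite /inner_product rmorph_sum; apply: eq_bigr => i _.
by rewrite rmorphM /= conjK mulrC.
Qed.

Lemma ipZl a x y : inner_product (a *: x) y = a * inner_product x y.
Proof. exact: (scalar_atZ a x (ip_linear y)). Qed.

Lemma ip_suml (I : finType) y (F : I -> 'rV[K]_n) :
  inner_product (\sum_i F i) y = \sum_i inner_product (F i) y.
Proof. exact: (scalar_at_sum F (ip_linear y)). Qed.

Lemma ip_sumr (I : finType) x (F : I -> K) (w : I -> 'rV[K]_n) :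
  inner_product x (\sum_i F i *: w i) = \sum_i conj (F i) * inner_product x (w i).
Proof.
rewrite -ip_conj ip_suml rmorph_sum; apply: eq_bigr => i _ /=.
by rewrite ipZl rmorphM /= ip_conj.
Qed.

Lemma ip_delta x i : inner_product x (delta_mx 0 i) = x 0 i.
Proof.
rewrite /inner_product (bigD1 i)//= mxE !eqxx rmorph1 mulr1 big1 ?addr0// => j ji.
by rewrite mxE (negPf ji) andbF rmorph0 mulr0.
Qed.
End inner_product.

(** * Angle and expansion of a maximal ETF *)

Section etf.
Variables (R : realType) (k : scalar_kind) (n : nat).
Hypothesis n_ge2 : (2 <= n)%N.
Local Notation K := (scalars R k).
Local Notation conj := (@scalar_conj R k).
Local Notation rs := (@real_scalar R k).
Local Notation d := (max_ETF_size k n).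
Local Notation theta := (is_real_scalar R k).
Local Notation c := (etf_angle R k n).

Lemma etf_sizeE : etf_size R k n = d%:R.
Proof.
rewrite /etf_size /max_ETF_size /is_real_scalar; case: k; last first.
  by rewrite !addr0 invr1 mulr1 natrX expr2.
have two0 : (2 : R) != 0 by rewrite pnatr_eq0.
apply: (mulIf two0); rewrite -natrM divnK; last by rewrite dvdn2 oddM /= andbN.
by rewrite natrM -[1 + 1]mulr2n divfK// natr1.
Qed.

Lemma etf_size_gt1 : (1 < d)%N.
Proof.
rewrite -(@ltr_nat R) -etf_sizeE /etf_size.
have n2 : 2 <= n%:R :> R by rewrite ler_nat.
by case: (theta01 R k) => ->; rewrite ltr_pdivlMr; nra.
Qed.

Variable w : 'I_d -> 'rV[K]_n.
Hypothesis w_etf : equiangular_tight_frame w.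

Let D : R := 1 + (d%:R - 1) * c.

Lemma etf_unit i : inner_product (w i) (w i) = 1.
Proof. by case: w_etf => -[]. Qed.

Lemma etf_frame_angle : exists a : K,
  [/\ forall x, x = a *: \sum_i inner_product x (w i) *: w i,
      a * (1 + (d%:R - 1) * rs c ^+ 2) = 1 &
      forall i j, i != j -> modulus (inner_product (w i) (w j)) = c].
Proof.
have [[w_inj w1 [c' c'E]] [a aE]] := w_etf.
have c'_all i j : i != j -> `|inner_product (w i) (w j)| = c'.
  rewrite neq_ltn => /orP[/c'E//|/c'E <-].
  by rewrite -ip_conj !normE modulus_conj.
have trE : a * d%:R = n%:R.
  transitivity (\sum_(p < n) (delta_mx 0 p : 'rV[K]_n) 0 p); last first.
    rewrite (eq_bigr (fun=> 1)) ?sumr_const ?card_ord// => p _.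
    by rewrite mxE !eqxx.
  rewrite [RHS](eq_bigr (fun p => \sum_i a * (w i 0 p * conj (w i 0 p)))); last first.
    move=> p _; rewrite (aE (delta_mx 0 p)) mxE summxE mulr_sumr; apply: eq_bigr => i _.
    by rewrite mxE -ip_conj ip_delta [conj _ * _]mulrC.
  rewrite exchange_big (eq_bigr (fun=> a)) ?sumr_const ?card_ord ?mulr_natr// => i _.
  by rewrite -mulr_sumr -[\sum_p _]/(inner_product (w i) (w i)) w1 mulr1.
have d1 := etf_size_gt1.
have i0 : 'I_d by exact: (Ordinal (ltnW d1)).
have ac : a * (1 + (d%:R - 1) * c' ^+ 2) = 1.
  have := congr1 (fun x => inner_product x (w i0)) (aE (w i0)).
  rewrite ipZl ip_suml w1 => e; rewrite [RHS]e; congr (_ * _).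
  rewrite [RHS](bigD1 i0)//= ipZl w1 mulr1; congr (_ + _).
  rewrite [RHS](eq_bigr (fun=> c' ^+ 2)).
    by rewrite sumr_const cardC1 card_ord -[RHS]mulr_natl -subn1 natrB ?(ltnW d1).
  move=> j ji; rewrite ipZl -[inner_product (w j) _]ip_conj mul_conj.
  by rewrite rmorphXn /= -normE c'_all// eq_sym.
have a0 : a != 0 by apply: contra_eqN ac => /eqP ->; rewrite mul0r eq_sym oner_eq0.
have c'0 : 0 <= c'.
  by rewrite -(c'E (Ordinal (ltnW d1)) (Ordinal d1)).
have n0 : n%:R != 0 :> R by rewrite pnatr_eq0; case: n n_ge2.
have dn_c : n%:R * (1 + (d%:R - 1) * c ^+ 2) = d%:R :> R.
  have c2 := etf_angle_sqr R k n_ge2; rewrite -etf_sizeE.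
  have n0' : (n%:R + 1 + theta) != 0.
    have th0 : 0 <= theta by case: (theta01 R k) => ->.
    by have := ler0n R n => n0'; rewrite gt_eqF//; lra.
  have -> : c ^+ 2 = (n%:R + 1 + theta)^-1.
    by apply: (mulfI n0'); rewrite c2 mulfV.
  rewrite /etf_size; move: n0'; case: (theta01 R k) => -> n0'; field.
    by rewrite -(addr0 (n%:R + 1)).
  by [].
have c'rs : c' = rs c.
  apply/eqP; rewrite -(@eqrXn2 _ 2)// ?real_ge0 ?(ltW (etf_angle_gt0 R k n_ge2))//.
  have nK : n%:R != 0 :> K by rewrite -(rmorph_nat rs) -(rmorph0 rs) (inj_eq (@real_inj R k)).
  have d1K : d%:R - 1 != 0 :> K.
    rewrite subr_eq0 -(rmorph_nat rs) -(rmorph1 rs) (inj_eq (@real_inj R k)).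
    by rewrite pnatr_eq1 gtn_eqF.
  have dn_c' : n%:R * (1 + (d%:R - 1) * c' ^+ 2) = d%:R :> K.
    by rewrite -trE mulrAC ac mul1r.
  have := congr1 rs dn_c; rewrite !(rmorphM, rmorphD, rmorphN, rmorph_nat, rmorph1) /=.
  move=> e1; have /(mulfI nK)/addrI h := etrans e1 (esym dn_c'); have e := mulfI d1K h.
  by apply/eqP; rewrite -e expr2.
exists a; split => //; first by rewrite -c'rs.
by move=> i j ij; apply: (@real_inj R k); rewrite -normE c'_all.
Qed.
End etf.

Section frame_spaces.
Variables (R : realType) (k : scalar_kind) (n : nat).
Hypothesis n_ge2 : (2 <= n)%N.
Local Notation K := (scalars R k).
Local Notation conj := (@scalar_conj R k).
Local Notation rs := (@real_scalar R k).
Local Notation d := (max_ETF_size k n).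
Local Notation c := (etf_angle R k n).
Variable w : 'I_d -> 'rV[K]_n.
Hypothesis w_etf : equiangular_tight_frame w.

Definition etf_sum : R := 1 + (d%:R - 1) * c.

Lemma etf_sum_gt0 : 0 < etf_sum.
Proof.
have d1 : 1 <= d%:R :> R by rewrite ler1n ltnW// etf_size_gt1.
by rewrite ltr_pwDl// mulr_ge0 ?subr_ge0// ltW// etf_angle_gt0.
Qed.

Lemma etf_spans x : (forall i, inner_product x (w i) = 0) -> x = 0.
Proof.
have [a [aE _ _]] := etf_frame_angle n_ge2 w_etf.
by move=> x0; rewrite [x]aE big1 ?scaler0// => i _; rewrite x0 scale0r.
Qed.

(** For j <> i the product <w_j, w_i> is c times a phase. Dividing these terms of the frame identity
    for <x, w_i> by c turns all coefficients into phases, and collecting the multiples of <x, w_i>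
    yields the factor D = 1 + (d - 1) c. *)
Lemma etf_self_expansion i : exists xi : 'I_d -> K,
  [/\ forall j, modulus (xi j) = 1,
    forall j, xi j * inner_product (w i) (w j) = rs (modulus (inner_product (w i) (w j))) &
    forall x, rs etf_sum * inner_product x (w i) = \sum_j xi j * inner_product x (w j)].
Proof.
have [a [aE ac angle]] := etf_frame_angle n_ge2 w_etf.
have c0 := etf_angle_gt0 R k n_ge2.
have cK : rs c != 0 by rewrite -(rmorph0 rs) (inj_eq (@real_inj R k)) gt_eqF.
exists (fun j => if j == i then 1 else inner_product (w j) (w i) / rs c); split=> [j|j|x].
  case: eqP => [_|/eqP ji]; first by rewrite modulus1.
  by rewrite -fmorphV modulusM modulus_real angle// ger0_norm ?invr_ge0 ?(ltW c0)// divff ?gt_eqF.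
  case: eqP => [->|/eqP ji]; first by rewrite (etf_unit w_etf) modulus1 rmorph1 mulr1.
  rewrite mulrAC -[inner_product (w j) _]ip_conj [conj _ * _]mulrC mul_conj angle 1?eq_sym//.
  by rewrite rmorphXn /= expr2 mulfK.
have a0 : a != 0 by apply: contra_eqN ac => /eqP ->; rewrite mul0r eq_sym oner_eq0.
have frame_x : inner_product x (w i) =
    a * \sum_j inner_product x (w j) * inner_product (w j) (w i).
  rewrite {1}[x]aE ipZl ip_suml; congr (_ * _); apply: eq_bigr => j _.
  by rewrite ipZl.
rewrite (bigD1 i)//= eqxx mul1r.
rewrite (eq_bigr (fun j => (rs c)^-1 * (inner_product x (w j) * inner_product (w j) (w i)))); last first.
  by move=> j /negPf ->; ring.
rewrite -mulr_sumr; move: frame_x; rewrite (bigD1 i)//= (etf_unit w_etf) mulr1.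
set y := inner_product x (w i); set s := \sum_(j | _) _ => yE.
have sE : y + s = (1 + (d%:R - 1) * rs c ^+ 2) * y.
  by apply: (mulfI a0); rewrite -yE mulrA ac mul1r.
have {}sE : s = (d%:R - 1) * rs c ^+ 2 * y.
  by apply: (addrI y); rewrite sE; ring.
have -> : rs etf_sum = 1 + (d%:R - 1) * rs c.
  by rewrite /etf_sum rmorphD rmorphM rmorphB rmorph_nat rmorph1.
have aux (e q z : K) : q != 0 ->
    (1 + (e - 1) * q) * z = z + q^-1 * ((e - 1) * q ^+ 2 * z).
  move=> q0; rewrite (_ : q^-1 * _ = (q^-1 * q) * ((e - 1) * q * z)); last by ring.
  by rewrite mulVf//; ring.
by rewrite (aux _ _ _ cK) sE.
Qed.

Variables (N : nat) (th : 'I_N -> 'rV[K]_n).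
Hypothesis th_w : forall j, exists i, th i = w j.

Definition coefficients (x : 'rV[K]_n) : 'rV[K]_N := \row_i inner_product x (th i).

Lemma coefficients_linear : linear coefficients.
Proof. by move=> a x y; apply/rowP => i; rewrite !mxE (ip_linear (th i)). Qed.

HB.instance Definition _ := GRing.isLinear.Build K 'rV[K]_n 'rV[K]_N *:%R
  coefficients coefficients_linear.

Lemma coefficients_inj : injective coefficients.
Proof.
move=> x y xy; apply/eqP; rewrite -subr_eq0; apply/eqP/etf_spans => j.
have [i <-] := th_w j.
have /rowP/(_ i) : coefficients (x - y) = 0 by rewrite linearB /= xy subrr.
by rewrite !mxE.
Qed.

Definition frame_space := pullback_space coefficients_inj.
Local Notation X := frame_space.

Lemma frame_space_dim : has_dimension n X.
Proof.
pose id_map (x : X) : 'rV[K]_n := x.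
have lin : linear id_map by [].
pose L : {linear X -> 'rV[K]_n} :=
  HB.pack id_map (GRing.isLinear.Build _ _ _ _ id_map lin).
by exists L, id.
Qed.

Lemma frame_space_norm_ge (x : X) i : modulus (inner_product x (th i)) <= real_norm x.
Proof.
by have := row_entry_le (coefficients x) i; rewrite mxE.
Qed.

Hypothesis th_expansion : forall i, exists2 xi : 'I_d -> K,
  forall j, modulus (xi j) <= 1 &
  forall x, rs etf_sum * inner_product x (th i) = \sum_j xi j * inner_product x (w j).

(* The identity of X, multiplied by etf_sum, is sum_j <., w_j> (x) zeta_j with
   |zeta_j| <= 1 in the sup norm; composing it with a projection and taking
   traces bounds the norm of the projection from below. *)
Lemma frame_space_projection_constant :
  ((etf_constant R k n)%:E <= projection_constant X)%E.
Proof.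
pose S : {linear X -> 'rV[K]_N} := @pullback_map _ _ _ _ coefficients_inj.
apply: (@le_trans _ _ (relative_projection_constant (range S))); last first.
  by apply: ereal_sup_ubound; exists 'rV[K]_N, S; split.
apply: le_ereal_inf_tmp => _ [P [PS SP] <-].
pose xi i j := sval (cid2 (th_expansion i)) j.
have xi1 i j : modulus (xi i j) <= 1 by rewrite /xi; case: cid2.
have xiE i x : rs etf_sum * inner_product x (th i) = \sum_j xi i j * inner_product x (w j).
  by rewrite /xi; case: cid2.
pose zeta j : 'rV[K]_N := \row_i xi i j.
have zeta1 j : real_norm (zeta j) <= 1.
  by apply: row_norm_le => // i; rewrite mxE.
have yP j : exists y : X, P (zeta j) = S y.
  by have [y _ yE] := PS (P (zeta j)) (ex_intro2 _ _ (zeta j) I erefl); exists y.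
pose y j := sval (cid (yP j)).
have yE j : P (zeta j) = S (y j) by rewrite /y; case: cid.
have SE x : rs etf_sum *: S x = \sum_j inner_product x (w j) *: zeta j.
  apply/rowP => i; rewrite !mxE xiE summxE; apply: eq_bigr => j _.
  by rewrite !mxE mulrC.
have idE (x : X) : rs etf_sum *: x = \sum_j inner_product x (w j) *: y j.
  apply: coefficients_inj; change (S (rs etf_sum *: x) = S (\sum_j inner_product x (w j) *: y j)).
  rewrite linearZ /= -[S x]SP; last by exists x.
  rewrite -linearZ /= SE !linear_sum; apply: eq_bigr => j _ /=.
  by rewrite !linearZ /= yE.
have trE : rs etf_sum * n%:R = \sum_j inner_product (y j) (w j).
  rewrite (eq_bigr (fun j => \sum_p y j 0 p * conj (w j 0 p)))// exchange_big /=.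
  rewrite mulr_natr -{1}(card_ord n) -sumr_const; apply: eq_bigr => p _.
  have := congr1 (fun z : 'rV[K]_n => z 0 p) (idE (delta_mx 0 p)).
  rewrite mxE mxE !eqxx mulr1 => ->; rewrite summxE; apply: eq_bigr => j _.
  by rewrite mxE -ip_conj ip_delta mulrC.
have d0 : 0 < d%:R :> R by rewrite ltr0n ltnW// etf_size_gt1.
have CE : etf_constant R k n * d%:R = etf_sum * n%:R.
  rewrite /etf_constant (etf_sizeE R k n) /etf_sum.
  by move: (d%:R : R) d0 => e e0; rewrite mulrAC divfK ?gt_eqF// mulrC.
have [j le_j] : exists j, etf_constant R k n <= real_norm (P (zeta j)).
  apply: contrapT => /forallNP lt_j.
  have : etf_sum * n%:R < etf_constant R k n * d%:R.
    rewrite -[ltLHS]ger0_norm ?mulr_ge0 ?(ltW etf_sum_gt0)// -(@modulus_real R k).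
    rewrite rmorphM /= rmorph_nat trE; apply: (le_lt_trans (modulus_sum _ _)).
    have -> : etf_constant R k n * d%:R = \sum_(j < d) etf_constant R k n.
      by rewrite sumr_const card_ord mulr_natr.
    have lt j : modulus (inner_product (y j) (w j)) < etf_constant R k n.
      have [i <-] := th_w j; apply: (le_lt_trans (frame_space_norm_ge (y j) i)).
      rewrite ltNge; apply/negP => le_y; apply: (lt_j j); rewrite yE.
      by rewrite (isometric_real_norm (@pullback_map_isometric _ _ _ _ coefficients_inj)).
    have j0 : 'I_d by exact: (Ordinal (ltnW (etf_size_gt1 R k n_ge2))).
    rewrite (bigD1 j0)//= [ltRHS](bigD1 j0)//= ltr_leD// ler_sum// => j _.
    exact: ltW.
  by rewrite CE ltxx.
apply: (@le_trans _ _ (real_norm (P (zeta j)))%:E); first by rewrite lee_fin.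
by apply: ereal_sup_ubound; exists (zeta j) => /=.
Qed.

Lemma max_projection_constantE : max_projection_constant R k n = (etf_constant R k n)%:E.
Proof.
apply/eqP; rewrite eq_le max_projection_constant_le//=.
apply: (le_trans frame_space_projection_constant).
by apply: ereal_sup_ubound; exists X; split => //; exact: frame_space_dim.
Qed.

Lemma frame_space_maximal : maximal_space n X.
Proof.
split; first exact: frame_space_dim.
apply/eqP; rewrite max_projection_constantE eq_le frame_space_projection_constant.
by rewrite projection_constant_le//; exact: frame_space_dim.
Qed.

End frame_spaces.

(** * Invariants of polyhedral norms *)

Section polyhedral.
Variables (R : realType) (k : scalar_kind) (N : nat).
Local Notation K := (scalars R k).
Local Notation rs := (@real_scalar R k).
Implicit Types X Y : normedModType K.

Definition norming_family X (phi : 'I_N -> X -> K) :=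
  [/\ forall i, scalar (phi i), forall i x, modulus (phi i x) <= real_norm x &
      forall x, x != 0 -> exists i, modulus (phi i x) = real_norm x].

Lemma norming_family_row X (phi : 'I_N -> X -> K) (x : X) :
  norming_family phi -> real_norm (\row_i phi i x) = real_norm x.
Proof.
case=> phis phib phin; apply/eqP; rewrite eq_le.
rewrite row_norm_le ?real_norm_ge0//=; last by move=> i; rewrite mxE.
have [->|/phin[i <-]] := eqVneq x 0; first by rewrite real_norm0 real_norm_ge0.
by have := row_entry_le (\row_i phi i x) i; rewrite mxE.
Qed.

(** The family embeds X into K^N with the sup norm, and [f] extends to that space. Evaluating the
    extension at a vector of suitable phases shows that the moduli of its coefficients sum to at
    most 1. *)
Lemma dual_ball_combination X (phi : 'I_N -> X -> K) (f : X -> K) :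
  norming_family phi -> dual_ball f ->
  exists2 a : 'I_N -> K, \sum_i modulus (a i) <= 1 & forall x, f x = \sum_i a i * phi i x.
Proof.
move=> phiN [fs fb]; have [phis phib phin] := phiN.
have [|||||g [gs gA gp]] := @hahn_banach R k 'rV[K]_N X (@real_norm R k 'rV[K]_N)
  (fun x => \row_i phi i x) f.
- exact: real_normD.
- exact: real_normZ.
- by move=> a x y; apply/rowP => i; rewrite !mxE phis.
- exact: fs.
- by move=> x; rewrite norming_family_row// (le_trans (re_le_modulus _)).
have g_sum (y : 'rV[K]_N) : g y = \sum_i g (delta_mx 0 i) * y 0 i.
  rewrite [y in LHS]row_sum_delta scalar_at_sum//; apply: eq_bigr => i _.
  by rewrite scalar_atZ// mulrC.
exists (fun i => g (delta_mx 0 i)) => [|x]; last first.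
  by rewrite -gA g_sum; apply: eq_bigr => i _; rewrite mxE.
have [s sP] := choice (fun i => modulus_phase (g (delta_mx 0 i))).
have s1 i : modulus (s i) = 1 by have [] := sP i.
have sE i : s i * g (delta_mx 0 i) = rs (modulus (g (delta_mx 0 i))) by have [] := sP i.
pose y : 'rV[K]_N := \row_i s i.
have <- : modulus (g y) = \sum_i modulus (g (delta_mx 0 i)).
  rewrite g_sum -[RHS]ger0_norm ?sumr_ge0//; last by move=> i _; exact: modulus_ge0.
  rewrite -(@modulus_real R k) rmorph_sum; congr modulus; apply: eq_bigr => i _.
  by rewrite mxE mulrC sE.
by apply: (le_trans (gp y)); apply: row_norm_le => // i; rewrite mxE s1.
Qed.

Definition peaked X (phi : 'I_N -> X -> K) := forall i, exists x : X,
  [/\ x != 0, modulus (phi i x) = real_norm x &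
      forall j, j != i -> modulus (phi j x) < real_norm x].

(** Let x be a peak of [phi i], and let [psi j] norm T x. Then [psi j] composed with T is a
    combination of the [phi l] with total modulus at most 1 that reaches |x| at x. Every [phi l]
    with l <> i is strictly smaller there, so only the i-th coefficient survives, and it has modulus
    1. *)
Lemma isometry_permutes X Y (phi : 'I_N -> X -> K) (psi : 'I_N -> Y -> K)
    (T : {linear X -> Y}) :
  isometric_embedding T -> norming_family phi -> peaked phi -> norming_family psi ->
  exists (pi : 'I_N -> 'I_N) (a : 'I_N -> K),
    [/\ injective pi, forall i, modulus (a i) = 1 &
        forall i x, psi (pi i) (T x) = a i * phi i x].
Proof.
move=> T_iso phiN phiP psiN; have [phis phib phin] := phiN.
have [psis psib psin] := psiN.
have T_norm x : real_norm (T x) = real_norm x by exact: isometric_real_norm.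
have step i : exists ja : 'I_N * K, modulus ja.2 = 1 /\
    forall x, psi ja.1 (T x) = ja.2 * phi i x.
  have [x [x0 xi xj]] := phiP i.
  have r0 : 0 < real_norm x.
    rewrite lt_def real_norm_ge0 andbT; apply: contraNneq x0 => /real_norm_eq0 ->.
    by [].
  have Tx0 : T x != 0.
    apply/eqP => Tx0; move: r0; rewrite -T_norm Tx0 real_norm0 ltxx//.
  have [j jE] := psin _ Tx0.
  have psiT : dual_ball (fun x => psi j (T x)).
    split=> [b u v|u]; first by rewrite linearP psis.
    by rewrite -T_norm.
  have [a a1 aE] := dual_ball_combination phiN psiT.
  have le_r : real_norm x <= \sum_l modulus (a l) * modulus (phi l x).
    rewrite -T_norm -jE aE; apply: (le_trans (modulus_sum _ _)).
    by apply: ler_sum => l _; rewrite modulusM.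
  have a_l l : l != i -> a l = 0.
    move=> li; apply/eqP; rewrite -modulus_eq0; apply/negPn/negP => al0.
    have al : 0 < modulus (a l) by rewrite lt_def al0 modulus_ge0.
    have : \sum_l modulus (a l) * modulus (phi l x) < (\sum_l modulus (a l)) * real_norm x.
      rewrite mulr_suml (bigD1 l)//= [ltRHS](bigD1 l)//= ltr_leD//.
        by rewrite ltr_pM2l// xj.
      by apply: ler_sum => q _; rewrite ler_wpM2l ?modulus_ge0.
    move=> /(le_lt_trans le_r); rewrite -[X in X < _]mul1r ltr_pM2r//.
    by rewrite ltNge a1.
  exists (j, a i) => /=.
  have psiE u : psi j (T u) = a i * phi i u.
    by rewrite aE (bigD1 i)//= big1 ?addr0// => l li; rewrite a_l// mul0r.
  split=> //; have := jE; rewrite psiE modulusM xi T_norm.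
  by rewrite -[RHS]mul1r => /(mulIf (lt0r_neq0 r0)).
have [ja jaP] := choice step.
exists (fun i => (ja i).1), (fun i => (ja i).2); split.
- move=> i i' ii'; apply/eqP; apply/negPn/negP => ii'n.
  have [x [x0 xi xj]] := phiP i.
  have := xj i'; rewrite eq_sym => /(_ ii'n).
  have : modulus (psi (ja i).1 (T x)) = modulus (psi (ja i').1 (T x)) by rewrite ii'.
  have [a1 ->] := jaP i; have [a1' ->] := jaP i'.
  by rewrite !modulusM a1 a1' !mul1r xi => <-; rewrite ltxx.
- by move=> i; have [] := jaP i.
- by move=> i x; have [_ ->] := jaP i.
Qed.
End polyhedral.

(** * Minors as isometry invariants *)

Section determinants.
Variables (R : realType) (k : scalar_kind) (n N : nat).
Local Notation K := (scalars R k).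
Implicit Types (th : 'I_N -> 'rV[K]_n) (h : {ffun 'I_n -> 'I_N}).

Definition minor th h : K := \det (\matrix_(a, b) th (h a) 0 b).

(** The sum runs over all maps; those with repetitions have minor 0. A permutation of the vectors
    then acts by reindexing. *)
Definition minor_sum th p : R := \sum_h modulus (minor th h) ^+ p.

Lemma minor_sum_equivariant th th' (pi : 'I_N -> 'I_N) (a : 'I_N -> K) (A : 'M[K]_n) p :
  injective pi -> (forall i, modulus (a i) = 1) ->
  (forall i, th' (pi i) *m A = a i *: th i) ->
  minor_sum th p = modulus (\det A) ^+ p * minor_sum th' p.
Proof.
move=> pi_inj a1 thE.
have [pii piK piiK] := injF_bij pi_inj.
rewrite {2}/minor_sum.
rewrite (reindex (fun h => [ffun x => pi (h x)])) /=; last first.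
  exists (fun h => [ffun x => pii (h x)]) => h _; apply/ffunP => x.
    by rewrite !ffunE piK.
  by rewrite !ffunE piiK.
rewrite mulr_sumr; apply: eq_bigr => h _; rewrite -exprMn -modulusM mulrC -det_mulmx.
congr (_ ^+ p).
have -> : (\matrix_(x, b) th' ([ffun x => pi (h x)] x) 0 b) *m A =
    diag_mx (\row_x a (h x)) *m \matrix_(x, b) th (h x) 0 b.
  apply/matrixP => x b; rewrite mul_diag_mx !mxE.
  have /rowP/(_ b) := thE (h x); rewrite !mxE => <-.
  by apply: eq_bigr => y _; rewrite !mxE ffunE.
rewrite det_mulmx det_diag modulusM -[LHS]mul1r; congr (_ * _).
have : modulus (\prod_x a (h x)) = 1.
  apply: (big_ind (fun z => modulus z = 1)) => [|u v u1 v1|//]; first exact: modulus1.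
  by rewrite modulusM u1 v1 mulr1.
by move=> <-; congr modulus; apply: eq_bigr => x _; rewrite mxE.
Qed.

(** The factors |det A|^4 and (|det A|^2)^2 cancel. *)
Lemma minor_ratio_invariant th th' pi a (A : 'M[K]_n) :
  injective pi -> (forall i, modulus (a i) = 1) ->
  (forall i, th' (pi i) *m A = a i *: th i) ->
  minor_sum th 4 * minor_sum th' 2 ^+ 2 = minor_sum th' 4 * minor_sum th 2 ^+ 2.
Proof.
move=> pi_inj a1 thE.
by rewrite !(minor_sum_equivariant _ pi_inj a1 thE); ring.
Qed.
End determinants.

Section scaled_family.
Variables (R : realType) (k : scalar_kind) (n d : nat).
Local Notation K := (scalars R k).
Local Notation rs := (@real_scalar R k).
Variables (w : 'I_d -> 'rV[K]_n) (g : 'rV[K]_n).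

Definition adjoin (l : R) (i : 'I_d.+1) : 'rV[K]_n :=
  if unlift ord0 i is Some j then w j else rs l *: g.

Lemma adjoin0 l : adjoin l ord0 = rs l *: g.
Proof. by rewrite /adjoin unlift_none. Qed.

Lemma adjoinS l j : adjoin l (lift ord0 j) = w j.
Proof. by rewrite /adjoin liftK. Qed.

Definition hits0 (h : {ffun 'I_n -> 'I_d.+1}) := [exists a, h a == ord0].

(** A map that takes the value [ord0] twice selects two equal rows, so in a nonzero minor the scalar
    l occurs at most once. *)
Lemma minor_adjoin l h :
  minor (adjoin l) h = (if hits0 h then rs l else 1) * minor (adjoin 1) h.
Proof.
pose s a : K := if h a == ord0 then rs l else 1.
have -> : minor (adjoin l) h = (\prod_a s a) * minor (adjoin 1) h.
  rewrite -[\prod_a _](_ : \det (diag_mx (\row_a s a)) = _); last first.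
    by rewrite det_diag; apply: eq_bigr => a _; rewrite mxE.
  rewrite -det_mulmx; congr determinant; apply/matrixP => a b.
  rewrite mul_diag_mx !mxE /s; case: eqP => [->|/eqP ha].
    by rewrite !adjoin0 !mxE rmorph1 mul1r.
  rewrite mul1r; have [j ->|hE] := unliftP ord0 (h a); first by rewrite !adjoinS.
  by rewrite hE eqxx in ha.
case: ifPn => [/existsP[a /eqP ha]|/existsPn h0]; last first.
  congr (_ * _); apply: big1 => a _; rewrite /s ifN//.
have [/existsP[b /andP[ba /eqP hb]]|/existsPn nob] := boolP [exists b, (b != a) && (h b == ord0)].
  have -> : minor (adjoin 1) h = 0.
    by apply: (determinant_alternate ba) => x; rewrite !mxE ha hb.
  by rewrite !mulr0.
congr (_ * _); rewrite (bigD1 a)//= {1}/s ha eqxx big1 ?mulr1// => b ba.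
by have := nob b; rewrite ba /= => /negPf; rewrite /s => ->.
Qed.

Definition fixed_minors p : R := \sum_(h | ~~ hits0 h) modulus (minor (adjoin 1) h) ^+ p.
Definition scaled_minors p : R := \sum_(h | hits0 h) modulus (minor (adjoin 1) h) ^+ p.

Lemma minor_sum_adjoin l p : 0 <= l ->
  minor_sum (adjoin l) p = fixed_minors p + l ^+ p * scaled_minors p.
Proof.
move=> l0; rewrite /minor_sum /fixed_minors /scaled_minors (bigID (fun h => hits0 h)) /=.
rewrite [LHS]addrC; congr (_ + _).
  by apply: eq_bigr => h /negPf h0; rewrite minor_adjoin h0 mul1r.
rewrite mulr_sumr; apply: eq_bigr => h h0.
by rewrite minor_adjoin h0 modulusM modulus_real ger0_norm// exprMn.
Qed.

Hypothesis w_full : row_full (\matrix_(i, b) w i 0 b).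
Hypothesis g0 : g != 0.

Let F : {ffun 'I_n -> 'I_d} := fullrankfun w_full.
Let B : 'M[K]_n := \matrix_(a, b) w (F a) 0 b.

Let B_unit : B \in unitmx.
Proof.
have := fullrowsub_unit w_full; congr (_ \in unitmx).
by apply/matrixP => a b; rewrite !mxE.
Qed.

Lemma fixed_minors_gt0 p : 0 < fixed_minors p.
Proof.
pose h : {ffun 'I_n -> 'I_d.+1} := [ffun a => lift ord0 (F a)].
rewrite /fixed_minors (bigD1 h)/=; last first.
  by apply/existsPn => a; rewrite ffunE eq_sym neq_lift.
apply: ltr_wpDr; first by apply: sumr_ge0 => i _; rewrite exprn_ge0 ?modulus_ge0.
rewrite exprn_gt0// lt_def modulus_ge0 andbT modulus_eq0.
rewrite (_ : minor _ _ = \det B) -?unitfE -?unitmxE//.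
congr determinant; apply/matrixP => a b; rewrite !mxE ffunE adjoinS//.
Qed.

(* Cramer's rule: some coordinate of g in the basis B is nonzero. *)
Lemma scaled_minors_gt0 p : 0 < scaled_minors p.
Proof.
pose v := g *m invmx B.
have gE : g = v *m B by rewrite mulmxKV.
have [a va] : exists a, v 0 a != 0.
  apply/existsP; apply: contraNT g0 => /existsPn v0.
  rewrite gE (_ : v = 0) ?mul0mx//; apply/rowP => a; rewrite [RHS]mxE.
  by apply/eqP; have := v0 a; rewrite negbK.
pose h : {ffun 'I_n -> 'I_d.+1} := [ffun b => if b == a then ord0 else lift ord0 (F b)].
rewrite /scaled_minors (bigD1 h)/=; last first.
  by apply/existsP; exists a; rewrite ffunE eqxx.
apply: ltr_wpDr; first by apply: sumr_ge0 => i _; rewrite exprn_ge0 ?modulus_ge0.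
rewrite exprn_gt0// lt_def modulus_ge0 andbT modulus_eq0.
suff -> : minor (adjoin 1) h = v 0 a * \det B.
  by rewrite mulf_neq0// -unitfE -unitmxE.
rewrite /minor; set M := \matrix_(_, _) _.
have cof b : cofactor M a b = cofactor B a b.
  rewrite /cofactor; congr (_ * \det _); apply/matrixP => x y; rewrite !mxE.
  by rewrite ffunE eq_sym (negPf (neq_lift _ _)) adjoinS.
have MaE b : M a b = \sum_c v 0 c * B c b.
  by rewrite mxE ffunE eqxx adjoin0 rmorph1 scale1r gE mxE.
rewrite (expand_det_row _ a).
rewrite (eq_bigr (fun b => \sum_c v 0 c * (B c b * cofactor B a b))); last first.
  by move=> b _; rewrite MaE cof mulr_suml; apply: eq_bigr => c _; rewrite mulrA.
rewrite exchange_big /= (bigD1 a)//= -mulr_sumr -expand_det_row big1 ?addr0// => c ca.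
rewrite -mulr_sumr (_ : \sum_i _ = (B *m \adj B) c a).
  by rewrite mul_mx_adj [X in _ * X]mxE (negPf ca) mulr0n mulr0.
by rewrite [RHS]mxE; apply: eq_bigr => b _; rewrite [(\adj B) b a]mxE.
Qed.
End scaled_family.

(** The derivative of (A4 + x^2 B4) / (A2 + x B2)^2 has the sign of A2 B4 x - A4 B2 for x > 0. The
    hypothesis puts [mu] and [nu] on the same side of the critical point. *)
Lemma ratio_injective (R : realType) (A2 B2 A4 B4 mu nu : R) :
  0 < A2 -> 0 < B2 -> 0 < A4 -> 0 < B4 -> 0 < mu -> 0 < nu ->
  (A2 * B4 * mu < A4 * B2 /\ A2 * B4 * nu < A4 * B2) \/
  (A4 * B2 < A2 * B4 * mu /\ A4 * B2 < A2 * B4 * nu) ->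
  (A4 + mu ^+ 2 * B4) * (A2 + nu * B2) ^+ 2 =
  (A4 + nu ^+ 2 * B4) * (A2 + mu * B2) ^+ 2 -> mu = nu.
Proof.
move=> A2p B2p A4p B4p mup nup side e.
have : (mu - nu) * (A2 * (A2 * B4 * mu - A4 * B2 + (A2 * B4 * nu - A4 * B2))
    + B2 * (nu * (A2 * B4 * mu - A4 * B2) + mu * (A2 * B4 * nu - A4 * B2))) = 0.
  by apply/eqP; move/eqP: e; rewrite -subr_eq0; congr (_ == 0); ring.
move/eqP; rewrite mulf_eq0 subr_eq0 => /orP[/eqP//|].
suff : A2 * (A2 * B4 * mu - A4 * B2 + (A2 * B4 * nu - A4 * B2))
    + B2 * (nu * (A2 * B4 * mu - A4 * B2) + mu * (A2 * B4 * nu - A4 * B2)) != 0.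
  by move=> /negPf ->.
have {e} key x y : 0 < x -> 0 < y -> 0 < A2 * (x + y) + B2 * (nu * x + mu * y).
  move=> x0 y0; apply: addr_gt0; apply: mulr_gt0 => //; first exact: addr_gt0.
  by apply: addr_gt0; apply: mulr_gt0.
case: side => -[h1 h2].
  rewrite lt_eqF// -oppr_gt0.
  have := key (A4 * B2 - A2 * B4 * mu) (A4 * B2 - A2 * B4 * nu).
  rewrite !subr_gt0 => /(_ h1 h2); congr (_ < _); ring.
rewrite gt_eqF//; apply: key; rewrite subr_gt0//.
Qed.

(** Over C a small imaginary [om] works. Over R a negative sum c + om needs |om| > c, hence 2 c < 1,
    which holds from n = 3 on and fails for n = 2, where c = 1/2. *)
Lemma etf_angle_room (R : realType) (k : scalar_kind) (n : nat) :
  (2 <= n)%N -> ~ (n = 2%N /\ k = RealScalars) ->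
  exists om : scalars R k, etf_angle R k n + modulus om < 1 /\
    ~ (0 <= real_scalar (etf_angle R k n) + om).
Proof.
move=> n2 hex; have c1 := etf_angle_lt1 R k n2; have c0 := etf_angle_gt0 R k n2.
have c2 := etf_angle_sqr R k n2.
case: k hex c1 c0 c2 => hex; move: (etf_angle _ _ _) => c c1 c0 c2.
  have n3 : 3 <= n%:R :> R.
    rewrite ler_nat ltn_neqAle n2 andbT; apply/eqP => n2'.
    by apply: hex; rewrite -n2'.
  clear hex.
  have c_half : c < 2^-1.
    rewrite ltNge; apply/negP => c_ge; move: c2; rewrite /is_real_scalar.
    by have : 2^-1 * 2^-1 <= c * c; [rewrite ler_pM|nra].
  pose del := (1 - 2 * c) / 2.
  exists (real_scalar (- (c + del))); rewrite modulus_real normrN ger0_norm.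
    split; first by rewrite /del; lra.
    by rewrite -rmorphD real_ge0 /del => h; lra.
  by rewrite /del; lra.
clear hex; pose del := (1 - c) / 2.
exists (Complex 0 del : scalars R ComplexScalars); split.
  rewrite /modulus normc_def /= expr0n add0r sqrtr_sqr ger0_norm; rewrite /del; lra.
rewrite /real_scalar /= lecE /= => /andP[/eqP h _]; move: h.
by rewrite add0r /del => h; lra.
Qed.

Lemma divfMK (F : fieldType) (a b c : F) : c != 0 -> a / (b * c) * c = a / b.
Proof. by move=> c0; rewrite invfM mulrA divfK. Qed.

(** * A further functional outside the frame *)

Section gap.
Variables (R : realType) (k : scalar_kind) (n : nat).
Hypothesis n_ge2 : (2 <= n)%N.
Local Notation K := (scalars R k).
Local Notation conj := (@scalar_conj R k).
Local Notation rs := (@real_scalar R k).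
Local Notation re := (@scalar_re R k).
Local Notation d := (max_ETF_size k n).
Local Notation c := (etf_angle R k n).
Local Notation D := (etf_sum R k n).
Variable w : 'I_d -> 'rV[K]_n.
Hypothesis w_etf : equiangular_tight_frame w.

Lemma etf_row_full : row_full (\matrix_(i, b) w i 0 b).
Proof.
rewrite /row_full -mxrank_tr -/(row_free _) -kermx_eq0.
apply/rowV0P => v /sub_kermxP vW.
have : map_mx conj v = 0.
  apply: (etf_spans n_ge2 w_etf) => j; rewrite -[RHS](rmorph0 conj).
  have /rowP/(_ j) := vW; rewrite !mxE => <-; rewrite rmorph_sum.
  by apply: eq_bigr => b _; rewrite !mxE rmorphM.
move/rowP => v0; apply/rowP => b; have := v0 b; rewrite !mxE => vb.
by rewrite -[v 0 b]conjK vb rmorph0.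
Qed.

Lemma orthogonal_vector (u : 'rV[K]_n) : exists2 y : 'rV[K]_n, y != 0 & inner_product y u = 0.
Proof.
have : kermx (adjmx u) != 0.
  rewrite -mxrank_eq0 mxrank_ker subn_eq0 -ltnNge.
  by apply: leq_ltn_trans (rank_leq_col _) _.
case/rowV0Pn => y /sub_kermxP yu y0; exists y => //.
have /matrixP/(_ 0 0) := yu; rewrite !mxE => <-.
by apply: eq_bigr => j _; rewrite !mxE.
Qed.

Lemma re_eq_modulus (z : K) : re z = modulus z -> 0 <= z.
Proof.
move=> zE; have z0 : 0 <= re z by rewrite zE modulus_ge0.
have := mul_conj z; rewrite -zE; move: z0.
rewrite /scalar_conj /real_scalar /scalar_re; case: k z {zE} => // -[a b] /= a0 [] e _.
have /eqP : b ^+ 2 = 0 by move: e; rewrite !expr2; lra.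
by rewrite sqrf_eq0 => /eqP ->; rewrite lecE /= eqxx.
Qed.

(* Near w_i0 the functional D <., w_i0> is the sum of the xi_j <., w_j>, but
   at w_i0 + y some xi_j <., w_j> leaves the positive half-line, so that the
   sum of the |<., w_j>| becomes larger than D. *)
Lemma gap_vector : ~ (n = 2%N /\ k = RealScalars) ->
  exists (g h : 'rV[K]_n) (xi : 'I_d -> K),
    [/\ forall j, modulus (xi j) <= 1,
        forall x, rs D * inner_product x g = \sum_j xi j * inner_product x (w j) &
        forall j, modulus (inner_product h (w j)) < modulus (inner_product h g)].
Proof.
move=> /(etf_angle_room R n_ge2)[om [om_lt om_neg]].
have D0 := etf_sum_gt0 R k n_ge2.
have DK : rs D != 0 by rewrite -(rmorph0 rs) (inj_eq (@real_inj R k)) gt_eqF.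
have [_ [_ _ angle]] := etf_frame_angle n_ge2 w_etf.
pose i0 : 'I_d := Ordinal (ltnW (etf_size_gt1 R k n_ge2)).
have [xi [xi1 xiw xiE]] := etf_self_expansion n_ge2 w_etf i0.
have [y y0 yw] := orthogonal_vector (w i0).
pose q j := inner_product y (w j).
pose js := [arg max_(j > i0) modulus (q j)]%O.
have q_le j : modulus (q j) <= modulus (q js).
  by rewrite /js; case: arg_maxP => // l _ /(_ j isT).
have q_js : q js != 0.
  apply: contraNneq y0 => q0; apply/eqP/(etf_spans n_ge2 w_etf) => j.
  apply/eqP; rewrite -modulus_eq0 eq_le modulus_ge0 andbT.
  by apply: (le_trans (q_le j)); rewrite q0 modulus0.
have js_i0 : js != i0 by apply: contraNneq q_js => ->; rewrite /q yw.
have xi_js : xi js != 0 by rewrite -modulus_eq0 xi1 oner_eq0.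
(* The coefficient makes [xi js] times <h, w_js> equal to c + om. By maximality of [js] every other
   product moves by at most |om| and stays in the unit disc; orthogonality of [y] keeps <h, w_i0> =
   1. *)
pose h := w i0 + (om / (xi js * q js)) *: y.
have hE j : inner_product h (w j) = inner_product (w i0) (w j) + om / (xi js * q js) * q j.
  by rewrite (scalar_atD _ _ (ip_linear (w j))) ipZl.
have h_i0 : inner_product h (w i0) = 1.
  by rewrite hE (etf_unit w_etf) /q yw mulr0 addr0.
have q_ratio j : modulus (om / (xi js * q js) * q j) <= modulus om.
  have m0 : 0 < modulus (q js) by rewrite lt_def modulus_eq0 q_js modulus_ge0.
  rewrite -(ler_pM2r m0) -!modulusM -mulrA [q j * _]mulrC mulrA.
  rewrite divfMK//.
  have xiV : modulus (xi js)^-1 = 1.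
    apply: (mulfI (lt0r_neq0 ltr01)); rewrite mulr1 -{1}(xi1 js) -modulusM mulfV//.
    by rewrite modulus1.
  by rewrite !modulusM xiV mulr1 ler_wpM2l ?modulus_ge0.
have h_le j : modulus (inner_product h (w j)) <= 1.
  have [->|ji] := eqVneq j i0; first by rewrite h_i0 modulus1.
  rewrite hE; apply: (le_trans (modulusD _ _)); rewrite angle 1?eq_sym//.
  by apply: ltW; apply: le_lt_trans om_lt; rewrite lerD2l.
have h_js : xi js * inner_product h (w js) = rs c + om.
  rewrite hE mulrDr xiw angle 1?eq_sym//; congr (_ + _).
  by rewrite -/(q js) divfMK// mulrC divfK.
have sum_gt : D < \sum_j modulus (inner_product h (w j)).
  have sumE : \sum_j re (xi j * inner_product h (w j)) = D.
    by rewrite -raddf_sum -xiE h_i0 mulr1 /= re_real.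
  rewrite -[ltLHS]sumE (bigD1 js)//= [ltRHS](bigD1 js)//= ltr_leD//; last first.
    apply: ler_sum => j _; apply: (le_trans (re_le_modulus _)).
    by rewrite modulusM xi1 mul1r.
  rewrite lt_neqAle; apply/andP; split; last first.
    by apply: (le_trans (re_le_modulus _)); rewrite modulusM xi1 mul1r.
  apply/eqP => eq_js; apply: om_neg; rewrite -h_js; apply: re_eq_modulus.
  by rewrite eq_js modulusM xi1 mul1r.
have [s sP] := choice (fun j => modulus_phase (inner_product h (w j))).
have s1 j : modulus (s j) = 1 by have [] := sP j.
have sE j : s j * inner_product h (w j) = rs (modulus (inner_product h (w j))) by have [] := sP j.
(* With the phases of the <h, w_j> as coefficients, D |<h, g>| is the sum of the |<h, w_j>|, hence
   exceeds D, while each |<h, w_j>| is at most 1. *)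
pose g := \sum_j conj (s j / rs D) *: w j.
have gE x : rs D * inner_product x g = \sum_j s j * inner_product x (w j).
  rewrite ip_sumr mulr_sumr; apply: eq_bigr => j _.
  by rewrite conjK mulrA [rs D * _]mulrC divfK.
exists g, h, s; split => // [j|j]; first by rewrite s1.
apply: (le_lt_trans (h_le j)).
rewrite -(ltr_pM2l D0) mulr1 -[X in _ < X * _](gtr0_norm D0) -(@modulus_real R k) -modulusM gE.
rewrite (eq_bigr (fun j => rs (modulus (inner_product h (w j))))) => [|l _]; last by rewrite sE.
rewrite -rmorph_sum modulus_real; apply: (lt_le_trans sum_gt); exact: ler_norm.
Qed.
End gap.

Section frame_space_norming.
Variables (R : realType) (k : scalar_kind) (n : nat).
Hypothesis n_ge2 : (2 <= n)%N.
Local Notation K := (scalars R k).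
Local Notation conj := (@scalar_conj R k).
Local Notation d := (max_ETF_size k n).
Variable w : 'I_d -> 'rV[K]_n.
Hypothesis w_etf : equiangular_tight_frame w.

Section one_space.
Variables (N : nat) (th : 'I_N -> 'rV[K]_n).
Hypothesis th_w : forall j, exists i, th i = w j.
Local Notation X := (frame_space n_ge2 w_etf th_w).

Lemma frame_space_norming : norming_family (fun i (x : X) => inner_product x (th i)).
Proof.
split=> [i|i x|x x0]; [exact: ip_linear|exact: frame_space_norm_ge|].
have Sx0 : coefficients th x != 0.
  apply: contraNneq x0 => Sx0; apply/eqP/(coefficients_inj n_ge2 w_etf th_w).
  by rewrite Sx0 linear0.
by have [i iE] := row_norm_attained Sx0; exists i; rewrite mxE in iE.
Qed.

Lemma frame_space_peak (x : X) i : 0 < modulus (inner_product x (th i)) ->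
  (forall j, j != i -> modulus (inner_product x (th j)) < modulus (inner_product x (th i))) ->
  [/\ x != 0, modulus (inner_product x (th i)) = real_norm x &
      forall j, j != i -> modulus (inner_product x (th j)) < real_norm x].
Proof.
move=> xi0 xj; have [phis _ phin] := frame_space_norming.
have x0 : x != 0.
  by apply: contraTneq xi0 => ->; rewrite (scalar_at0 (phis i)) modulus0 ltxx.
have iE : modulus (inner_product x (th i)) = real_norm x.
  have [j jE] := phin x x0; have [<-//|ji] := eqVneq j i.
  have := xj j ji; rewrite jE => /lt_le_trans/(_ (frame_space_norm_ge x i)).
  by rewrite ltxx.
by split => // j /xj; rewrite iE.
Qed.
End one_space.

(** By [isometry_permutes], the adjoint of the isometry maps the vectors [th'] to the vectors [th],
    up to order and phases. *)
Lemma isometric_minor_ratio N (th th' : 'I_N -> 'rV[K]_n)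
    (th_w : forall j, exists i, th i = w j) (th_w' : forall j, exists i, th' i = w j) :
  peaked (fun i (x : frame_space n_ge2 w_etf th_w) => inner_product x (th i)) ->
  isometric (frame_space n_ge2 w_etf th_w) (frame_space n_ge2 w_etf th_w') ->
  minor_sum th 4 * minor_sum th' 2 ^+ 2 = minor_sum th' 4 * minor_sum th 2 ^+ 2.
Proof.
move=> pk [T [_ T_iso]].
have [pi [a [pi_inj a1 aE]]] := isometry_permutes T_iso (frame_space_norming th_w) pk
  (frame_space_norming th_w').
pose Tm : 'M[K]_n := \matrix_(p, q) (T (delta_mx 0 p) : 'rV[K]_n) 0 q.
apply: (@minor_ratio_invariant R k n N th th' pi (fun i => conj (a i)) (adjmx Tm)) => //.
  by move=> i; rewrite modulus_conj.
move=> i; apply/rowP => b; rewrite !mxE.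
rewrite -[th i 0 b]conjK -rmorphM -(ip_delta (th i)) ip_conj -aE.
rewrite rmorph_sum; apply: eq_bigr => q _ /=.
by rewrite !mxE rmorphM /= conjK mulrC.
Qed.
End frame_space_norming.

(** * The one-parameter family of maximal spaces *)

Section continuum.
Variables (R : realType) (k : scalar_kind) (n : nat).
Hypothesis n_ge2 : (2 <= n)%N.
Local Notation K := (scalars R k).
Local Notation conj := (@scalar_conj R k).
Local Notation rs := (@real_scalar R k).
Local Notation d := (max_ETF_size k n).
Local Notation D := (etf_sum R k n).
Variable w : 'I_d -> 'rV[K]_n.
Hypothesis w_etf : equiangular_tight_frame w.

Lemma ipZr (a : K) (x y : 'rV[K]_n) : inner_product x (a *: y) = conj a * inner_product x y.
Proof. by rewrite -ip_conj ipZl rmorphM /= ip_conj. Qed.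

Variables (g h : 'rV[K]_n) (xi : 'I_d -> K).
Hypothesis xi1 : forall j, modulus (xi j) <= 1.
Hypothesis gE : forall x, rs D * inner_product x g = \sum_j xi j * inner_product x (w j).

Lemma adjoin_w l j : exists i, adjoin w g l i = w j.
Proof. by exists (lift ord0 j); rewrite adjoinS. Qed.

Definition adjoin_space l := frame_space n_ge2 w_etf (adjoin_w l).

Lemma adjoin_space_maximal l : 0 <= l <= 1 -> maximal_space n (adjoin_space l).
Proof.
move=> /andP[l0 l1]; apply: frame_space_maximal => i.
have [j ->|->] := unliftP ord0 i.
  have [z [z1 _ zE]] := etf_self_expansion n_ge2 w_etf j.
  by exists z => [p|x]; rewrite ?z1// adjoinS zE.
exists (fun j => rs l * xi j) => [j|x].
  by rewrite modulusM modulus_real ger0_norm// mulr_ile1// modulus_ge0.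
rewrite adjoin0 ipZr conj_real mulrCA gE mulr_sumr.
by apply: eq_bigr => j _; rewrite mulrA.
Qed.

Hypothesis gap : forall j, modulus (inner_product h (w j)) < modulus (inner_product h g).

(** Each w_j is its own peak: the other frame vectors have products of modulus c < 1 with it, and D
    |<w_j, g>| <= sum_q |<w_j, w_q>| = D gives l |<w_j, g>| < 1. The functional of l g peaks at
    [h]. *)
Lemma adjoin_space_peaked l : 0 <= l < 1 ->
  (forall j, modulus (inner_product h (w j)) < l * modulus (inner_product h g)) ->
  peaked (fun i (x : adjoin_space l) => inner_product x (adjoin w g l i)).
Proof.
move=> /andP[l0 l1] l_gap i.
have [_ [_ _ angle]] := etf_frame_angle n_ge2 w_etf.
have c1 := etf_angle_lt1 R k n_ge2.
have [j ->|->] := unliftP ord0 i.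
  exists (w j); apply: frame_space_peak; rewrite adjoinS (etf_unit w_etf) modulus1//.
  move=> p pj; have [q qE|->] := unliftP ord0 p.
    by rewrite qE adjoinS angle//; apply: contraNneq pj => jq; rewrite qE jq.
  rewrite adjoin0 ipZr conj_real modulusM modulus_real ger0_norm//.
  suff : modulus (inner_product (w j) g) <= 1.
    by move=> /(ler_wpM2l l0)/le_lt_trans; apply; rewrite mulr1.
  have D0 := etf_sum_gt0 R k n_ge2.
  rewrite -(ler_pM2l D0) mulr1 -{1}(gtr0_norm D0) -(@modulus_real R k) -modulusM gE.
  apply: (le_trans (modulus_sum _ _)).
  apply: (@le_trans _ _ (\sum_q modulus (inner_product (w j) (w q)))).
    by apply: ler_sum => q _; rewrite modulusM ler_piMl ?modulus_ge0.
  rewrite (bigD1 j)//= (etf_unit w_etf) modulus1 (eq_bigr (fun=> etf_angle R k n)).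
    rewrite sumr_const cardC1 card_ord /etf_sum lerD2l -[leLHS]mulr_natl -subn1 natrB//.
    exact: (ltnW (etf_size_gt1 R k n_ge2)).
  by move=> q qj; rewrite angle// eq_sym.
have j0 : 'I_d by exact: (Ordinal (ltnW (etf_size_gt1 R k n_ge2))).
have hg : modulus (inner_product h (adjoin w g l ord0)) = l * modulus (inner_product h g).
  by rewrite adjoin0 ipZr conj_real modulusM modulus_real ger0_norm.
exists h; apply: frame_space_peak; rewrite hg.
  by apply: le_lt_trans (l_gap j0); exact: modulus_ge0.
move=> p; have [q ->|->] := unliftP ord0 p; last by rewrite eqxx.
by rewrite adjoinS.
Qed.

Lemma adjoin_space_ratio l m : 0 <= l < 1 -> 0 <= m < 1 ->
  (forall j, modulus (inner_product h (w j)) < l * modulus (inner_product h g)) ->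
  isometric (adjoin_space l) (adjoin_space m) ->
  (fixed_minors w g 4 + (l ^+ 2) ^+ 2 * scaled_minors w g 4) *
    (fixed_minors w g 2 + m ^+ 2 * scaled_minors w g 2) ^+ 2 =
  (fixed_minors w g 4 + (m ^+ 2) ^+ 2 * scaled_minors w g 4) *
    (fixed_minors w g 2 + l ^+ 2 * scaled_minors w g 2) ^+ 2.
Proof.
move=> l01 m01 l_gap lm.
have := isometric_minor_ratio (adjoin_space_peaked l01 l_gap) lm.
have /andP[l0 _] := l01; have /andP[m0 _] := m01.
by rewrite !minor_sum_adjoin// -!exprM.
Qed.

Theorem continuum_of_maximal_spaces : exists X : R -> normedModType K,
  (forall s, maximal_space n (X s)) /\ (forall s t, s <> t -> ~ isometric (X s) (X t)).
Proof.
have j0 : 'I_d by exact: (Ordinal (ltnW (etf_size_gt1 R k n_ge2))).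
have hg0 : 0 < modulus (inner_product h g).
  by apply: le_lt_trans (gap j0); exact: modulus_ge0.
have g0 : g != 0.
  apply: contraTneq hg0 => ->.
  by rewrite -ip_conj (scalar_at0 (ip_linear h)) rmorph0 modulus0 ltxx.
pose js := [arg max_(j > j0) modulus (inner_product h (w j))]%O.
have js_max j : modulus (inner_product h (w j)) <= modulus (inner_product h (w js)).
  by rewrite /js; case: arg_maxP => // i _ /(_ j isT).
(* For l above [l0] the functional of l g is still exposed by [h]. *)
pose l0 := modulus (inner_product h (w js)) / modulus (inner_product h g).
have l0_ge0 : 0 <= l0 by rewrite divr_ge0 ?modulus_ge0.
have l0_lt1 : l0 < 1 by rewrite ltr_pdivrMr// mul1r.
have l0_gap l j : l0 < l -> modulus (inner_product h (w j)) < l * modulus (inner_product h g).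
  by rewrite ltr_pdivrMr//; exact: le_lt_trans.
have w_full := etf_row_full n_ge2 w_etf.
have A2p := fixed_minors_gt0 g w_full 2; have A4p := fixed_minors_gt0 g w_full 4.
have B2p := scaled_minors_gt0 w_full g0 2; have B4p := scaled_minors_gt0 w_full g0 4.
have ratio l m := @adjoin_space_ratio l m.
move: ratio A2p A4p B2p B4p.
move: (fixed_minors w g 2) (fixed_minors w g 4) (scaled_minors w g 2) (scaled_minors w g 4).
move=> A2 A4 B2 B4 ratio A2p A4p B2p B4p.
pose mu0 := A4 * B2 / (A2 * B4).
have A2B4 : 0 < A2 * B4 by exact: mulr_gt0.
(* On the interval from [l1] to 1 the square l^2 avoids [mu0], the critical point of the invariant
   as a function of l^2. *)
have [l1 [l1_ge l1_lt side]] : exists l1, [/\ l0 <= l1, l1 < 1 &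
    (forall l, l1 < l < 1 -> l ^+ 2 < mu0) \/ (forall l, l1 < l < 1 -> mu0 < l ^+ 2)].
  have mu0_ge0 : 0 <= mu0 by rewrite divr_ge0 ?mulr_ge0 ?ltW.
  have [mu0_lt1|mu0_ge1] := ltP mu0 1; last first.
    exists l0; split => //; left => l /andP[ll l1]; apply: lt_le_trans mu0_ge1.
    by rewrite expr_lt1//; exact: ltW (le_lt_trans l0_ge0 ll).
  exists (Num.max l0 (Num.sqrt mu0)); split; first by rewrite le_max lexx.
    by rewrite gt_max l0_lt1 -[ltRHS]sqrtr1 ltr_sqrt.
  right => l /andP[]; rewrite gt_max => /andP[ll ml] _.
  by rewrite -[ltLHS]sqr_sqrtr// ltr_sqr// nnegrE ?sqrtr_ge0// (le_trans l0_ge0 (ltW ll)).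
(* A logistic curve, injecting the real line into the interval from [l1] to 1. *)
pose lam (s : R) := l1 + (1 - l1) / (1 + expR s).
have e1 (s : R) : 1 < 1 + expR s by rewrite ltrDl expR_gt0.
have e0 (s : R) : 0 < 1 + expR s by exact: lt_trans ltr01 (e1 s).
have l1' : 0 < 1 - l1 by rewrite subr_gt0.
have lam_gt s : l1 < lam s by rewrite ltrDl divr_gt0.
have lam_lt s : lam s < 1.
  by rewrite -ltrBrDl ltr_pdivrMr// ltr_pMr.
have lam_ge0 s : 0 <= lam s.
  by apply: (le_trans l0_ge0); apply: (le_trans l1_ge); exact: ltW.
have lam_inj : injective lam.
  move=> s t /addrI/(mulfI (lt0r_neq0 l1'))/invr_inj/addrI; exact: expR_inj.
exists (fun s => adjoin_space (lam s)); split.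
  by move=> s; apply: adjoin_space_maximal; rewrite lam_ge0 ltW.
move=> s t st iso; apply: st; apply: lam_inj.
apply/eqP; rewrite -(@eqrXn2 _ 2)//; apply/eqP.
have lam01 u : 0 <= lam u < 1 by rewrite lam_ge0 lam_lt.
have lam_in u : l1 < lam u < 1 by rewrite lam_gt lam_lt.
have lam2 u : 0 < lam u ^+ 2.
  by rewrite exprn_gt0// (le_lt_trans l0_ge0)// (le_lt_trans l1_ge).
apply: (ratio_injective A2p B2p A4p B4p) => //; last first.
  apply: ratio iso => // j; apply: l0_gap; exact: le_lt_trans l1_ge (lam_gt s).
case: side => side; [left|right].
  by split; rewrite mulrC -ltr_pdivlMr//; exact: side.
by split; rewrite [X in _ < X]mulrC -ltr_pdivrMr//; exact: side.
Qed.
End continuum.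

(** * Extremal planes are hexagonal *)

Section near_extremal.
Variables (R : realType) (k : scalar_kind) (n : nat).
Hypothesis n_ge2 : (2 <= n)%N.
Local Notation K := (scalars R k).
Local Notation rs := (@real_scalar R k).
Variables (X : normedModType K) (f : {linear X -> 'rV[K]_n}) (fi : 'rV[K]_n -> X).
Hypotheses (fK : cancel f fi) (fiK : cancel fi f).
Variable C : R.
Hypotheses (C_gt0 : 0 < C) (X_large : (C%:E < projection_constant X)%E).

(** By [projection_of_trace_bound], a relative projection constant above C violates the trace bound
    with constant C for some T. Dividing by the total weight and rotating by a phase gives total
    weight 1 and a real trace. *)
Lemma near_extremal_data :
  exists N (phi : 'I_N -> X -> K) (m : 'I_N -> R) (M : 'M[K]_N) (T : 'M[K]_n) (t : R),
    let F := functional_matrix fi phi in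
    [/\ forall j, dual_ball (phi j), forall j, 0 < m j,
        forall i j, modulus (M i j) <= m j, M *m F = F *m T^T &
        [/\ forall y : 'cV[K]_n, F *m y = 0 -> y = 0,
            \sum_j m j = 1,
            forall x, real_norm (fi (f x *m T)) <= \sum_j m j * modulus (phi j x),
            \tr T = rs t & C < t]].
Proof.
have [Z [S [S_iso large]]] : exists (Z : normedModType K) (S : {linear X -> Z}),
    isometric_embedding S /\ (C%:E < relative_projection_constant (range S))%E.
  apply: contrapT => none; move: X_large; apply/negP; rewrite -leNgt.
  apply: ub_ereal_sup => _ [Z [S [S_iso ->]]]; rewrite leNgt; apply/negP => lt.
  by apply: none; exists Z, S.
have [T [r [Tr lt]]] : exists T r, nuclear_cost fi (embedded_operator fi S T) r /\
    C * r < modulus (\tr T).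
  apply: contrapT => none; move: large; apply/negP; rewrite -leNgt.
  apply: (projection_of_trace_bound fK fiK S_iso C_gt0) => T r Tr.
  by rewrite leNgt; apply/negP => lt; apply: none; exists T, r.
(* Half of the excess over C r, divided by C: the weights may grow by this much and the bound is
   still violated. *)
have eps0 : 0 < (modulus (\tr T) - C * r) / (2 * C).
  by rewrite divr_gt0 ?subr_gt0// mulr_gt0.
have [N [phi [m [M [phib m0 Mm MF [Finj mr Tx]]]]]] := nuclear_trace_data fK fiK S_iso eps0 Tr.
have r0 := nuclear_cost_ge0 Tr.
have tr0 : 0 < modulus (\tr T) by apply: le_lt_trans lt; rewrite mulr_ge0// ltW.
pose s := \sum_j m j.
have s0 : 0 < s.
  have Cn := etf_constant_gt0 R k n_ge2.
  have := trace_bound m0 Mm MF Finj n_ge2; rewrite mxtrace_tr => /(lt_le_trans tr0).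
  by rewrite pmulr_rgt0.
have Cs : C * s < modulus (\tr T).
  apply: (@le_lt_trans _ _ (C * (r + (modulus (\tr T) - C * r) / (2 * C)))).
    by rewrite ler_pM2l.
  have -> : C * (r + (modulus (\tr T) - C * r) / (2 * C)) = (modulus (\tr T) + C * r) / 2.
    by move: (modulus _) C_gt0 => t /gt_eqF C0; field; rewrite C0.
  by rewrite ltr_pdivrMr//; lra.
have [u [u1 uE]] := modulus_phase (\tr T).
pose v := rs s^-1 * u.
have vm : modulus v = s^-1.
  by rewrite modulusM modulus_real u1 mulr1 ger0_norm// invr_ge0 ltW.
exists N, phi, (fun j => s^-1 * m j), (v *: M), (v *: T), (s^-1 * modulus (\tr T)) => F.
split => //.
- by move=> j; rewrite mulr_gt0 ?invr_gt0.
- by move=> i j; rewrite mxE modulusM vm ler_wpM2l// invr_ge0 ltW.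
- by rewrite linearZ /= -scalemxAl MF scalemxAr.
split => //.
- by rewrite -mulr_sumr mulVf// gt_eqF.
- move=> x; rewrite -scalemxAr linear_atZ; last exact: (coord_inv_linear fK fiK).
  rewrite real_normZ vm; under eq_bigr do rewrite -mulrA.
  by rewrite -mulr_sumr ler_wpM2l// invr_ge0 ltW.
- by rewrite linearZ /= /v -mulrA uE rmorphM.
- by rewrite mulrC ltr_pdivlMr.
Qed.
End near_extremal.

Section near_hexagonal_norm.
Variable R : realType.
Local Notation K := (scalars R RealScalars).
Variables (X : normedModType K) (f : {linear X -> 'rV[K]_2}) (fi : 'rV[K]_2 -> X).
Hypotheses (fK : cancel f fi) (fiK : cancel fi f).
Hypothesis X_extremal : projection_constant X = (4 / 3)%:E.

(** Within a class, [phi j] is a signed copy of one functional G_k up to w_j. Averaging |phi_j x| <=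
    |x| over a class bounds G_k, and substituting the G_k into the nuclear estimate leaves three
    terms of weight about 1/3. *)
Lemma near_hexagonal_norm (d : R) : 0 < d <= 1 ->
  exists (G0 G2 : X -> R) (T : 'M[R]_2),
    [/\ scalar (G0 : X -> K), scalar (G2 : X -> K),
        forall x, [/\ `|G0 x| <= (1 + d) * real_norm x, `|G2 x| <= (1 + d) * real_norm x &
                      `|G0 x + G2 x| <= (1 + d) * real_norm x],
        forall x, real_norm (fi (f x *m T)) <=
          3^-1 * (`|G0 x| + `|G2 x| + `|G0 x + G2 x|) + d * real_norm x &
        4 / 3 - d <= \tr T].
Proof.
move=> /andP[d0 d1].
(* The factor 2000 exceeds 3 * 600 + 50, the errors collected below from the three masses and from
   [w]. *)
pose z := d / 2000.
have z0 : 0 < z by rewrite /z; lra.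
have dz : d = 2000 * z by rewrite /z; lra.
have z1 : z <= 1 by rewrite /z; lra.
move: z dz z0 z1 => z dz z0 z1.
have z4 : 0 < z ^+ 4 <= z.
  rewrite exprn_gt0//= exprS ler_piMr ?(ltW z0)//; apply: exprn_ile1 => //; exact: ltW.
have C0 : 0 < 4 / 3 - z ^+ 4 by case/andP: z4 => _ ?; lra.
have large : ((4 / 3 - z ^+ 4)%:E < projection_constant X)%E.
  by rewrite X_extremal lte_fin; case/andP: z4 => ? _; lra.
have [N [phi [m [M [T [t /= [phib m0 Mm MF [Finj m1 Tx trT tC]]]]]]]] :=
  near_extremal_data (isT : (2 <= 2)%N) fK fiK C0 large.
have m_ge0 j : 0 <= m j by rewrite ltW.
have [P Pu /= [iso trz]] := @trace_orthonormalized R RealScalars 2 N M _ T^T m m0 MF Finj.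
set F := functional_matrix fi phi in MF Finj iso trz.
pose a j : R := (F *m P) j 0; pose b j : R := (F *m P) j 1.
have aa : \sum_j m j * a j ^+ 2 = 1.
  by rewrite -[RHS](iso 0 0); apply: eq_bigr => j _; rewrite expr2 mulrA.
have bb : \sum_j m j * b j ^+ 2 = 1.
  by rewrite -[RHS](iso 1 1); apply: eq_bigr => j _; rewrite expr2 mulrA.
have ab : \sum_j m j * (a j * b j) = 0.
  by rewrite -[RHS](iso 0 1); apply: eq_bigr => j _; rewrite mulrA.
have tr_le : 4 / 3 - z ^+ 4 <= \sum_i \sum_j m i * m j * `|cross_dot a b i j|.
  apply: (le_trans (ltW tC)).
  have -> : t = \sum_i \sum_j m i * M i j * cross_dot a b i j.
    have <- : \tr T = t by exact: trT.
    rewrite -mxtrace_tr trz; apply: eq_bigr => i _; apply: eq_bigr => j _.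
    rewrite /dotp big_ord_recl big_ord1 /cross_dot /a /b.
    rewrite [(F *m P) j _ * _]mulrC [(F *m P) j (lift _ _) * _]mulrC.
    by rewrite (_ : lift ord0 ord0 = 1) //; exact: val_inj.
  apply: ler_sum => i _; apply: ler_sum => j _.
  have Mij : `|M i j| <= m j by exact: Mm.
  have [h1 h2] := (normr_ge0 (cross_dot a b i j), m_ge0 i).
  rewrite -!mulrA ler_wpM2l//; apply: (le_trans (ler_norm _)).
  by rewrite normrM ler_wpM2r.
have z_small : z <= 100^-1 by lra.
have [e1 [e2 [cl [s [w [[e1E e2E] s1 close mw Mk]]]]]] :=
  hexagon_approximation m_ge0 m1 aa bb ab z0 z_small tr_le.
pose y x : 'cV[R]_2 := invmx P *m (f x)^T.
pose G k x : R := e1 k * y x 0 0 + e2 k * y x 1 0.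
have phiE j x : phi j x = a j * y x 0 0 + b j * y x 1 0 :> R.
  have [ps _] := phib j.
  transitivity ((F *m P *m y x) j 0).
    rewrite /y mulmxA mulmxK// mxE (scalar_coord fK fiK)//.
    by apply: eq_bigr => i _; rewrite !mxE mulrC.
  rewrite mxE big_ord_recl big_ord1 (_ : lift ord0 ord0 = 1)//; exact: val_inj.
have nx (x : X) : 0 <= real_norm x := real_norm_ge0 x.
have phi_le j x : `|phi j x| <= real_norm x by have [_ h] := phib j; exact: h.
(* The Euclidean norm in orthonormalized coordinates is the quadratic mean of the |phi_j x|, each of
   which is at most |x|. *)
have y_le x : Num.sqrt (y x 0 0 ^+ 2 + y x 1 0 ^+ 2) <= real_norm x.
  rewrite -(@ler_sqr R) ?nnegrE ?sqrtr_ge0//.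
  rewrite sqr_sqrtr ?addr_ge0 ?sqr_ge0//.
  have -> : y x 0 0 ^+ 2 + y x 1 0 ^+ 2 = \sum_j m j * (phi j x : R) ^+ 2.
    rewrite (eq_bigr (fun j => y x 0 0 ^+ 2 * (m j * a j ^+ 2) +
      2 * y x 0 0 * y x 1 0 * (m j * (a j * b j)) + y x 1 0 ^+ 2 * (m j * b j ^+ 2))).
      by rewrite !big_split /= -!mulr_sumr aa bb ab; ring.
    by move=> j _; rewrite phiE; ring.
  rewrite -[leRHS]mul1r -m1 mulr_suml; apply: ler_sum => j _.
  rewrite ler_wpM2l// -[leLHS]real_normK ?num_real// lerXn2r ?nnegrE//.
have s_norm j (u : R) : `|s j * u| = `|u|.
  by case: (s1 j) => ->; rewrite ?mul1r ?mulN1r ?normrN.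
have phiG j x : `|phi j x - s j * G (cl j) x| <= w j * real_norm x.
  have [w0 h] := close j; rewrite phiE; apply: (le_trans (h _ _)).
  by rewrite ler_wpM2l.
have w0 j : 0 <= w j by have [] := close j.
have lower j x : `|G (cl j) x| <= (1 + w j) * real_norm x.
  rewrite -(s_norm j) mulrDl mul1r -[s j * _](subrK (phi j x : R)).
  rewrite [leRHS]addrC; apply: (le_trans (ler_normD _ _)).
  by rewrite lerD// distrC.
have upper j x : `|phi j x| <= `|G (cl j) x| + w j * real_norm x.
  rewrite -(s_norm j) -[phi j x : R](subrK (s j * G (cl j) x)) addrC.
  by apply: (le_trans (ler_normD _ _)); rewrite lerD.
pose W (x : X) := 50 * z * real_norm x.
have wW (I : pred 'I_N) x : \sum_(j | I j) m j * (w j * real_norm x) <= W x.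
  rewrite /W; under eq_bigr do rewrite mulrA.
  rewrite -mulr_suml ler_wpM2r//; apply: le_trans mw.
  by rewrite [leRHS](bigID I)/= lerDl sumr_ge0// => j _; rewrite mulr_ge0.
pose Mu k := \sum_(j | cl j == k) m j.
have G_le k x : `|G k x| <= (1 + d) * real_norm x.
  have Mk1 : 6^-1 <= Mu k by have := Mk k; rewrite -/(Mu k) ler_norml => /andP[? _]; lra.
  have : Mu k * `|G k x| <= Mu k * real_norm x + W x.
    apply: (@le_trans _ _ (\sum_(j | cl j == k) (m j * real_norm x + m j * (w j * real_norm x)))).
      rewrite mulr_suml; apply: ler_sum => j /eqP <-.
      rewrite -mulrDr ler_wpM2l//; apply: (le_trans (lower j x)).
      by rewrite mulrDl mul1r.
    by rewrite big_split /= -mulr_suml lerD2l; exact: wW.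
  have Wx : W x <= 6^-1 * (d * real_norm x).
    by have := mulr_ge0 (ltW z0) (nx x); rewrite /W dz; lra.
  have dx : 0 <= d * real_norm x by rewrite mulr_ge0// ltW.
  have : 6^-1 * (d * real_norm x) <= Mu k * (d * real_norm x) by rewrite ler_wpM2r.
  move=> h1 h2; have Mu0 : 0 < Mu k by lra.
  rewrite -(ler_pM2l Mu0) mulrDl mul1r mulrDr.
  by lra.
have G1 x : G 1 x = G 0 x + G 2%:R x by rewrite /G e1E e2E; ring.
have G_scalar k : scalar (G k : X -> K).
  move=> c x x'; have yE : y (c *: x + x') = c *: y x + y x'.
    by rewrite /y (linearP f) linearP /= mulmxDr -scalemxAr.
  have mxE' (u v : 'cV[R]_2) i : ((c : R) *: u + v) i 0 = (c : R) * u i 0 + v i 0 by rewrite !mxE.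
  transitivity (e1 k * ((c : R) * y x 0 0 + y x' 0 0) + e2 k * ((c : R) * y x 1 0 + y x' 1 0)).
    by rewrite /G yE !mxE'.
  by rewrite /G; ring.
exists (G 0), (G 2%:R), T; split => //.
- by move=> x; rewrite -G1.
- move=> x; have Txx : @real_norm R RealScalars X (fi (f x *m T)) <= \sum_j m j * `|phi j x| := Tx x.
  apply: (le_trans Txx).
  have h1 : \sum_j m j * `|phi j x| <= \sum_k Mu k * `|G k x| + W x.
    have h0 : \sum_j m j * `|phi j x| <= \sum_j (m j * `|G (cl j) x| + m j * (w j * @real_norm R RealScalars X x)).
      by apply: ler_sum => j _; rewrite -mulrDr ler_wpM2l.
    apply: (le_trans h0).
    rewrite big_split /= lerD ?(wW predT)// (partition_big cl predT)//=.
    by apply: ler_sum => k' _; rewrite mulr_suml; apply: ler_sum => j /eqP ->.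
  apply: (le_trans h1).
  have h2 k : Mu k * `|G k x| <= 3^-1 * `|G k x| + 600 * z * @real_norm R RealScalars X x.
    have := Mk k; rewrite -/(Mu k) ler_norml => /andP[_ h].
    have h3 : (Mu k - 3^-1) * `|G k x| <= 300 * z * `|G k x| by rewrite ler_wpM2r.
    have h4 : 300 * z * `|G k x| <= 300 * z * (2 * @real_norm R RealScalars X x).
      rewrite ler_wpM2l ?mulr_ge0 ?(ltW z0)//; apply: (le_trans (G_le k x)).
      by rewrite ler_wpM2r//; lra.
    by lra.
  rewrite !big_ord_recl big_ord0 addr0.
  have -> : lift ord0 ord0 = 1 :> 'I_3 by exact: val_inj.
  have -> : lift ord0 (lift ord0 ord0) = 2%:R :> 'I_3 by exact: val_inj.
  have := h2 ord0; have := h2 1; have := h2 2%:R; rewrite -G1 /W dz.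
  have := mulr_ge0 (ltW z0) (nx x); rewrite -[`|x|]/(@real_norm R RealScalars X x) -[G 0]/(G ord0).
  by lra.
- by rewrite trT; case/andP: z4 => _ z4; apply: le_trans (ltW tC); rewrite dz; lra.
Qed.
End near_hexagonal_norm.

Lemma le_of_small_error (R : realType) (x y c : R) :
  (forall e, 0 < e <= 1 -> x <= y + e * c) -> x <= y.
Proof.
move=> h; rewrite leNgt; apply/negP => yx.
pose e := Num.min 1 ((x - y) / (2 * (`|c| + 1))).
have c1 : 0 < 2 * (`|c| + 1) by rewrite mulr_gt0// ltr_wpDl.
have e0 : 0 < e by rewrite lt_min ltr01 divr_gt0// subr_gt0.
have := h e; rewrite e0 ge_min lexx /= => /(_ isT).
have : e * c <= e * (`|c| + 1).
  by rewrite ler_pM2l// (le_trans (ler_norm c))// lerDl.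
have : e * (`|c| + 1) <= (x - y) / (2 * (`|c| + 1)) * (`|c| + 1).
  by rewrite ler_wpM2r ?addr_ge0// ge_min lexx orbT.
have -> : (x - y) / (2 * (`|c| + 1)) * (`|c| + 1) = (x - y) / 2.
  by field; rewrite gt_eqF// ltr_wpDl.
lra.
Qed.

(** The parameters for d = 1 / (i + 1) lie in a compact box. As [P] is arbitrary, their cluster
    point is described through nearby solutions with small d. *)
Lemma bounded_cluster (R : realType) (I : finType) (P : R -> (I -> R) -> Prop)
    (B : I -> R) :
  (forall d : R, 0 < d <= 1 -> exists p, P d p /\ forall k, `|p k| <= B k) ->
  exists l : I -> R, forall e : R, 0 < e ->
    exists d p, [/\ 0 < d <= e, P d p & forall k, `|p k - l k| <= e].
Proof.
move=> PB.
have seq_d i : 0 < (i.+1%:R : R)^-1 <= 1 by rewrite invr_gt0 ltr0n invf_le1 ?ltr0n// ler1n.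
have [p pP] := choice (fun i => PB _ (seq_d i)).
pose u i : 'rV[R]_#|I| := \row_k p i (enum_val k).
pose box := [set v : 'rV[R]_#|I| | forall k, `[- B (enum_val k), B (enum_val k)] (v ord0 k)].
have box_compact : compact box.
  apply: (@rV_compact R _ (fun k => `[- B (enum_val k), B (enum_val k)])) => k.
  exact: segment_compact.
have ubox : (u @ \oo) box.
  exists 0%N => // i _ k; rewrite /= mxE in_itv /= -ler_norml.
  by have [_] := pP i.
have [l [_ ul]] := box_compact (u @ \oo) (fmap_proper_filter u _) ubox.
exists (fun k => l 0 (enum_rank k)) => e e0.
have small : (u @ \oo) (u @` [set i | (i.+1%:R : R)^-1 <= e]).
  have [N _ NP] := near_infty_natSinv_lt (PosNum e0).
  by exists N => // i Ni; exists i => //; apply/ltW; exact: NP.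
have [_ [[i ei <-] li]] := ul _ _ small (nbhsx_ballx l e e0).
have /andP[d0 _] := seq_d i.
exists i.+1%:R^-1, (p i); split; [by rewrite d0|by have [] := pP i|move=> k].
move: li; rewrite -ball_normE /= => li.
have := @row_entry_le R RealScalars _ (l - u i) (enum_rank k).
rewrite !mxE enum_rankK => /= h.
by rewrite distrC; apply: (le_trans h); apply: ltW.
Qed.

(** A left inverse of the matrix of spanning functionals recovers the coordinates from values
    bounded by the norm. *)
Lemma coord_bounded (R : realType) (k : scalar_kind) (n : nat)
    (X : normedModType (scalars R k)) (f : {linear X -> 'rV[scalars R k]_n})
    (fi : 'rV[scalars R k]_n -> X) : cancel f fi -> cancel fi f ->
  exists c : R, forall x j, modulus (f x 0 j) <= c * real_norm x.
Proof.
move=> fK fiK; have [N [psi [psib /row_fullP[L LE]]]] := dual_ball_total fK fiK.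
exists (\sum_j \sum_q modulus (L j q)) => x j.
have -> : f x 0 j = \sum_q L j q * psi q x.
  transitivity ((L *m (functional_matrix fi psi *m (f x)^T)) j 0).
    by rewrite mulmxA LE mul1mx mxE.
  rewrite mxE; apply: eq_bigr => q _; congr (_ * _); have [ps _] := psib q.
  rewrite mxE (scalar_coord fK fiK)//; apply: eq_bigr => i _.
  by rewrite !mxE mulrC.
apply: (le_trans (modulus_sum _ _)); apply: (@le_trans _ _ (\sum_q modulus (L j q) * real_norm x)).
  apply: ler_sum => q _; rewrite modulusM ler_wpM2l ?modulus_ge0//.
  by have [_] := psib q.
rewrite -mulr_suml ler_wpM2r ?real_norm_ge0//.
rewrite (bigD1 j)//= lerDl sumr_ge0// => i _; apply: sumr_ge0 => q _.
exact: modulus_ge0.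
Qed.

Section hexagonal_norm.
Variable R : realType.
Local Notation K := (scalars R RealScalars).
Variables (X : normedModType K) (f : {linear X -> 'rV[K]_2}) (fi : 'rV[K]_2 -> X).
Hypotheses (fK : cancel f fi) (fiK : cancel fi f).
Hypothesis X_extremal : projection_constant X = (4 / 3)%:E.
Local Notation nrm := (@real_norm R RealScalars X).

(** The approximate data amount to eight real numbers: G0 and G2 on the basis, and the entries of T.
    They are bounded independently of d, and the estimates are continuous in them. *)
Lemma hexagonal_norm_data :
  exists (G0 G2 : X -> R) (T : 'M[R]_2),
    [/\ scalar (G0 : X -> K), scalar (G2 : X -> K),
        forall x, [/\ `|G0 x| <= nrm x, `|G2 x| <= nrm x & `|G0 x + G2 x| <= nrm x],
        forall x, nrm (fi (f x *m T)) <= 3^-1 * (`|G0 x| + `|G2 x| + `|G0 x + G2 x|) &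
        4 / 3 <= \tr T].
Proof.
pose I := ('I_2 + 'I_2 + 'I_2 * 'I_2)%type.
pose v x i : R := f x 0 i.
pose g0 (p : I -> R) x : R := \sum_i v x i * p (inl (inl i)).
pose g2 (p : I -> R) x : R := \sum_i v x i * p (inl (inr i)).
pose Tm (p : I -> R) : 'M[R]_2 := \matrix_(i, j) p (inr (i, j)).
pose P d p := [/\ forall x, [/\ `|g0 p x| <= (1 + d) * nrm x, `|g2 p x| <= (1 + d) * nrm x &
     `|g0 p x + g2 p x| <= (1 + d) * nrm x],
   forall x, nrm (fi (f x *m Tm p)) <=
          3^-1 * (`|g0 p x| + `|g2 p x| + `|g0 p x + g2 p x|) + d * nrm x &
        4 / 3 - d <= \tr (Tm p)].
have [c cP] := coord_bounded fK fiK.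
pose b i := basis_vector fi i.
pose B (k : I) : R := match k with
  | inl (inl i) => 2 * nrm (b i) | inl (inr i) => 2 * nrm (b i)
  | inr (i, _) => `|c| * (3 * nrm (b i)) end.
have nx (x : X) : 0 <= nrm x := real_norm_ge0 x.
have [d /andP[d0 d1]|l lP] := @bounded_cluster R I P B.
  have [|G0 [G2 [T [G0s G2s G_le T_le trT]]]] := near_hexagonal_norm fK fiK X_extremal (d := d).
    by rewrite d0.
  pose p (k : I) : R := match k with
    | inl (inl i) => G0 (b i) | inl (inr i) => G2 (b i) | inr (i, j) => T i j end.
  have g0E x : g0 p x = G0 x by rewrite (scalar_coord fK fiK _ G0s).
  have g2E x : g2 p x = G2 x by rewrite (scalar_coord fK fiK _ G2s).
  have TE : Tm p = T by apply/matrixP => i j; rewrite mxE.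
  exists p; split.
    by split=> [x|x|]; rewrite ?g0E ?g2E ?TE.
  have d2 (x : X) : (1 + d) * nrm x <= 2 * nrm x by rewrite ler_wpM2r//; lra.
  case=> [[i|i]|[i j]] /=.
  - by have [h _ _] := G_le (b i); apply: (le_trans h).
  - by have [_ h _] := G_le (b i); apply: (le_trans h).
  have -> : T i j = f (fi (f (b i) *m T)) 0 j :> R.
    rewrite fiK /b /basis_vector fiK -rowE mxE//.
  apply: (le_trans (cP _ _)); apply: (@le_trans _ _ (`|c| * nrm (fi (f (b i) *m T)))).
    by rewrite ler_wpM2r// ler_norm.
  rewrite ler_wpM2l//; apply: (le_trans (T_le _)).
  have [h1 h2 h3] := G_le (b i); have := d2 (b i).
  have : d * nrm (b i) <= 1 * nrm (b i) by rewrite ler_wpM2r.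
  by rewrite -[`|b i|]/(nrm (b i)); lra.
have v_lin a x y i : v (a *: x + y) i = (a : R) * v x i + v y i by rewrite /v linearP !mxE.
have comb_scalar (q : 'I_2 -> R) : scalar ((fun x => \sum_i v x i * q i) : X -> K).
  move=> a x y; transitivity (\sum_i ((a : R) * (v x i * q i) + v y i * q i)).
    by apply: eq_bigr => i _; rewrite v_lin; ring.
  by rewrite big_split /= -mulr_sumr.
pose S (x : X) := \sum_i `|v x i|.
have comb_close (q q' : 'I_2 -> R) e x : (forall i, `|q i - q' i| <= e) ->
    `|\sum_i v x i * q i - \sum_i v x i * q' i| <= e * S x.
  move=> qq; rewrite -sumrB /S mulr_sumr; apply: (le_trans (ler_norm_sum _ _ _)).
  by apply: ler_sum => i _; rewrite -mulrBr normrM mulrC ler_wpM2r.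
pose Nb := \sum_i nrm (b i).
have T_close (U U' : 'M[R]_2) e x : (forall i j, `|U i j - U' i j| <= e) ->
    nrm (fi (f x *m U')) <= nrm (fi (f x *m U)) + e * (S x * Nb).
  move=> UU; rewrite -[U'](subrK U) mulmxDr addrC.
  rewrite (linear_atD _ _ (coord_inv_linear fK fiK)).
  apply: (le_trans (real_normD _ _)); apply: lerD => //.
  rewrite (fi_sum fK fiK) mulrA mulr_sumr; apply: (le_trans (real_norm_sum _)).
  apply: ler_sum => j _; rewrite real_normZ ler_wpM2r//.
  rewrite mxE -[modulus _]/(`| _ : R|) mulr_sumr; apply: (le_trans (ler_norm_sum _ _ _)).
  by apply: ler_sum => i _; rewrite normrM mulrC !mxE ler_wpM2r// distrC.
have close e : 0 < e <= 1 -> exists p, [/\ P e p,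
    forall x, `|g0 p x - g0 l x| <= e * S x, forall x, `|g2 p x - g2 l x| <= e * S x &
    forall i j, `|Tm p i j - Tm l i j| <= e].
  move=> /andP[e0 e1]; have [d [p [/andP[d0 de] [pG pT ptr] pl]]] := lP e e0.
  have de' (x : X) : (1 + d) * nrm x <= (1 + e) * nrm x by rewrite ler_wpM2r// lerD2l.
  exists p; split.
  - split.
    + by move=> x; have [h1 h2 h3] := pG x; have h4 := de' x; split; exact: le_trans h4.
    + by move=> x; apply: (le_trans (pT x)); rewrite lerD2l ler_wpM2r.
    + by apply: le_trans ptr; rewrite lerD2l lerN2.
  - by move=> x; apply: comb_close => i; exact: pl.
  - by move=> x; apply: comb_close => i; exact: pl.
  - by move=> i j; rewrite !mxE; exact: pl.
have near (s t c' : R) : `|s - t| <= c' -> `|t| <= `|s| + c' /\ `|s| <= `|t| + c'.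
  move=> st; split.
    have -> : t = s - (s - t) by ring.
    by apply: (le_trans (ler_normB _ _)); rewrite lerD2l.
  have -> : s = t + (s - t) by ring.
  by apply: (le_trans (ler_normD _ _)); rewrite lerD2l.
have sum_close (s t s' t' c' : R) : `|s - t| <= c' -> `|s' - t'| <= c' ->
    `|(s + s') - (t + t')| <= 2 * c'.
  move=> h1 h2; rewrite opprD addrACA; apply: (le_trans (ler_normD _ _)); lra.
exists (g0 l), (g2 l), (Tm l); split; [exact: comb_scalar|exact: comb_scalar| | |].
- move=> x; split; apply: (@le_of_small_error _ _ _ (nrm x + 2 * S x)) => e e01;
    have [p [[pG _ _] p0 p2 _]] := close e e01; have [h1 h2 h3] := pG x;
    have e0 : 0 <= e * S x by apply: le_trans (p0 x).
  + by have [k _] := near _ _ _ (p0 x); lra.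
  + by have [k _] := near _ _ _ (p2 x); lra.
  + by have [k _] := near _ _ _ (sum_close _ _ _ _ _ (p0 x) (p2 x)); lra.
- move=> x; apply: (@le_of_small_error _ _ _ (nrm x + 2 * S x + S x * Nb)) => e e01.
  have [p [[_ pT _] p0 p2 pl]] := close e e01.
  have e0 : 0 <= e * S x by apply: le_trans (p0 x).
  have [_ k1] := near _ _ _ (p0 x); have [_ k2] := near _ _ _ (p2 x).
  have [_ k3] := near _ _ _ (sum_close _ _ _ _ _ (p0 x) (p2 x)).
  have := T_close _ _ e x pl; have := pT x; lra.
- apply: (@le_of_small_error _ _ _ 3) => e e01.
  have [p [[_ _ ptr] _ _ pl]] := close e e01.
  have tr2 (U : 'M[R]_2) : \tr U = U 0 0 + U 1 1.
    rewrite /mxtrace big_ord_recl big_ord1 (_ : lift ord0 ord0 = 1)//; exact: val_inj.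
  rewrite tr2 in ptr; have := pl 0 0; have := pl 1 1; rewrite !ler_norml tr2.
  by move=> /andP[? ?] /andP[? ?]; lra.
Qed.
End hexagonal_norm.

(** * Hexagonal norms *)

Section hexagonal_space.
Variable R : realType.
Local Notation K := (scalars R RealScalars).

Definition hexagon_norm (s t : R) : R := Num.max (Num.max `|s| `|t|) `|s + t|.

(** Among |s|, |t| and |s + t|, the largest is the sum of the other two. *)
Lemma hexagon_normE s t : `|s| + `|t| + `|s + t| = 2 * hexagon_norm s t.
Proof.
rewrite /hexagon_norm; case: (leP `|s| `|t|) => h1; case: leP => h2; move: h1 h2;
  by case: (ger0P s); case: (ger0P t); case: (ger0P (s + t)) => ? ? ? ? ?; lra.
Qed.

Lemma hexagon_norm_le s t c :
  (hexagon_norm s t <= c) = [&& `|s| <= c, `|t| <= c & `|s + t| <= c].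
Proof. by rewrite /hexagon_norm !ge_max andbA. Qed.

Lemma ord2P (i : 'I_2) : i = 0 \/ i = 1.
Proof. by case: i => -[|[|]] // ?; [left|right]; exact: val_inj. Qed.

Lemma det_mx2 (T : 'M[R]_2) : \det T = T 0 0 * T 1 1 - T 0 1 * T 1 0.
Proof.
rewrite (expand_det_row _ 0) big_ord_recl big_ord1 /cofactor !det_mx11 !mxE /=.
have -> : lift ord0 ord0 = 1 :> 'I_2 by exact: val_inj.
have -> : lift (1 : 'I_2) 0 = 0 by exact: val_inj.
by rewrite -[ord0]/(0 : 'I_2) /= expr0 expr1; ring.
Qed.

(** The test vectors (1, 0), (0, 1) and (1, -1) all have right side 2/3. The first two bound the
    diagonal entries by 2/3, so the trace makes them equal to 2/3. The off-diagonal entries are then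
    at most 0 by the first two vectors and at least 0 by the third. *)
Lemma hexagonal_trace_rigid (T : 'M[R]_2) :
  (forall y : 'rV[R]_2, hexagon_norm ((y *m T) 0 0) ((y *m T) 0 1) <=
     3^-1 * (`|y 0 0| + `|y 0 1| + `|y 0 0 + y 0 1|)) ->
  4 / 3 <= \tr T -> T = (2 / 3)%:M.
Proof.
move=> T_le; rewrite /mxtrace big_ord_recl big_ord1.
have l1 : lift ord0 ord0 = 1 :> 'I_2 by exact: val_inj.
rewrite l1 => trT.
pose row2 (s t : R) : 'rV[R]_2 := \row_j (if j == 0 then s else t).
have row2E s t j : (row2 s t *m T) 0 j = s * T 0 j + t * T 1 j.
  by rewrite mxE big_ord_recl big_ord1 l1 !mxE.
have := T_le (row2 1 0); have := T_le (row2 0 1); have := T_le (row2 1 (-1)).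
rewrite !hexagon_norm_le !row2E !mxE /= !mul1r !mul0r !mulN1r !addr0 !add0r subrr.
rewrite !normrN normr1 normr0 !ler_norml.
move=> /and3P[/andP[? ?] /andP[? ?] /andP[? ?]] /and3P[/andP[? ?] /andP[? ?] /andP[? ?]].
move=> /and3P[/andP[? ?] /andP[? ?] /andP[? ?]].
have [e00 e11] : T 0 0 = 2 / 3 /\ T 1 1 = 2 / 3.
  by rewrite -[ord0]/(0 : 'I_2) in trT; split; lra.
have [e01 e10] : T 0 1 = 0 /\ T 1 0 = 0 by split; lra.
apply/matrixP => i j; rewrite !mxE.
by case: (ord2P i) => ->; case: (ord2P j) => ->; rewrite ?e00 ?e11 ?e01 ?e10.
Qed.

Variables (X : normedModType K).
Hypothesis X_dim : has_dimension 2 X.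
Hypothesis X_extremal : projection_constant X = (4 / 3)%:E.
Local Notation nrm := (@real_norm R RealScalars X).

Lemma hexagonal_coordinates :
  exists G0 G2 : X -> R, [/\ scalar (G0 : X -> K), scalar (G2 : X -> K),
    forall x, nrm x = hexagon_norm (G0 x) (G2 x) &
    forall s t, exists x, G0 x = s /\ G2 x = t].
Proof.
have [f [fi fK fiK]] := X_dim.
have [G0 [G2 [T [G0s G2s G_le T_le trT]]]] := hexagonal_norm_data fK fiK X_extremal.
have fi_lin := coord_inv_linear fK fiK.
suff [] : (forall x, nrm x = hexagon_norm (G0 x) (G2 x)) /\
    (forall s t, exists x, G0 x = s /\ G2 x = t) by exists G0, G2.
pose Q : 'M[R]_2 := \matrix_(i, j) (if j == 0 then G0 else G2) (basis_vector fi i).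
have QE x : (f x *m Q) 0 0 = G0 x /\ (f x *m Q) 0 1 = G2 x.
  by split; rewrite (scalar_coord fK fiK) // mxE; apply: eq_bigr => i _; rewrite mxE.
have nx (x : X) : 0 <= nrm x := real_norm_ge0 x.
(* A vector annihilated by G0 and G2 is annihilated by T. A singular 2 x 2 matrix satisfies T^2 =
   (tr T) T, and T does not increase the norm; as tr T > 1, this would force T = 0. *)
have Qu : Q \in unitmx.
  rewrite -row_free_unit -kermx_eq0; apply/rowV0P => y /sub_kermxP yQ.
  apply: contrapT => y0.
  have yT : y *m T = 0.
    have := T_le (fi y); have [<- <-] := QE (fi y); rewrite fiK yQ !mxE addr0 normr0 !addr0 mulr0 => h.
    have /real_norm_eq0/(congr1 f) : nrm (fi (y *m T)) = 0 by apply/eqP; rewrite eq_le h nx.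
    by rewrite fiK linear0.
  have Tsing : \det T = 0.
    by apply/eqP/det0P; exists y => //; apply/eqP.
  have l1 : lift ord0 ord0 = 1 :> 'I_2 by exact: val_inj.
  have TT : T *m T = \tr T *: T.
    have := Tsing; rewrite det_mx2 => dT.
    apply/matrixP => i j; rewrite !mxE /mxtrace !big_ord_recl !big_ord0 !addr0 l1 -[ord0]/(0 : 'I_2).
    case: (ord2P i) => ->; case: (ord2P j) => ->; lra.
  have TT_le x : nrm (fi (f x *m T)) <= nrm x.
    have [h1 h2 h3] := G_le x; apply: (le_trans (T_le x)); lra.
  have t0 : 0 < \tr T by lra.
  have T0 : T = 0.
    apply/row_matrixP => i; rewrite row0 rowE; set w := delta_mx _ _.
    have := TT_le (fi (w *m T)); rewrite fiK -mulmxA TT -scalemxAr linear_atZ//.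
    rewrite real_normZ -[modulus _]/(`|\tr T|) gtr0_norm// => h.
    have /real_norm_eq0/(congr1 f) : nrm (fi (w *m T)) = 0.
      by apply/eqP; rewrite eq_le nx andbT; have := nx (fi (w *m T)); nra.
    by rewrite fiK linear0.
  by move: trT; rewrite T0 mxtrace0; lra.
have TQ : invmx Q *m T *m Q = (2 / 3)%:M.
  apply: hexagonal_trace_rigid.
    move=> y; pose x := fi (y *m invmx Q).
    have xQ : f x *m Q = y by rewrite fiK mulmxKV.
    have [h1 h2] := QE x; rewrite xQ in h1 h2; rewrite h1 h2.
    apply: le_trans (T_le x).
    have -> : y *m (invmx Q *m T *m Q) = f (fi (f x *m T)) *m Q by rewrite !fiK !mulmxA.
    have [-> ->] := QE (fi (f x *m T)).
    have [k1 k2 k3] := G_le (fi (f x *m T)).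
    by rewrite hexagon_norm_le k1 k2 k3.
  by rewrite mxtrace_mulC mulmxA mulmxV// mul1mx.
have TE : T = (2 / 3)%:M.
  rewrite -[LHS](mulmxK Qu) -[T *m Q](mulKVmx Qu) [invmx Q *m (T *m Q)]mulmxA TQ.
  by rewrite mul_mx_scalar -scalemxAl mulmxV// scalemx1.
split=> [x|s t].
  have : hexagon_norm (G0 x) (G2 x) <= nrm x by rewrite hexagon_norm_le; have [-> -> ->] := G_le x.
  have := T_le x; rewrite TE mul_mx_scalar linear_atZ// fK real_normZ hexagon_normE.
  have -> : modulus (2 / 3 : K) = 2 / 3 by rewrite /modulus /= ger0_norm// divr_ge0.
  by lra.
exists (fi ((\row_j (if j == 0 then s else t)) *m invmx Q)).
have [<- <-] := QE (fi ((\row_j (if j == 0 then s else t)) *m invmx Q)).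
by rewrite fiK mulmxKV// !mxE.
Qed.
End hexagonal_space.

Section hexagonal_space_geometry.
Variable R : realType.
Local Notation K := (scalars R RealScalars).

Definition is_hexagonal (X : normedModType K) := exists h : R -> R -> X,
  [/\ forall a s t s' t', h (a * s + s') (a * t + t') = (a : K) *: h s t + h s' t',
      forall s t, real_norm (h s t) = hexagon_norm s t &
      forall x, exists s t, x = h s t].

Lemma extremal_is_hexagonal (X : normedModType K) :
  has_dimension 2 X -> projection_constant X = (4 / 3)%:E -> is_hexagonal X.
Proof.
move=> Xn Xc; have [G0 [G2 [G0s G2s nE surj]]] := hexagonal_coordinates Xn Xc.
have inj x y : G0 x = G0 y -> G2 x = G2 y -> x = y.
  move=> e0 e2; have xy : x - y = (-1 : K) *: y + x by rewrite scaleN1r addrC.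
  have d0 : G0 (x - y) = 0 by rewrite xy G0s e0 mulN1r addNr.
  have d2 : G2 (x - y) = 0 by rewrite xy G2s e2 mulN1r addNr.
  apply/eqP; rewrite -subr_eq0; apply/eqP/real_norm_eq0.
  by rewrite nE d0 d2 /hexagon_norm addr0 normr0 !maxxx.
have [h' hP] := choice (fun st : R * R => surj st.1 st.2).
have h0 s t : G0 (h' (s, t)) = s := (hP (s, t)).1.
have h2 s t : G2 (h' (s, t)) = t := (hP (s, t)).2.
exists (fun s t => h' (s, t)); split.
- by move=> a s t s' t'; apply: inj; [rewrite G0s !h0|rewrite G2s !h2].
- by move=> s t; rewrite nE h0 h2.
- by move=> x; exists (G0 x), (G2 x); apply: inj; rewrite ?h0 ?h2.
Qed.

Lemma hexagonal_inj (X : normedModType K) (h : R -> R -> X) :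
  (forall a s t s' t', h (a * s + s') (a * t + t') = (a : K) *: h s t + h s' t') ->
  (forall s t, real_norm (h s t) = hexagon_norm s t) ->
  forall s t s' t', h s t = h s' t' -> s = s' /\ t = t'.
Proof.
move=> lin nE s t s' t' e.
have : real_norm (h (-1 * s' + s) (-1 * t' + t)) = 0.
  by rewrite lin scaleN1r e addNr real_norm0.
rewrite nE => hn; have : hexagon_norm (-1 * s' + s) (-1 * t' + t) <= 0 by rewrite hn.
by rewrite hexagon_norm_le !normr_le0 => /and3P[/eqP ? /eqP ? _]; lra.
Qed.

Lemma hexagonal_isometric (X Y : normedModType K) :
  is_hexagonal X -> is_hexagonal Y -> isometric X Y.
Proof.
move=> [h [hl hn hs]] [h' [hl' hn' hs']].
have [p pP] := choice hs; have [q qP] := choice (fun x => pP x).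
have [p' pP'] := choice hs'; have [q' qP'] := choice (fun x => pP' x).
pose S x := h' (p x) (q x).
have inj := hexagonal_inj hl hn; have inj' := hexagonal_inj hl' hn'.
have pq s t : p (h s t) = s /\ q (h s t) = t.
  by have [e1 e2] := inj _ _ _ _ (qP (h s t)).
have pq' s t : p' (h' s t) = s /\ q' (h' s t) = t.
  by have [e1 e2] := inj' _ _ _ _ (qP' (h' s t)).
have Slin : linear S.
  move=> a x y; rewrite {1}(qP x) {1}(qP y) -hl /S.
  by have [-> ->] := pq (a * p x + p y) (a * q x + q y); rewrite hl'.
pose SL : {linear X -> Y} := HB.pack S (GRing.isLinear.Build _ _ _ _ S Slin).
exists SL; split.
  exists (fun y => h (p' y) (q' y)) => x /=; rewrite /S.
    by have [-> ->] := pq' (p x) (q x); rewrite -qP.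
  by have [-> ->] := pq (p' x) (q' x); rewrite -qP'.
move=> x; apply: (etrans (hn' _ _)); rewrite -hn -qP//.
Qed.

(* The triple angle formula: cos (pi / 3) is a root of 4 c^3 - 3 c + 1. *)
Lemma cos_pi3 : cos (pi / 3) = 2^-1 :> R.
Proof.
have pi0 := pi_gt0 R.
have c0 : 0 < cos (pi / 3 : R) by apply: cos_gt0_pihalf; apply/andP; split; lra.
have : cos (pi / 3 + (pi / 3 + pi / 3) : R) = -1.
  by rewrite -[RHS](cospi R); congr cos; field.
rewrite cosD cosD sinD; have := cos2Dsin2 (pi / 3 : R).
set c := cos _ in c0 *; set s := sin _; move=> cs e.
have : (c + 1) * (2 * c - 1) ^+ 2 = 0.
  have ss : s * s = 1 - c * c by rewrite -cs; ring.
  rewrite (_ : _ * _ = c * c * c - 3 * c * (1 - c * c) + 1); last by ring.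
  by rewrite -ss; lra.
move/eqP; rewrite mulf_eq0 sqrf_eq0 gt_eqF/=; last by lra.
by move/eqP => ?; lra.
Qed.

Lemma sin_pi3 : sin (pi / 3) = sin60 R.
Proof.
have pi0 := pi_gt0 R.
have s0 : 0 < sin (pi / 3 : R) by apply: sin_gt0_pi; apply/andP; split; lra.
have := cos2Dsin2 (pi / 3 : R); rewrite cos_pi3.
have := sin60_sqr R; have := sin60_ge R.
move: (sin _) (sin60 R) s0 => s g s0 g0 gg ss.
have : (s - g) * (s + g) = 0 by lra.
by move/eqP; rewrite mulf_eq0 subr_eq0 [s + g == 0]gt_eqF ?orbF; [move/eqP|lra].
Qed.
End hexagonal_space_geometry.

(** * The unit ball as an affine regular hexagon *)

Section hexagonal_ball.
Variable R : realType.
Local Notation K := (scalars R RealScalars).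
Local Notation g := (sin60 R).

(* Coordinates of the vertices of a regular hexagon in the basis consisting of
   the first two of them. *)
Definition corner (i : 'I_6) : R * R :=
  nth (0, 0) [:: (1, 0); (0, 1); (-1, 1); (-1, 0); (0, -1); (1, -1)] i.

Lemma corner_norm i : hexagon_norm (corner i).1 (corner i).2 <= 1.
Proof.
rewrite hexagon_norm_le /corner.
by case: i => -[|[|[|[|[|[|//]]]]]] _ /=; rewrite ?addr0 ?add0r ?subrr ?addNr
  ?normrN ?normr1 ?normr0 lexx ?ler01.
Qed.

Lemma hexagon_vertexE i :
  hexagon_vertex 0 1 0 i =
  \row_j (if j == 0 then (corner i).1 + 2^-1 * (corner i).2 else g * (corner i).2).
Proof.
have rot n : cos (n.+1%:R * (pi / 3) : R) =
      2^-1 * cos (n%:R * (pi / 3)) - g * sin (n%:R * (pi / 3)) /\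
    sin (n.+1%:R * (pi / 3) : R) =
      g * cos (n%:R * (pi / 3)) + 2^-1 * sin (n%:R * (pi / 3)).
  rewrite -natr1 mulrDl mul1r cosD sinD cos_pi3 sin_pi3; split; ring.
have [c0 s0] : cos (0%:R * (pi / 3) : R) = 1 /\ sin (0%:R * (pi / 3) : R) = 0.
  by rewrite mul0r cos0 sin0.
have gg := sin60_sqr R.
have step n (c s c' s' : R) : cos (n%:R * (pi / 3) : R) = c -> sin (n%:R * (pi / 3) : R) = s ->
    2^-1 * c - g * s = c' -> g * c + 2^-1 * s = s' ->
    cos (n.+1%:R * (pi / 3) : R) = c' /\ sin (n.+1%:R * (pi / 3) : R) = s'.
  by move=> <- <- <- <-; exact: rot.
have [c1 s1] : cos (1%:R * (pi / 3) : R) = 2^-1 /\ sin (1%:R * (pi / 3) : R) = g.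
  by apply: step c0 s0 _ _; lra.
have [c2 s2] : cos (2%:R * (pi / 3) : R) = - 2^-1 /\ sin (2%:R * (pi / 3) : R) = g.
  by apply: step c1 s1 _ _; lra.
have [c3 s3] : cos (3%:R * (pi / 3) : R) = - 1 /\ sin (3%:R * (pi / 3) : R) = 0.
  by apply: step c2 s2 _ _; lra.
have [c4 s4] : cos (4%:R * (pi / 3) : R) = - 2^-1 /\ sin (4%:R * (pi / 3) : R) = - g.
  by apply: step c3 s3 _ _; lra.
have [c5 s5] : cos (5%:R * (pi / 3) : R) = 2^-1 /\ sin (5%:R * (pi / 3) : R) = - g.
  by apply: step c4 s4 _ _; lra.
rewrite /hexagon_vertex add0r scale1r; apply/rowP => j; rewrite !mxE add0r.
have -> : (j == ord0) = (j == 0) by [].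
rewrite /corner; case: i => -[|[|[|[|[|[|//]]]]]] _ /=; case: eqP => _;
  rewrite ?(c0, s0, c1, s1, c2, s2, c3, s3, c4, s4, c5, s5); lra.
Qed.

Lemma corner_combination s t : hexagon_norm s t <= 1 ->
  exists w : 'I_6 -> R, [/\ forall i, 0 <= w i, \sum_i w i = 1,
    \sum_i w i * (corner i).1 = s & \sum_i w i * (corner i).2 = t].
Proof.
rewrite hexagon_norm_le !ler_norml => /and3P[/andP[s1 s2] /andP[t1 t2] /andP[u1 u2]].
suff [w0 [w1 [w2 [w3 [w4 [w5 [[p0 p1 p2] [p3 p4 p5] sum eqs]]]]]]] :
    exists w0 w1 w2 w3 w4 w5 : R, [/\ [/\ 0 <= w0, 0 <= w1 & 0 <= w2],
      [/\ 0 <= w3, 0 <= w4 & 0 <= w5], w0 + w1 + w2 + w3 + w4 + w5 = 1 &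
      w0 - w2 - w3 + w5 = s /\ w1 + w2 - w4 - w5 = t].
  exists (fun i => nth 0 [:: w0; w1; w2; w3; w4; w5] i).
  split; rewrite ?big_ord_recl ?big_ord0 /corner /=.
  - by case=> -[|[|[|[|[|[|//]]]]]].
  - by rewrite -sum; ring.
  - by rewrite -eqs.1; ring.
  - by rewrite -eqs.2; ring.
(* Two adjacent corners produce (s, t) with total weight n, its norm; the remaining mass 1 - n is
   shared equally by the opposite corners 0 and 3, which cancel. *)
pose c (n : R) : R := (1 - n) / 2.
have [s0|s0] := leP 0 s; have [t0|t0] := leP 0 t; have [u0|u0] := leP 0 (s + t).
- by exists (s + c (s + t)), t, 0, (c (s + t)), 0, 0; rewrite /c; split; [split|split| |split]; lra.
- by lra.
- by exists (s + t + c s), 0, 0, (c s), 0, (- t); rewrite /c; split; [split|split| |split]; lra.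
- by exists (c (- t)), 0, 0, (c (- t)), (- (s + t)), s; rewrite /c; split; [split|split| |split]; lra.
- by exists (c t), (s + t), (- s), (c t), 0, 0; rewrite /c; split; [split|split| |split]; lra.
- by exists (c (- s)), 0, t, (- (s + t) + c (- s)), 0, 0; rewrite /c; split; [split|split| |split]; lra.
- by lra.
- by exists (c (- (s + t))), 0, 0, (- s + c (- (s + t))), (- t), 0; rewrite /c; split; [split|split| |split]; lra.
Qed.

Lemma hexagonal_ball (X : normedModType K) :
  is_hexagonal X -> unit_ball_is_affine_regular_hexagon (X : normedModType R).
Proof.
move=> [h [hl hn hs]].
have g1 := sin60_ge R; have g0 : g != 0 by apply: lt0r_neq0; lra.
(* [h] after the inverse of (s, t) |-> (s + t / 2, g t), the map that takes the corners to the
   vertices. *)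
pose L (v : 'rV[R]_2) : X := h (v 0 0 - 2^-1 * (v 0 1 / g)) (v 0 1 / g).
have Llin : linear L.
  move=> a u v; rewrite /L -hl !mxE; congr h; field; exact: g0.
pose LL : {linear 'rV[R]_2 -> (X : normedModType R)} :=
  HB.pack L (GRing.isLinear.Build _ _ _ _ L Llin).
have LV i : L (hexagon_vertex 0 1 0 i) = h (corner i).1 (corner i).2.
  rewrite hexagon_vertexE /L !mxE /=; congr h; field; exact: g0.
exists (convex_hull (hexagon_vertex 0 1 0)), L; split.
- by exists 0, 1, 0; split.
- by exists LL, 0 => x; rewrite addr0.
have h0 : h 0 0 = 0 by apply/real_norm_eq0; rewrite hn /hexagon_norm addr0 normr0 !maxxx.
have hsum (w : 'I_6 -> R) : \sum_i (w i : K) *: h (corner i).1 (corner i).2 =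
    h (\sum_i w i * (corner i).1) (\sum_i w i * (corner i).2).
  elim/big_ind3: _ => // [x1 x2 x3 y1 y2 y3 -> ->|i _].
    by have := hl 1 x2 x1 y2 y1; rewrite !mul1r scale1r.
  by have := hl (w i) (corner i).1 (corner i).2 0 0; rewrite !addr0 h0 addr0.
have Lsum (w : 'I_6 -> R) : L (\sum_i w i *: hexagon_vertex 0 1 0 i) =
    \sum_i (w i : K) *: h (corner i).1 (corner i).2.
  rewrite -[L]/(LL : _ -> _) linear_sum; apply: eq_bigr => i _.
  by rewrite linearZ /= LV.
apply/seteqP; split => x /=.
  have [s [t ->]] := hs x => n1.
  have [|w [w0 w1 ws wt]] := @corner_combination s t.
    by rewrite -hn.
  exists (\sum_i w i *: hexagon_vertex 0 1 0 i); first by exists w.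
  by rewrite Lsum hsum ws wt.
move=> [_ [w [w0 w1 ->]] <-]; rewrite Lsum.
have : real_norm (\sum_i (w i : K) *: h (corner i).1 (corner i).2 : X) <= 1; last by [].
apply: (le_trans (real_norm_sum _)); rewrite -w1; apply: ler_sum => i _.
by rewrite real_normZ hn -[modulus _]/(`|w i|) ger0_norm// ler_piMr// corner_norm.
Qed.
End hexagonal_ball.

(** * Maximal spaces *)

Lemma isometric_common_source (K : numFieldType) (X Y Z : normedModType K) :
  isometric X Y -> isometric X Z -> isometric Y Z.
Proof.
move=> [S [[Si SK SiK] S_iso]] [T [[Ti TK TiK] T_iso]].
pose U y := T (Si y).
have U_lin : linear U.
  by move=> a x y; rewrite /U -linearP; congr (T _); apply: (can_inj SK); rewrite linearP !SiK.
pose UL : {linear Y -> Z} := HB.pack U (GRing.isLinear.Build _ _ _ _ U U_lin).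
exists UL; split.
  by exists (fun z => S (Ti z)) => x /=; rewrite /U ?SK ?TiK ?TK ?SiK.
by move=> y; rewrite /= T_iso -S_iso SiK.
Qed.

Section maximal_spaces.
Variables (R : realType) (k : scalar_kind) (n : nat).
Hypothesis n_ge2 : (2 <= n)%N.
Hypothesis ETF_n : maximal_ETF_exists R k n.

Lemma exists_maximal_space :
  max_projection_constant R k n = (etf_constant R k n)%:E /\
  exists X : normedModType (scalars R k), maximal_space n X.
Proof.
have [w w_etf] := ETF_n.
have w_w j : exists i, w i = w j by exists j.
have expand i : exists2 xi : 'I_(max_ETF_size k n) -> scalars R k,
    forall j, modulus (xi j) <= 1 &
    forall x, real_scalar (etf_sum R k n) * inner_product x (w i) =
      \sum_j xi j * inner_product x (w j).
  by have [xi [xi1 _ xiE]] := etf_self_expansion n_ge2 w_etf i; exists xi => // j; rewrite xi1.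
split; first exact: (max_projection_constantE n_ge2 w_etf w_w expand).
by exists (frame_space n_ge2 w_etf w_w); exact: frame_space_maximal.
Qed.

Lemma continuum_of_non_isometric : ~ (n = 2%N /\ k = RealScalars) ->
  exists X : R -> normedModType (scalars R k),
    (forall s, maximal_space n (X s)) /\ (forall s t, s <> t -> ~ isometric (X s) (X t)).
Proof.
have [w w_etf] := ETF_n.
move=> /(gap_vector n_ge2 w_etf)[g [h [xi [xi1 gE gap]]]].
exact: (continuum_of_maximal_spaces n_ge2 w_etf xi1 gE gap).
Qed.
End maximal_spaces.

Theorem corollary5p2 (R : realType) (k : scalar_kind) (n : nat)
    (n_ge2 : (2 <= n)%N) (ETF_n : maximal_ETF_exists R k n) :
  ((exists X : normedModType (scalars R k),
      maximal_space n X /\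
      forall Y : normedModType (scalars R k),
        maximal_space n Y -> isometric X Y)
   <-> n = 2%N /\ k = RealScalars) /\
  (n = 2%N /\ k = RealScalars ->
   forall X : normedModType (scalars R RealScalars),
     maximal_space n X -> unit_ball_is_affine_regular_hexagon X) /\
  (~ (n = 2%N /\ k = RealScalars) ->
   exists X : R -> normedModType (scalars R k),
     (forall s, maximal_space n (X s)) /\
     (forall s t, s <> t -> ~ isometric (X s) (X t))).
Proof.
have [mE [X0 X0_max]] := exists_maximal_space n_ge2 ETF_n.
have continuum := continuum_of_non_isometric n_ge2 ETF_n.
have hexagonal : n = 2%N /\ k = RealScalars ->
    forall X : normedModType (scalars R RealScalars), maximal_space n X -> is_hexagonal X.
  move=> [n2 kR] X; move: mE; rewrite kR n2 plane_constant => mE [X_dim X_max].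
  by apply: extremal_is_hexagonal => //; rewrite X_max.
split; [split=> [[X [X_max X_unique]]|nk]|split] => //.
- apply: contrapT => /continuum[Y [Y_max Y_distinct]].
  apply: (Y_distinct 0 1); first by apply/eqP; rewrite eq_sym oner_eq0.
  exact: (isometric_common_source (X_unique _ (Y_max 0)) (X_unique _ (Y_max 1))).
- exists X0; split=> // Y Y_max; case: nk (nk) hexagonal X0 X0_max Y Y_max => n2 kR nk.
  move: nk {continuum mE ETF_n}; rewrite kR => nk hexagonal X0 X0_max Y Y_max.
  by apply: hexagonal_isometric; exact: hexagonal.
- by move=> nk X X_max; apply: hexagonal_ball; exact: (hexagonal nk).
Qed.
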